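(* Let $N\ge 2$, $\beta=0$, $\alpha,\gamma,\mu>0$, $T=\infty$, and let $F$ be a symmetric equilibrium arrival distribution of the $(N+1)$-customer game (when arrivals before time zero are not allowed, suppose that the atom $p_0=F(0)$ at time zero satisfies $p_0<1$). Then there exists $\tau$ such that for all $t>\tau$ the hazard rate $h(t)=\frac{f(t)}{1-F(t)}$ is non-decreasing, i.e. $h(t+s)-h(t)\ge 0$ for all $s>0$, and therefore $F$ is light tailed: there exists $\eta>0$ such that $\lim_{t\to\infty}e^{\eta t}(1-F(t))<\infty$. Moreover, there exists some $\eta<\mu$ such that $$\lim_{t\to\infty}e^{\eta t}(1-F(t))=C,$$ where $0<C<\infty$.
   Context: Model. There are $N+1$ customers, each choosing (possibly at random, independently) an arrival time. A single server starts operating at time $0$ and serves First Come First Served; service times are i.i.d. exponential with rate $\mu$. There is no closing time. Customers arriving at exactly the same time are admitted in uniformly random order. Each customer pays $\alpha$ per unit of time from arrival until admission into service, and $\gamma$ for every customer ahead of him in the arrival order. Arrivals before time zero may either be allowed (admissible times $t\in\mathbb{R}$) or not (admissible times $t\ge0$). When the other $N$ customers arrive independently according to a cdf $F$, the expected cost of arriving at $t$ is $$c_F(t)=-\alpha t\,\mathbf{1}_{\{t<0\}}+\frac{\alpha}{\mu}\mathbb{E}Q(t)+\gamma\,\mathbb{E}A(t),$$ where $A(t)$ is the number of the other customers that have arrived up to time $t$ and $Q(t)$ is the number of them present in the system (in queue or in service) at time $t$; if $F$ has an atom at $t$, then of the customers arriving exactly at $t$ only those placed ahead by the random tie-breaking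 are counted. A symmetric equilibrium arrival distribution is a cdf $F$ for which there is a constant $c_e$ such that $c_F(t)=c_e$ for all $t$ in the support of $F$ and $c_F(t)\ge c_e$ for every admissible $t$. Only distributions $F$ whose support is, on any finite interval, a finite union of closed intervals and points are considered. The equilibrium distribution has a density for large $t$, characterized by $$f(t)=\frac{\alpha\left(1-\mathbb{P}(Q(t)=0)\right)}{N\left(\frac{\alpha}{\mu}+\gamma\right)},\qquad t\in[t_e,\infty),$$ where $t_e=0$ if arrivals before time zero are allowed, and otherwise $t_e>0$ is the start of the support beyond the atom at $0$; this $f$ is the density used in the hazard rate. *)

(* Defs.v *)
From HB Require Import structures.
From mathcomp Require Import all_boot all_order all_algebra.
From mathcomp Require Import all_classical all_reals all_analysis.

Set Implicit Arguments.
Unset Strict Implicit.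
Unset Printing Implicit Defensive.

Import Order.TTheory GRing.Theory Num.Theory.
Import numFieldNormedType.Exports.

Local Open Scope classical_set_scope.
Local Open Scope ring_scope.

Definition mutually_independent (R : realType) (d : measure_display)
    (T : measurableType d) (P : probability T R) (I : finType)
    (Z : I -> {RV P >-> R}) : Prop :=
  forall (J : {set I}) (B : I -> set R), (forall i, measurable (B i)) ->
    P (\bigcap_(i in [set` J]) (Z i @^-1` B i)) =
    (\prod_(i in J) fine (P (Z i @^-1` B i)))%:E.

(* The [N] customers other than a tagged one.  [None] indexes the tagged
   customer's tie-breaking mark; customers who arrive simultaneously are ordered
   by increasing i.i.d. uniform marks, i.e. in uniformly random order. *)
Record customers (R : realType) (d : measure_display) (T : measurableType d)
    (P : probability T R) (N : nat) (mu : R) (F : R -> R) := Customers {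
  arrival : 'I_N -> {RV P >-> R};
  service : 'I_N -> {RV P >-> R};
  mark : option 'I_N -> {RV P >-> R};
  arrival_law : forall i t, cdf (arrival i) t = (F t)%:E;
  service_law : forall i (B : set R), measurable B ->
    distribution P (service i) B = exponential_prob mu B;
  mark_law : forall i (B : set R), measurable B ->
    distribution P (mark i) B = uniform_prob (@ltr01 R) B;
  customers_indep : mutually_independent
    (fun k : 'I_N + 'I_N + option 'I_N =>
       match k with
       | inl (inl i) => arrival i
       | inl (inr i) => service i
       | inr i => mark i
       end)
}.

Section Queue.
Variables (R : realType) (d : measure_display) (T : measurableType d).
Variables (P : probability T R) (N : nat) (mu : R) (F : R -> R).
Variable M : customers P N mu F.

Definition arrives_before (w : T) : rel 'I_N := fun i j =>
  (arrival M i w < arrival M j w) ||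
  ((arrival M i w == arrival M j w) &&
   (mark M (Some i) w <= mark M (Some j) w)).

(* [i] is ahead of the tagged customer if the latter arrives at [t] *)
Definition ahead (t : R) (w : T) (i : 'I_N) : bool :=
  (arrival M i w < t) ||
  ((arrival M i w == t) && (mark M (Some i) w < mark M None w)).

Definition arrivals (t : R) (w : T) : seq 'I_N :=
  sort (arrives_before w) [seq i <- enum 'I_N | ahead t w i].

(* FCFS: a service starts at the latest of the customer's arrival and the
   previous departure; the initial value 0 is the opening time of the server. *)
Definition departures (t : R) (w : T) : seq R :=
  scanl (fun dep i => Num.max dep (arrival M i w) + service M i w) 0
    (arrivals t w).

Definition num_arrived (t : R) (w : T) : nat := size (arrivals t w).

Definition num_present (t : R) (w : T) : nat :=
  count (fun dep => t < dep) (departures t w).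

Definition cost (alpha gamma t : R) : R :=
  - alpha * t * (t < 0)%R%:R
  + alpha / mu * fine 'E_P[fun w => (num_present t w)%:R]
  + gamma * fine 'E_P[fun w => (num_arrived t w)%:R].

Definition prob_empty (t : R) : R :=
  fine (P [set w | num_present t w = 0%N]).

(* Where the cost is constant and [F] has a density f, at times t > 0, substitute
   d/dt E Q(t) = N f(t) - mu P(Q(t) > 0) into the differentiated cost and solve
   for f(t).  It is the density of an equilibrium [F] from the time on where the
   support of [F] is a half-line; before that it is only this formula. *)
Definition equilibrium_density (alpha gamma t : R) : R :=
  alpha * (1 - prob_empty t) / (N%:R * (alpha / mu + gamma)).

Definition hazard_rate (alpha gamma t : R) : R :=
  equilibrium_density alpha gamma t / (1 - F t).

End Queue.

Definition cdf_support (R : realType) (F : R -> R) : set R :=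
  [set t | forall e, 0 < e -> F (t - e) < F (t + e)].

(* Points are the degenerate intervals [x, x]. *)
Definition locally_finite_union_of_intervals (R : realType) (A : set R) : Prop :=
  forall a b : R, exists s : seq (R * R),
    A `&` `[a, b] = \bigcup_(I in [set` s]) `[I.1, I.2]%classic.

(* [early] tells whether arrivals before time zero are allowed. *)
Definition admissible (R : realType) (early : bool) : set R :=
  [set t | early || (0 <= t)].

Definition symmetric_equilibrium (R : realType) (d : measure_display)
    (T : measurableType d) (P : probability T R) (N : nat) (mu : R)
    (F : R -> R) (M : customers P N mu F) (early : bool) (alpha gamma : R) :
    Prop :=
  [/\ locally_finite_union_of_intervals (cdf_support F),
      cdf_support F `<=` admissible early &
      exists ce : R,
        (forall t, cdf_support F t -> cost M alpha gamma t = ce) /\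
        (forall t, admissible early t -> ce <= cost M alpha gamma t)].

(* Main.v *)
Require Import Defs.
From HB Require Import structures.
From mathcomp Require Import all_boot all_order all_algebra.
From mathcomp Require Import all_classical all_reals all_analysis.
From mathcomp Require Import measurable_realfun.
From mathcomp Require Import ring lra zify.

(* Let Q(t) be the number of customers present, G = 1 - F and f = F'.  An atom
   is never optimal, since arriving slightly earlier jumps the queue of the
   tied customers; nor is a gap in the support, during which only departures
   happen.  Hence the support contains a half-line, on which the cost is
   constant; letting t tend to infinity, the constant is gamma N, so there
   E Q = kappa G with kappa = mu gamma N / alpha.  As customers leave at rate
   mu P(Q > 0), this gives f = c P(Q > 0) with c = mu / (N + kappa), and the
   hazard rate is h = eta - c E(Q - 1)^+ / G with eta = c kappa < mu.  So
   everything follows if u = E(Q - 1)^+ / G eventually decreases, exponentially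
   fast: then h increases and (ln (e^(eta t) G))' = c u is integrable.

   Write q^J_k = P(Q^J >= k) where Q^J is the queue formed by the customers in J
   alone.  Since a customer who has not arrived yet is independent of the queue
   formed by the others,
     (q^J_k)' = - mu (q^J_k - q^J_(k+1)) + f sum_(i in J) (q^(J-i)_(k-1) - q^(J-i)_k),
   and q^(J-i)_k <= q^J_k.  With P_k = q^J_k for the full J one gets in turn
   P_k / G -> 0 for k >= 2, hence h -> eta; P_(k+1) / P_k -> 0 for k >= 2;
   q^(J-i)_1 / G -> (N - 1) eta / (mu - eta); the sharp asymptotic upper bound
   for G^2 / P_2; and these make u' <= - epsilon u. *)

Set Implicit Arguments.
Unset Strict Implicit.
Unset Printing Implicit Defensive.

Import Order.TTheory GRing.Theory Num.Theory.
Import numFieldNormedType.Exports.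

Local Open Scope classical_set_scope.
Local Open Scope ring_scope.

(** * First come, first served *)

Section Fcfs.
Variables (R : realType) (I : eqType) (x s : I -> R).

Definition serve (dep : R) (i : I) : R := Num.max dep (x i) + s i.

Hypothesis s_gt0 : forall i, 0 < s i.

Lemma lt_serve d i : d < serve d i.
Proof. by rewrite /serve (le_lt_trans (_ : d <= Num.max d (x i))) ?le_max ?lexx// ltrDl. Qed.

Lemma serve_homo i : {homo serve^~ i : d d' / d <= d'}.
Proof. by move=> d d' dd'; rewrite /serve lerD2r ge_max !le_max dd' lexx orbT. Qed.

Lemma all_gt_scanl_serve (t : R) d l :
  t <= d -> all (fun e => (t < e)%R) (scanl serve d l).
Proof.
elim: l d => //= i l IH d td.
have td' := le_lt_trans td (lt_serve d i).
by rewrite td' IH// ltW.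
Qed.

Lemma count_scanl_serve (t : R) d l k : (0 < k <= size l)%N ->
  (k <= count (fun e => (t < e)%R) (scanl serve d l))%N =
  (t < foldl serve d (take (size l - k).+1 l)).
Proof.
elim: l d => [|i l IH] d /=; first by case: k.
move=> /andP[k0]; rewrite leq_eqVlt => /orP[/eqP ->|]; rewrite ?ltnS.
  rewrite subnn take0 /=; have [td|td] := ltP t (serve d i).
    have := all_gt_scanl_serve l (ltW td).
    by rewrite all_count size_scanl => /eqP ->; rewrite add1n leqnn.
  rewrite add0n; apply/negbTE; rewrite -ltnNge ltnS.
  by rewrite (leq_trans (count_size _ _))// size_scanl.
move=> kl; rewrite subSn//= -IH ?k0//.
have [td|//] := ltP t (serve d i).
have := all_gt_scanl_serve l (ltW td).
rewrite all_count size_scanl => /eqP ->.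
by rewrite kl add1n (leq_trans kl).
Qed.

Lemma count_scanl_serve_subseq (t : R) d d' l l' : d' <= d -> subseq l' l ->
  (count (fun e => (t < e)%R) (scanl serve d' l') <=
   count (fun e => (t < e)%R) (scanl serve d l))%N.
Proof.
elim: l l' d d' => [|i l IH] [|i' l'] d d' dd' //=.
case: eqP => [->|_] sub.
  have h := @serve_homo i _ _ dd'.
  apply: leq_add; last exact: IH.
  by have [/lt_le_trans/(_ h) -> /=|_] := ltP t (serve d' i); rewrite ?leq0n.
rewrite -[leqLHS]/(count _ (scanl serve d' (i' :: l'))).
apply: leq_trans (leq_addl _ _).
by apply: IH => //; apply: le_trans dd' (ltW (lt_serve _ _)).
Qed.

Lemma count_scanl_serve_late (t : R) d l : (forall i, i \in l -> t <= x i) ->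
  count (fun e => (t < e)%R) (scanl serve d l) = size l.
Proof.
elim: l d => //= i l IH d tl.
rewrite IH; last by move=> j jl; rewrite tl// in_cons jl orbT.
suff -> : t < serve d i by [].
rewrite /serve (le_lt_trans (_ : t <= Num.max d (x i))) ?ltrDl//.
by rewrite le_max tl ?orbT// mem_head.
Qed.

Lemma count_scanl_serve_cat (t : R) d l l' : (forall i, i \in l' -> t <= x i) ->
  count (fun e => (t < e)%R) (scanl serve d (l ++ l')) =
  (count (fun e => (t < e)%R) (scanl serve d l) + size l')%N.
Proof. by move=> tl; rewrite scanl_cat count_cat (@count_scanl_serve_late t _ l')//. Qed.

Lemma count_scanl_serve_long (t : R) d l i : 0 <= d -> i \in l ->
  t < s i -> (0 < count (fun e => (t < e)%R) (scanl serve d l))%N.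
Proof.
elim: l d => //= j l IH d d0; rewrite in_cons => /orP[/eqP <-|il] ts.
  suff -> : t < serve d i by [].
  by rewrite (lt_le_trans ts)// /serve lerDr le_max d0.
apply: leq_trans (leq_addl _ _).
by apply: IH => //; apply: le_trans d0 (ltW (lt_serve _ _)).
Qed.

Lemma count_scanl_serve_all_long (t : R) d l : 0 <= d ->
  (forall i, i \in l -> t < s i) ->
  count (fun e => (t < e)%R) (scanl serve d l) = size l.
Proof.
elim: l d => //= j l IH d d0 tl.
rewrite IH; last 2 first.
- exact: le_trans d0 (ltW (lt_serve _ _)).
- by move=> i il; rewrite tl// in_cons il orbT.
suff -> : t < serve d j by [].
by rewrite (lt_le_trans (tl j _)) ?mem_head// /serve lerDr le_max d0.
Qed.

Lemma foldl_serve_le d l : 0 <= d ->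
  foldl serve d l <= d + \sum_(i <- l) (`|x i| + s i).
Proof.
elim: l d => [|i l IH] d d0 /=; first by rewrite big_nil addr0.
rewrite (le_trans (IH _ (le_trans d0 (ltW (lt_serve _ _)))))// big_cons addrA lerD2r.
rewrite /serve addrA lerD2r ge_max lerDl normr_ge0/=.
by rewrite (le_trans (ler_norm _))// lerDr.
Qed.

End Fcfs.

(** * Real functions on a half-line *)

Section QuadraticEstimate.
Context (R : realType) (phi psi : R -> R) (a C : R).
Hypothesis C0 : 0 <= C.
Hypothesis est : forall s t, a <= s -> s < t ->
  `|phi t - phi s - (t - s) * psi s| <= C * (t - s) ^+ 2.

Lemma quadratic_estimate_continuous (B : R) t : (forall s, a <= s -> `|psi s| <= B) ->
  a < t -> {for t, continuous phi}.
Proof.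
move=> psiB at_; have B0 : 0 <= B by apply: le_trans (psiB t (ltW at_)).
have lip s u : a <= s -> s < u -> u <= s + 1 -> `|phi u - phi s| <= (B + C) * (u - s).
  move=> as_ su us; have us0 : 0 < u - s by rewrite subr_gt0.
  have h1 := est as_ su; have h2 := psiB s as_.
  have h3 : `|(u - s) * psi s| <= (u - s) * B by rewrite normrM gtr0_norm// ler_pM2l.
  have h4 : C * (u - s) ^+ 2 <= C * (u - s).
    rewrite ler_wpM2l// expr2 ler_piMl ?(ltW us0)//; lra.
  move: h1 h3; rewrite !ler_norml => /andP[? ?] /andP[? ?]; apply/andP; split; lra.
have K0 : 0 < B + C + 1 by have := C0; lra.
apply/cvgrPdist_le => e e0; near=> u.
have au : a < u by near: u; exact: lt_nbhsr.
have : `|t - u| < Num.min 1 (e / (B + C + 1)).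
  near: u; apply: (@cvgr_dist_lt _ _ _ _ _ id t) => //.
  by rewrite lt_min ltr01 divr_gt0.
rewrite lt_min => /andP[tu1]; rewrite ltr_pdivlMr// => tue.
have [ut|tu|->] := ltgtP u t; last by rewrite subrr normr0 ltW.
  move: tu1 tue; rewrite gtr0_norm ?subr_gt0// => tu1 tue.
  apply: le_trans (lip _ _ (ltW au) ut _) _; first by lra.
  have : 0 < t - u by lra.
  by set x := t - u in tue *; nra.
move: tu1 tue; rewrite ltr0_norm ?subr_lt0// opprB => tu1 tue.
rewrite distrC; apply: le_trans (lip _ _ (ltW at_) tu _) _; first by lra.
have : 0 < u - t by lra.
by set x := u - t in tue *; nra.
Unshelve. all: by end_near. Qed.

Lemma quadratic_estimate_derive t : {for t, continuous psi} -> a < t ->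
  is_derive t 1 phi (psi t).
Proof.
move=> cpsi at_.
suff h : (fun h => h^-1 *: (phi (h *: 1 + t) - phi t)) @ 0^' --> psi t.
  by apply: DeriveDef; [apply/cvg_ex; exists (psi t)|rewrite /derive; exact/cvg_lim].
have K0 : 0 < C + 1 by have := C0; lra.
have CK : C <= C + 1 by lra.
apply/cvgrPdist_le => e e0; near=> h.
have h0 : h != 0 by near: h; exact: nbhs_dnbhs_neq.
have hC : `|h| * (C + 1) <= e / 2.
  rewrite -ler_pdivlMr//.
  near: h; apply: dnbhs0_le; by rewrite !divr_gt0.
have ha : a < h + t.
  have : `|h| < t - a by near: h; apply: dnbhs0_lt; rewrite subr_gt0.
  by rewrite ltr_norml => /andP[]; lra.
have hpsi : `|psi t - psi (h + t)| <= e / 2.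
  near: h; have e2 : 0 < e / 2 by rewrite divr_gt0.
  have /cvgrPdist_le/(_ _ e2) := cpsi.
  have : h + t @[h --> 0^'] --> t.
    rewrite -[X in _ --> X]add0r; apply: cvgD; last exact: cvg_cst.
    by apply: cvg_within_filter.
  by move=> /[apply].
rewrite /GRing.scale/= mulr1.
have key : `|phi (h + t) - phi t - h * psi (h + t)| <= C * h ^+ 2 \/
           `|phi (h + t) - phi t - h * psi t| <= C * h ^+ 2.
  have [hn|hp|hE] := ltgtP h 0; [left|right|by rewrite hE eqxx in h0].
    have := est (ltW ha) (_ : h + t < t); rewrite gtrDr => /(_ hn).
    rewrite (_ : t - (h + t) = - h); last by ring.
    rewrite sqrrN -normrN; apply: le_trans; rewrite le_eqVlt; apply/orP; left; apply/eqP.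
    by congr `|_|; ring.
  have := est (ltW at_) (_ : t < h + t); rewrite ltrDr => /(_ hp).
  by rewrite (_ : h + t - t = h); last by ring.
have nh : 0 < `|h| by rewrite normr_gt0.
rewrite -(ler_pM2l nh) -normrM mulrBr mulrA divff// mul1r.
have h2 : C * h ^+ 2 <= `|h| * (e / 2).
  have -> : h ^+ 2 = `|h| * `|h| by rewrite -expr2 real_normK// num_real.
  by rewrite mulrCA ler_pM2l// (le_trans _ hC)// mulrC ler_pM2l.
have h3 : `|h * psi t - h * psi (h + t)| <= `|h| * (e / 2) by rewrite -mulrBr normrM ler_pM2l.
have e2 : `|h| * e = `|h| * (e / 2) + `|h| * (e / 2) by rewrite -mulrDr -splitr.
have pos : 0 <= `|h| * (e / 2) by rewrite mulr_ge0// divr_ge0// ltW.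
case: key => [k1|k1]; have := le_trans k1 h2; move: h3; rewrite e2 !ler_norml;
  set X := _ * (e / 2) in pos *; move=> /andP[? ?] /andP[? ?]; apply/andP; split; lra.
Unshelve. all: by end_near. Qed.

End QuadraticEstimate.

Section Comparison.
Context (R : realType) (phi dphi : R -> R) (a : R).
Hypothesis dphiE : forall t, a < t -> is_derive t 1 phi (dphi t).

Lemma within_continuous_halfline s t : a < s -> {within `[s, t], continuous phi}.
Proof.
move=> as_; apply: derivable_within_continuous => x; rewrite in_itv/= => /andP[sx _].
by have [] := dphiE (lt_le_trans as_ sx).
Qed.

Lemma mvt_halfline s t : a < s -> s < t ->
  exists2 c, s < c < t & phi t - phi s = dphi c * (t - s).
Proof.
move=> as_ st.
have d x : x \in `]s, t[ -> is_derive x 1 phi (dphi x).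
  by rewrite in_itv/= => /andP[sx _]; apply: dphiE; exact: lt_trans sx.
have [c] := MVT st d (@within_continuous_halfline s t as_).
by rewrite in_itv/= => cst e; exists c.
Qed.

(* Above the level [L] the function decreases at a definite rate, so it
   crosses [L], and it cannot cross back. *)
Lemma eventually_below (L delta : R) :
  (forall t, a < t -> 0 <= phi t) -> 0 < delta ->
  (\forall t \near +oo, L <= phi t -> dphi t <= - delta) ->
  \forall t \near +oo, phi t <= L.
Proof.
move=> phi0 delta0 [A [_ HA]].
pose B := Num.max A a + 1.
have AB : A < B by rewrite (@le_lt_trans _ _ (Num.max A a)) ?le_max ?lexx ?ltrDl.
have aB : a < B by rewrite (@le_lt_trans _ _ (Num.max A a)) ?le_max ?lexx ?orbT ?ltrDl.
have [t1 [Bt1 lt1]] : exists t1, B <= t1 /\ phi t1 < L.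
  apply: contrapT => no.
  have ge t : B <= t -> L <= phi t.
    by move=> Bt; rewrite leNgt; apply/negP => h; apply: no; exists t.
  pose t := B + (phi B / delta + 1).
  have phiB : 0 <= phi B / delta by rewrite divr_ge0 ?phi0// ltW.
  have Bt : B < t by rewrite ltrDl ltr_wpDl.
  have [c /andP[Bc ct] e] := mvt_halfline aB Bt.
  have dc : dphi c <= - delta by apply: HA; [exact: lt_trans Bc|exact/ge/ltW].
  have pt : 0 <= phi t by apply: phi0; exact: lt_trans Bt.
  have h : dphi c * (t - B) <= - delta * (t - B) by rewrite ler_wpM2r// subr_ge0 ltW.
  have tB : delta * (t - B) = phi B + delta.
    by rewrite /t addrC addKr mulrDr mulr1 mulrCA divff ?mulr1// gt_eqF.
  by move: h; rewrite mulNr tB -e; lra.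
exists t1; split; first exact: num_real.
move=> t2 t12; rewrite leNgt; apply/negP => lt2.
have at1 : a < t1 by exact: lt_le_trans Bt1.
have [c] := EVT_max (ltW t12) (@within_continuous_halfline t1 t2 at1).
rewrite in_itv/= => /andP[t1c ct2] cmax.
have Lc : L < phi c by apply: lt_le_trans lt2 (cmax _ _); rewrite in_itv/= (ltW t12) lexx.
have {}t1c : t1 < c.
  by rewrite lt_neqAle t1c andbT; apply: contraTneq Lc => <-; rewrite -leNgt ltW.
have cc : {for c, continuous phi}.
  apply: differentiable_continuous; apply/derivable1_diffP.
  by have [] := dphiE (lt_trans at1 t1c).
have nearc : \forall x \near c, L < phi x by apply: cvgr_gt cc _ Lc.
have [r /= r0 hr] := (nbhs_ballP _ _).1 nearc.
pose u := Num.max t1 (c - r / 2).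
have uc : u < c by rewrite gt_max t1c/= gtrBl divr_gt0.
have t1u : t1 <= u by rewrite le_max lexx.
have [x /andP[ux xc] e] := mvt_halfline (lt_le_trans at1 t1u) uc.
have dx : dphi x <= - delta.
  apply: HA; first by rewrite (lt_le_trans AB)// (le_trans Bt1)// (le_trans t1u)// ltW.
  apply: ltW; apply: hr; rewrite /ball/= gtr0_norm ?subr_gt0//.
  have : c - r / 2 < x by apply: le_lt_trans ux; rewrite le_max lexx orbT.
  by lra.
have : phi u <= phi c by apply: cmax; rewrite in_itv/= t1u (le_trans (ltW uc)).
have : dphi x * (c - u) < 0 by rewrite nmulr_rlt0 ?subr_gt0// (le_lt_trans dx)// oppr_lt0.
by rewrite -e; lra.
Qed.

End Comparison.

(** * Asymptotics of the forward equations *)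

Lemma is_derive_ratio (R : realType) (f g : R -> R) (df dg t : R) :
  is_derive t 1 f df -> is_derive t 1 g dg -> g t != 0 ->
  is_derive t 1 (fun u => f u / g u) ((df - f t / g t * dg) / g t).
Proof.
move=> hf hg g0; have hgV := is_deriveV g0 hg.
have := is_deriveM hf hgV.
rewrite (_ : f t *: (- g t ^- 2 *: dg) + (g t)^-1 *: df = (df - f t / g t * dg) / g t)//.
by rewrite /GRing.scale/=; field.
Qed.

Section Asymptotics.
Context (R : realType) (N : nat) (q : {set 'I_N} -> nat -> R -> R) (G : R -> R).
Variables (a mu kappa : R).

Local Notation everyone := [set: 'I_N]%SET.
Local Notation P k := (q everyone k).

Let n : R := N%:R.
Let c : R := mu / (n + kappa).
Let eta : R := c * kappa.

Definition drift (J : {set 'I_N}) (k : nat) (s : R) : R :=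
  - mu * (q J k.+1 s - q J k.+2 s) +
  c * P 1 s * \sum_(i in J) (q (J :\ i) k s - q (J :\ i) k.+1 s).

Hypothesis N_ge2 : (2 <= N)%N.
Hypothesis mu_gt0 : 0 < mu.
Hypothesis kappa_gt0 : 0 < kappa.
Hypothesis G_gt0 : forall t, a < t -> 0 < G t.
Hypothesis G_cvg0 : G t @[t --> +oo] --> (0 : R).
Hypothesis q_ge0 : forall J k t, 0 <= q J k t.
Hypothesis q_0 : forall J t, q J 0 t = 1.
Hypothesis q_anti : forall J k t, q J k.+1 t <= q J k t.
Hypothesis q_subset : forall (J J' : {set 'I_N}) k t, J' \subset J -> q J' k t <= q J k t.
Hypothesis q_gt : forall (J : {set 'I_N}) k t, (#|J| < k)%N -> q J k t = 0.
Hypothesis P_gt0 : forall t, a < t -> 0 < P N t.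
Hypothesis sumP : forall t, a < t -> \sum_(k < N) P k.+1 t = kappa * G t.
Hypothesis dG : forall t, a < t -> is_derive t 1 G (- (c * P 1 t)).
Hypothesis dq : forall J k t, a < t -> is_derive t 1 (q J k.+1) (drift J k t).

Let n_ge2 : 2 <= n. Proof. by rewrite ler_nat. Qed.

Let nk_gt0 : 0 < n + kappa. Proof. by have := n_ge2; have := kappa_gt0; lra. Qed.

Let c_gt0 : 0 < c. Proof. by rewrite divr_gt0. Qed.

Let eta_gt0 : 0 < eta. Proof. by rewrite mulr_gt0. Qed.

Let muE : mu = c * n + eta.
Proof. by rewrite /eta -mulrDr /c mulfVK// lt0r_neq0. Qed.

Let eta_lt_mu : eta < mu.
Proof. by rewrite muE ltrDr mulr_gt0//; have := n_ge2; lra. Qed.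

Let P_anti k l t : (k <= l)%N -> P l t <= P k t.
Proof.
by move=> /subnK <-; elim: (l - k)%N => // m; apply: le_trans; rewrite addSn; exact: q_anti.
Qed.

Let h t : R := c * P 1 t / G t.

Let P1_le t : a < t -> P 1 t <= kappa * G t.
Proof.
move=> at_; rewrite -sumP// (bigD1 (Ordinal (ltnW N_ge2)))//= lerDl.
by apply: sumr_ge0 => k _; exact: q_ge0.
Qed.

Let rate_le t : a < t -> c * P 1 t <= eta * G t.
Proof. by move=> at_; rewrite /eta -mulrA ler_pM2l// P1_le. Qed.

Let h_ge0 t : a < t -> 0 <= h t.
Proof.
move=> at_; apply: divr_ge0; last exact/ltW/G_gt0.
by apply: mulr_ge0 => //; exact: ltW.
Qed.

Let h_le t : a < t -> h t <= eta.
Proof. by move=> at_; rewrite ler_pdivrMr ?G_gt0// rate_le. Qed.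

Let hG t : a < t -> c * P 1 t = h t * G t.
Proof. by move=> at_; rewrite mulfVK// lt0r_neq0// G_gt0. Qed.

Let eventually_gt : \forall t \near +oo, a < t.
Proof. by apply: nbhs_pinfty_gt; exact: num_real. Qed.

Let G_small (e : R) : 0 < e -> \forall t \near +oo, G t <= e.
Proof.
move=> e0; near=> t; rewrite ltW//.
have : `|0 - G t| < e by near: t; move: (G_cvg0) => /cvgrPdist_lt; apply.
by rewrite sub0r normrN; apply: le_lt_trans; exact: ler_norm.
Unshelve. all: by end_near. Qed.

Let P_small k (e : R) : (0 < k)%N -> 0 < e -> \forall t \near +oo, P k t <= e.
Proof.
move=> k0 e0; near=> t; apply: le_trans (P_anti _ k0) _.
have at_ : a < t by near: t; exact: eventually_gt.
apply: le_trans (P1_le at_) _; rewrite mulrC -ler_pdivlMr//.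
by near: t; apply: G_small; rewrite divr_gt0.
Unshelve. all: by end_near. Qed.

Let inflow_le (J : {set 'I_N}) k t : \sum_(i in J) (q (J :\ i) k t - q (J :\ i) k.+1 t) <= n * q J k t.
Proof.
apply: (@le_trans _ _ (\sum_(i in J) q J k t)).
  by apply: ler_sum => i _; rewrite lerBlDr ler_wpDr// q_subset// subD1set.
by rewrite sumr_const -[leLHS]mulr_natl ler_wpM2r// ler_nat -[leqRHS]card_ord max_card.
Qed.

Let inflow_ge0 (J : {set 'I_N}) k t : 0 <= \sum_(i in J) (q (J :\ i) k t - q (J :\ i) k.+1 t).
Proof. by apply: sumr_ge0 => i _; rewrite subr_ge0 q_anti. Qed.

Let drift_le k t : a < t ->
  drift everyone k t <= - mu * (P k.+1 t - P k.+2 t) + eta * n * G t * P k t.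
Proof.
move=> at_; rewrite /drift lerD2l.
apply: (@le_trans _ _ (c * P 1 t * (n * P k t))).
  by rewrite ler_wpM2l ?inflow_le// mulr_ge0// ltW.
rewrite (_ : eta * n * G t * P k t = eta * G t * (n * P k t)); last by ring.
by rewrite ler_wpM2r ?rate_le// mulr_ge0//; have := n_ge2; lra.
Qed.

Let drift_ge k t : a < t -> - mu * (P k.+1 t - P k.+2 t) <= drift everyone k t.
Proof.
move=> at_; rewrite /drift lerDl mulr_ge0 ?inflow_ge0//.
by rewrite mulr_ge0// ltW.
Qed.

Let P_overflow k t : (N < k)%N -> P k t = 0.
Proof. by move=> Nk; rewrite q_gt// cardsT card_ord. Qed.

Let crowd_vs_tail k : (2 <= k)%N -> forall e : R, 0 < e ->
  \forall t \near +oo, P k t <= e * G t.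
Proof.
have : exists j, (N < k + j)%N by exists N.+1; rewrite addnS ltnS leq_addl.
case=> j; elim: j k => [|j IH] k.
  rewrite addn0 => Nk k2 e e0; near=> t; rewrite P_overflow// mulr_ge0// ltW//.
  by apply: G_gt0; near: t; exact: eventually_gt.
case: k => // k; rewrite addnS -addSn => kj k2 e e0.
have {}IH := IH k.+2 kj isT.
pose u t := P k.+1 t / G t.
pose du t := (drift everyone k t - u t * (- (c * P 1 t))) / G t.
have G0 t : a < t -> G t != 0 by move=> at_; rewrite lt0r_neq0// G_gt0.
have ud t : a < t -> is_derive t 1 u (du t).
  by move=> at_; apply: is_derive_ratio; [exact: dq|exact: dG|exact: G0].
pose d := (mu - eta) * e / 2.
have d0 : 0 < d by rewrite divr_gt0// mulr_gt0// subr_gt0.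
have d2 : 0 < d / 2 by apply: divr_gt0.
have n0 : 0 < n by have := n_ge2; lra.
have u0 t : a < t -> 0 <= u t by move=> at_; rewrite divr_ge0// ltW// G_gt0.
have main : \forall t \near +oo, u t <= e.
  apply: (eventually_below ud u0 d0); near=> t => ue.
  have at_ : a < t by near: t; exact: eventually_gt.
  have G0' := G_gt0 at_.
  have b1 : P k.+2 t <= (d / 2 / mu) * G t.
    by near: t; apply: IH; apply: divr_gt0.
  have b2 : P k t <= d / 2 / (eta * n).
    by near: t; apply: P_small => //; apply: divr_gt0 => //; apply: mulr_gt0.
  rewrite /du ler_pdivrMr//.
  have uG : P k.+1 t = u t * G t by rewrite /u mulfVK// G0.
  have dl := drift_le k at_.
  have b1' : mu * P k.+2 t <= d / 2 * G t.
    by rewrite mulrC -ler_pdivlMr// mulrAC.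
  have b2' : eta * n * G t * P k t <= d / 2 * G t.
    by rewrite mulrAC ler_pM2r// mulrC -ler_pdivlMr// mulr_gt0.
  have b3 : u t * (c * P 1 t) <= u t * (eta * G t) by rewrite ler_wpM2l ?u0// rate_le.
  have b4 : (mu - eta) * e * G t <= (mu - eta) * u t * G t.
    by rewrite ler_pM2r// ler_pM2l// subr_gt0.
  rewrite uG in dl; rewrite /d in b1' b2' *; lra.
near=> t; have at_ : a < t by near: t; exact: eventually_gt.
by rewrite -ler_pdivrMr ?G_gt0//; near: t.
Unshelve. all: by end_near. Qed.

Let n_gt0 : 0 < n. Proof. by have := n_ge2; lra. Qed.

Let P1_ge t : a < t -> kappa * G t <= P 1 t + n * P 2 t.
Proof.
move=> at_; rewrite -sumP// (bigD1 (Ordinal (ltnW N_ge2)))//= lerD2l.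
apply: (@le_trans _ _ (\sum_(k < N | k != Ordinal (ltnW N_ge2)) P 2 t)).
  apply: ler_sum => k k0; apply: P_anti.
  by move: k0; rewrite -val_eqE /= -lt0n.
rewrite sumr_const -[leLHS]mulr_natl ler_wpM2r// ler_nat.
by rewrite -[leqRHS]card_ord max_card.
Qed.

Let h_ge (e : R) : 0 < e -> \forall t \near +oo, eta - e <= h t.
Proof.
move=> e0; have cn0 : 0 < c * n by apply: mulr_gt0.
have e1 : 0 < e / (c * n) by apply: divr_gt0.
near=> t; have at_ : a < t by near: t; exact: eventually_gt.
have b : P 2 t <= e / (c * n) * G t by near: t; exact: crowd_vs_tail.
have G0 := G_gt0 at_; rewrite ler_pdivlMr//.
have b' : c * n * P 2 t <= e * G t by rewrite mulrC -ler_pdivlMr// mulrAC.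
have := P1_ge at_; rewrite -(ler_pM2l c_gt0) => b2.
rewrite /eta; lra.
Unshelve. all: by end_near. Qed.

Let crowd_ratio k : (2 <= k)%N -> forall e : R, 0 < e ->
  \forall t \near +oo, P k.+1 t <= e * P k t.
Proof.
have : exists j, (N <= k + j)%N by exists N; rewrite leq_addl.
case=> j; elim: j k => [|j IH] k.
  rewrite addn0 => Nk k2 e e0; near=> t; rewrite P_overflow ?ltnS//.
  by rewrite mulr_ge0// ltW.
move=> kj k2 e e0.
have [Nk|kN] := ltnP N k.
  near=> t; rewrite P_overflow ?(ltnW Nk)//; last by rewrite (leq_trans Nk).
  by rewrite mulr_ge0// ltW.
case: k kj k2 kN => // k; rewrite addnS -addSn => kj k2 kN.
have {}IH := IH k.+2 kj isT.
have Pk0 t : a < t -> 0 < P k.+1 t.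
  by move=> at_; apply: lt_le_trans (P_gt0 at_) _; exact: P_anti.
pose w t := P k.+2 t / P k.+1 t.
pose dw t := (drift everyone k.+1 t - w t * drift everyone k t) / P k.+1 t.
have wd t : a < t -> is_derive t 1 w (dw t).
  by move=> at_; apply: is_derive_ratio; [exact: dq|exact: dq|rewrite lt0r_neq0// Pk0].
have w0 t : a < t -> 0 <= w t by move=> at_; rewrite divr_ge0// ltW// Pk0.
have e20 : 0 < e ^+ 2 by rewrite exprn_gt0.
pose d := mu * e ^+ 2 / 2.
have d0 : 0 < d by rewrite /d; apply: divr_gt0 => //; apply: mulr_gt0.
have main : \forall t \near +oo, w t <= e.
  apply: (eventually_below wd w0 d0); near=> t => we.
  have at_ : a < t by near: t; exact: eventually_gt.
  have p0 := Pk0 _ at_.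
  have b1 : P k.+3 t <= (e ^+ 2 / 4) * P k.+2 t.
    by near: t; apply: IH; apply: divr_gt0.
  have b2 : G t <= mu * e ^+ 2 / 4 / (eta * n).
    near: t; apply: G_small; apply: divr_gt0; last exact: mulr_gt0.
    by apply: divr_gt0 => //; apply: mulr_gt0.
  have b3 : eta * n * G t <= mu * e ^+ 2 / 4.
    by rewrite mulrC -ler_pdivlMr//; apply: mulr_gt0.
  have w1 : w t <= 1 by rewrite ler_pdivrMr// mul1r.
  have wE : P k.+2 t = w t * P k.+1 t by rewrite mulfVK// lt0r_neq0.
  rewrite /dw ler_pdivrMr//.
  have dl := drift_le k.+1 at_; have dg := drift_ge k at_.
  have b4 : w t * (- mu * (P k.+1 t - P k.+2 t)) <= w t * drift everyone k t.
    by rewrite ler_wpM2l// w0.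
  have b5 : eta * n * G t * P k.+1 t <= mu * e ^+ 2 / 4 * P k.+1 t by rewrite ler_pM2r.
  have b6 : P k.+3 t <= e ^+ 2 / 4 * P k.+1 t.
    apply: le_trans b1 _; apply: ler_wpM2l; last exact: q_anti.
    by apply: ltW; apply: divr_gt0.
  have b7 : mu * P k.+3 t <= mu * (e ^+ 2 / 4 * P k.+1 t) by rewrite ler_pM2l.
  have b8 : mu * e ^+ 2 * P k.+1 t <= mu * (w t * w t) * P k.+1 t.
    by rewrite ler_pM2r// ler_pM2l// -expr2 lerXn2r// nnegrE ?w0// ltW.
  rewrite wE in dl b4; rewrite /d; lra.
near=> t; have at_ : a < t by near: t; exact: eventually_gt.
by rewrite -ler_pdivrMr ?Pk0//; near: t.
Unshelve. all: by end_near. Qed.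

Let rho (i : 'I_N) t : R := q (everyone :\ i) 1 t / G t.

Let rho_star : R := (n - 1) * eta / (mu - eta).

Let drho (i : 'I_N) t : R :=
  (drift (everyone :\ i) 0 t - rho i t * (- (c * P 1 t))) / G t.

Let rho_derive i t : a < t -> is_derive t 1 (rho i) (drho i t).
Proof.
by move=> at_; apply: is_derive_ratio; [exact: dq|exact: dG|rewrite lt0r_neq0// G_gt0].
Qed.

Let rho_ge0 i t : a < t -> 0 <= rho i t.
Proof. by move=> at_; rewrite divr_ge0// ltW// G_gt0. Qed.

Let rho_le i t : a < t -> rho i t <= kappa.
Proof.
move=> at_; rewrite ler_pdivrMr ?G_gt0//; apply: le_trans (P1_le at_).
by apply: q_subset; exact: subD1set.
Qed.

Let drho_bounds i t : a < t ->
  - (mu - h t) * rho i t + h t * (n - 1) - eta * n * P 1 t <= drho i t <=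
  - (mu - h t) * rho i t + h t * (n - 1) + mu * (P 2 t / G t).
Proof.
move=> at_; have G0 := G_gt0 at_; have P1_0 : 0 <= c * P 1 t by rewrite mulr_ge0// ltW.
have card : #|everyone :\ i|%:R = n - 1 :> R.
  have := cardsD1 i everyone; rewrite inE cardsT card_ord /= => NE.
  have -> : n = (1 + #|everyone :\ i|)%:R by rewrite /n; congr (_%:R).
  by rewrite natrD addrAC subrr add0r.
have up : \sum_(j in everyone :\ i) (q (everyone :\ i :\ j) 0 t - q (everyone :\ i :\ j) 1 t) <= n - 1.
  rewrite -card -sumr_const; apply: ler_sum => j _.
  by rewrite q_0 gerBl.
have low : (n - 1) - n * P 1 t <=
    \sum_(j in everyone :\ i) (q (everyone :\ i :\ j) 0 t - q (everyone :\ i :\ j) 1 t).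
  apply: (@le_trans _ _ (\sum_(j in everyone :\ i) (1 - P 1 t))).
    rewrite sumr_const -[leRHS]mulr_natl card mulrBr mulr1 lerD2l lerN2.
    by rewrite ler_wpM2r// gerBl.
  apply: ler_sum => j _; rewrite q_0 lerD2l lerN2; apply: q_subset.
  by apply: (fintype.subset_trans (subD1set _ _)); exact: subD1set.
have qE : q (everyone :\ i) 1 t = rho i t * G t by rewrite mulfVK// lt0r_neq0.
have PE : mu * P 2 t = mu * (P 2 t / G t) * G t by rewrite -mulrA mulfVK// lt0r_neq0.
have q2 : 0 <= mu * q (everyone :\ i) 2 t <= mu * P 2 t.
  by rewrite mulr_ge0 ?(ltW mu_gt0)//= ler_pM2l// q_subset// subD1set.
rewrite /drho ler_pdivlMr// ler_pdivrMr// /drift qE hG//.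
have hG0 : 0 <= h t * G t by rewrite -hG.
have up' := ler_wpM2l hG0 up; have low' := ler_wpM2l hG0 low.
have e1 : h t * G t * (n * P 1 t) <= eta * n * P 1 t * G t.
  rewrite (_ : h t * G t * (n * P 1 t) = h t * (n * P 1 t * G t)); last by ring.
  rewrite (_ : eta * n * P 1 t * G t = eta * (n * P 1 t * G t)); last by ring.
  rewrite ler_wpM2r ?h_le//; apply: mulr_ge0; last exact: ltW.
  by apply: mulr_ge0 => //; exact: ltW.
move/andP: q2 => [q21 q22].
apply/andP; split; lra.
Qed.

Let rho_upper i (e : R) : 0 < e -> \forall t \near +oo, rho i t <= rho_star + e.
Proof.
move=> e0; have me : 0 < mu - eta by rewrite subr_gt0.
pose d := (mu - eta) * e / 2.
have d0 : 0 < d by apply: divr_gt0 => //; apply: mulr_gt0.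
have dm0 : 0 < d / mu by apply: divr_gt0.
apply: (eventually_below (rho_derive i) (rho_ge0 i) d0); near=> t => re.
have at_ : a < t by near: t; exact: eventually_gt.
have /andP[_ up] := drho_bounds i at_.
have b1 : P 2 t <= d / mu * G t by near: t; apply: crowd_vs_tail.
have b2 : mu * (P 2 t / G t) <= d.
  by rewrite mulrC -ler_pdivlMr// ler_pdivrMr// G_gt0.
have h1 := h_le at_; have r0 := rho_ge0 i at_.
have b3 : h t * (rho i t + (n - 1)) <= eta * (rho i t + (n - 1)).
  by rewrite ler_wpM2r//; have := n_ge2; lra.
have b4 : (mu - eta) * (rho_star + e) <= (mu - eta) * rho i t by rewrite ler_pM2l.
have b5 : (mu - eta) * rho_star = (n - 1) * eta.
  by rewrite /rho_star mulrC mulfVK// lt0r_neq0.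
rewrite /d in b2 *; lra.
Unshelve. all: by end_near. Qed.

Let rho_lower i (e : R) : 0 < e -> \forall t \near +oo, rho_star - e <= rho i t.
Proof.
move=> e0; have me : 0 < mu - eta by rewrite subr_gt0.
pose d := (mu - eta) * e / 2.
have d0 : 0 < d by apply: divr_gt0 => //; apply: mulr_gt0.
have kn0 : 0 < kappa + n by have := n_ge2; have := kappa_gt0; lra.
have en0 : 0 < eta * n by apply: mulr_gt0.
have d2 : 0 < d / 2 by apply: divr_gt0.
have phid t : a < t -> is_derive t 1 (fun u => kappa - rho i u) (- drho i t).
  move=> at_; have := is_deriveB (is_derive_cst kappa t 1) (rho_derive i at_).
  by rewrite sub0r.
have phi0 t : a < t -> 0 <= kappa - rho i t by move=> at_; rewrite subr_ge0 rho_le.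
have main : \forall t \near +oo, kappa - rho i t <= kappa - (rho_star - e).
  apply: (eventually_below phid phi0 d0); near=> t => re.
  have at_ : a < t by near: t; exact: eventually_gt.
  have /andP[low _] := drho_bounds i at_.
  have b1 : eta - d / 2 / (kappa + n) <= h t by near: t; apply: h_ge; apply: divr_gt0.
  have b2 : P 1 t <= d / 2 / (eta * n) by near: t; apply: P_small => //; apply: divr_gt0.
  have b2' : eta * n * P 1 t <= d / 2 by rewrite mulrC -ler_pdivlMr.
  have r0 := rho_ge0 i at_; have r1 := rho_le i at_.
  have rn0 : 0 <= rho i t + (n - 1) by have := n_ge2; lra.
  have b3 : (eta - d / 2 / (kappa + n)) * (rho i t + (n - 1)) <= h t * (rho i t + (n - 1)).
    by rewrite ler_wpM2r.
  have b3' : d / 2 / (kappa + n) * (rho i t + (n - 1)) <= d / 2.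
    rewrite mulrAC ler_pdivrMr// ler_pM2l//; lra.
  have b4 : (mu - eta) * rho i t <= (mu - eta) * (rho_star - e).
    by rewrite ler_pM2l//; lra.
  have b5 : (mu - eta) * rho_star = (n - 1) * eta.
    by rewrite /rho_star mulrC mulfVK// lt0r_neq0.
  rewrite /d in b2' b3 b3' *; lra.
near=> t; have b : kappa - rho i t <= kappa - (rho_star - e) by near: t.
by move: b; rewrite lerD2l lerN2.
Unshelve. all: by end_near. Qed.

Let rho_star_gt0 : 0 < rho_star.
Proof.
apply: divr_gt0; last by rewrite subr_gt0.
by apply: mulr_gt0 => //; have := n_ge2; lra.
Qed.

Let sigma t : R := \sum_i rho i t.

Let sigma_bounds (e : R) : 0 < e ->
  \forall t \near +oo, n * rho_star - e <= sigma t <= n * rho_star + e.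
Proof.
move=> e0; have en : 0 < e / n by apply: divr_gt0.
have all_up : \forall t \near +oo, forall i : 'I_N, rho i t <= rho_star + e / n.
  by apply: filter_forall => i; exact: rho_upper.
have all_low : \forall t \near +oo, forall i : 'I_N, rho_star - e / n <= rho i t.
  by apply: filter_forall => i; exact: rho_lower.
have sumE (x : R) : \sum_(i < N) x = n * x by rewrite sumr_const card_ord mulr_natl.
have ne : n * (e / n) = e by rewrite mulrCA divff ?mulr1// lt0r_neq0.
near=> t; apply/andP; split.
  rewrite -[X in _ - X]ne -mulrBr -sumE; apply: ler_sum => i _.
  by move: i; near: t.
rewrite -[X in _ + X]ne -mulrDr -sumE; apply: ler_sum => i _.
by move: i; near: t.
Unshelve. all: by end_near. Qed.

Let S : R := eta * (n * rho_star).

Let S_gt0 : 0 < S.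
Proof. by apply: mulr_gt0 => //; apply: mulr_gt0. Qed.

Let hsigma_bounds (e : R) : 0 < e ->
  \forall t \near +oo, S - e <= h t * sigma t <= S + e.
Proof.
move=> e0; have e1 : 0 < e / 2 / eta by apply: divr_gt0 => //; apply: divr_gt0.
have k0 : 0 < n * kappa by apply: mulr_gt0.
have e2 : 0 < e / 2 / (n * kappa) by apply: divr_gt0 => //; apply: divr_gt0.
near=> t; have at_ : a < t by near: t; exact: eventually_gt.
have /andP[s1 s2] : n * rho_star - e / 2 / eta <= sigma t <= n * rho_star + e / 2 / eta.
  by near: t; exact: sigma_bounds.
have h1 : eta - e / 2 / (n * kappa) <= h t by near: t; exact: h_ge.
have h2 := h_le at_; have h0 := h_ge0 at_.
have sig0 : 0 <= sigma t by apply: sumr_ge0 => i _; exact: rho_ge0.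
have sigk : sigma t <= n * kappa.
  have -> : n * kappa = \sum_(i < N) kappa by rewrite sumr_const card_ord mulr_natl.
  by apply: ler_sum => i _; exact: rho_le.
have ee : eta * (e / 2 / eta) = e / 2 by rewrite mulrCA divff ?mulr1// lt0r_neq0.
have b1 : (eta - e / 2 / (n * kappa)) * sigma t <= h t * sigma t by rewrite ler_wpM2r.
have b2 : e / 2 / (n * kappa) * sigma t <= e / 2.
  by rewrite mulrAC ler_pdivrMr// ler_pM2l//; apply: divr_gt0.
have b3 : h t * sigma t <= eta * sigma t by rewrite ler_wpM2r.
have b4 : eta * (n * rho_star - e / 2 / eta) <= eta * sigma t by rewrite ler_pM2l.
have b5 : eta * sigma t <= eta * (n * rho_star + e / 2 / eta) by rewrite ler_pM2l.
rewrite mulrBr ee in b4; rewrite mulrDr ee in b5; rewrite /S.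
by apply/andP; split; lra.
Unshelve. all: by end_near. Qed.

Let sum_lonely t : a < t -> \sum_i q (everyone :\ i) 1 t = G t * sigma t.
Proof.
move=> at_; rewrite /sigma mulr_sumr; apply: eq_bigr => i _.
by rewrite mulrC mulfVK// lt0r_neq0// G_gt0.
Qed.

Let excess : R := Num.max (mu - 2 * eta) 0.

Let P2_gt0 t : a < t -> 0 < P 2 t.
Proof. by move=> at_; apply: lt_le_trans (P_gt0 at_) _; exact: P_anti. Qed.

Let drift1_ge t : a < t ->
  - mu * P 2 t + h t * sigma t * (G t * G t) - eta * n * G t * P 2 t <= drift everyone 1 t.
Proof.
move=> at_; rewrite /drift.
rewrite (eq_bigl xpredT) => [|i]; last by rewrite inE.
rewrite sumrB sum_lonely// hG//.
have hG0 : 0 <= h t * G t by rewrite mulr_ge0 ?h_ge0// ltW// G_gt0.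
have b1 : \sum_i q (everyone :\ i) 2 t <= n * P 2 t.
  have -> : n * P 2 t = \sum_(i < N) P 2 t by rewrite sumr_const card_ord mulr_natl.
  by apply: ler_sum => i _; apply: q_subset; exact: subD1set.
have b2 := ler_wpM2l hG0 b1.
have b3 : h t * G t * (n * P 2 t) <= eta * G t * (n * P 2 t).
  apply: ler_wpM2r; first by apply: mulr_ge0 => //; exact: ltW.
  by rewrite ler_pM2r ?G_gt0// h_le.
have b4 : 0 <= mu * P 3 t by apply: mulr_ge0 => //; exact: ltW.
lra.
Qed.

Let square_vs_pair (e : R) : 0 < e ->
  \forall t \near +oo, G t * G t <= (excess + e) / S * P 2 t.
Proof.
move=> e0; set V := (excess + e) / S.
have ex0 : 0 <= excess by rewrite /excess le_max lexx orbT.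
have ex1 : mu - 2 * eta <= excess by rewrite /excess le_max lexx.
have V0 : 0 < V by apply: divr_gt0 => //; lra.
have VS : S * V = excess + e by rewrite mulrC mulfVK// lt0r_neq0.
pose v t := G t * G t / P 2 t.
pose dv t := ((G t * (- (c * P 1 t)) + G t * (- (c * P 1 t))) - v t * drift everyone 1 t) / P 2 t.
have vd t : a < t -> is_derive t 1 v (dv t).
  move=> at_; apply: (is_derive_ratio (f := fun u => G u * G u)) => //.
  - exact: (is_deriveM (dG at_) (dG at_)).
  - exact: dq.
  - by rewrite lt0r_neq0// P2_gt0.
have v0 t : a < t -> 0 <= v t.
  move=> at_; apply: divr_ge0; last exact/ltW/P2_gt0.
  by apply: mulr_ge0; exact/ltW/G_gt0.
have d0 : 0 < V * (e / 2) by apply: mulr_gt0 => //; apply: divr_gt0.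
have e16 : 0 < e / 16 by apply: divr_gt0.
have e4V : 0 < e / 4 / V by apply: divr_gt0 => //; apply: divr_gt0.
have en : 0 < eta * n by apply: mulr_gt0.
have e8 : 0 < e / 8 / (eta * n) by apply: divr_gt0 => //; apply: divr_gt0.
have main : \forall t \near +oo, v t <= V.
  apply: (eventually_below vd v0 d0); near=> t => Vv.
  have at_ : a < t by near: t; exact: eventually_gt.
  have G0 := G_gt0 at_; have p0 := P2_gt0 at_.
  have h1 : eta - e / 16 <= h t by near: t; exact: h_ge.
  have /andP[s1 _] : S - e / 4 / V <= h t * sigma t <= S + e / 4 / V.
    by near: t; exact: hsigma_bounds.
  have g1 : G t <= e / 8 / (eta * n) by near: t; exact: G_small.
  have g1' : eta * n * G t <= e / 8 by rewrite mulrC -ler_pdivlMr.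
  have vG : G t * G t = v t * P 2 t by rewrite mulfVK// lt0r_neq0.
  have vt := v0 t at_.
  have s2 : S * V - e / 4 <= h t * sigma t * V.
    have : (S - e / 4 / V) * V <= h t * sigma t * V by rewrite ler_pM2r.
    by rewrite mulrBl mulfVK// lt0r_neq0.
  have hs0 : 0 <= h t * sigma t.
    by apply: mulr_ge0; [exact: h_ge0|apply: sumr_ge0 => i _; exact: rho_ge0].
  have s3 : h t * sigma t * V <= h t * sigma t * v t by rewrite ler_wpM2l.
  have key : mu - 2 * h t - h t * sigma t * v t + eta * n * G t <= - (e / 2) by lra.
  have dl := ler_wpM2l vt (drift1_ge at_).
  rewrite /dv ler_pdivrMr// hG//.
  have k1 := ler_wpM2l (mulr_ge0 vt (ltW p0)) key.
  have k2 : V * (e / 2) * P 2 t <= v t * (e / 2) * P 2 t.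
    by rewrite ler_pM2r// ler_pM2r//; apply: divr_gt0.
  have vG2 : h t * (G t * G t) = h t * (v t * P 2 t) by rewrite vG.
  rewrite vG in dl; lra.
near=> t; have at_ : a < t by near: t; exact: eventually_gt.
by rewrite -ler_pdivrMr ?P2_gt0//; near: t.
Unshelve. all: by end_near. Qed.

Let overcrowd_le (e : R) : 0 < e ->
  \forall t \near +oo, kappa * G t - P 1 t <= (1 + e) * P 2 t.
Proof.
move=> e0; have en : 0 < e / n by apply: divr_gt0.
near=> t; have at_ : a < t by near: t; exact: eventually_gt.
have b : P 3 t <= e / n * P 2 t by near: t; exact: crowd_ratio.
rewrite -sumP// (bigD1 (Ordinal (ltnW N_ge2)))//= addrAC subrr add0r.
rewrite (bigD1 (Ordinal N_ge2))//= mulrDl mul1r lerD2l.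
apply: (@le_trans _ _ (n * P 3 t)); last first.
  have := ler_wpM2l (ltW n_gt0) b.
  by rewrite mulrA mulrCA divff ?mulr1// lt0r_neq0.
apply: (@le_trans _ _ (\sum_(k < N | (k != Ordinal (ltnW N_ge2)) && (k != Ordinal N_ge2)) P 3 t)).
  apply: ler_sum => k /andP[k0 k1]; apply: P_anti.
  by move: k0 k1; rewrite -!val_eqE /=; case: (nat_of_ord k) => [|[|]].
rewrite sumr_const -[leLHS]mulr_natl ler_wpM2r// ler_nat.
by rewrite -[leqRHS]card_ord max_card.
Unshelve. all: by end_near. Qed.

Let p t : R := P 1 t / G t.

Let dp t : R := (drift everyone 0 t - p t * (- (c * P 1 t))) / G t.

Let p_derive t : a < t -> is_derive t 1 p (dp t).
Proof.
by move=> at_; apply: is_derive_ratio; [exact: dq|exact: dG|rewrite lt0r_neq0// G_gt0].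
Qed.

Let dpE t : a < t ->
  dp t * G t = mu * P 2 t - h t * (kappa * G t - P 1 t) - h t * sigma t * (G t * G t).
Proof.
move=> at_; have G0 := lt0r_neq0 (G_gt0 at_).
rewrite /dp divfK// /drift.
rewrite (eq_bigl xpredT) => [|i]; last by rewrite inE.
rewrite sumrB sum_lonely// (eq_bigr (fun=> 1)) => [|i _]; last exact: q_0.
rewrite sumr_const card_ord -/n.
have e1 : P 1 t = p t * G t by rewrite mulfVK.
have e2 : h t = c * p t by rewrite /h /p mulrA.
have e3 : mu = c * n + c * kappa by exact: muE.
rewrite e2 e1 e3; ring.
Qed.

Let p_growth : exists2 e : R, 0 < e & \forall t \near +oo, e * (P 2 t / G t) <= dp t.
Proof.
pose g := mu - eta - excess.
have g0 : 0 < g.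
  by rewrite /g /excess; case: (leP (mu - 2 * eta) 0) => _; have := eta_lt_mu; have := eta_gt0; lra.
have ex0 : 0 <= excess by rewrite /excess le_max lexx orbT.
have e1 : 0 < eta + 1 by have := eta_gt0; lra.
pose e := g / 4 / (eta + 1).
have e0 : 0 < e by apply: divr_gt0 => //; apply: divr_gt0.
pose V := (excess + e) / S.
have V0 : 0 < V by apply: divr_gt0 => //; lra.
have VS : S * V = excess + e by rewrite mulrC mulfVK// lt0r_neq0.
have e'0 : 0 < g / 4 / V by apply: divr_gt0 => //; apply: divr_gt0.
exists (g / 2); first by apply: divr_gt0.
near=> t; have at_ : a < t by near: t; exact: eventually_gt.
have G0 := G_gt0 at_; have p0 := P2_gt0 at_.
have b1 : G t * G t <= V * P 2 t by near: t; exact: square_vs_pair.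
have b2 : kappa * G t - P 1 t <= (1 + e) * P 2 t by near: t; exact: overcrowd_le.
have /andP[_ b3] : S - g / 4 / V <= h t * sigma t <= S + g / 4 / V.
  by near: t; exact: hsigma_bounds.
have hs0 : 0 <= h t * sigma t.
  by apply: mulr_ge0; [exact: h_ge0|apply: sumr_ge0 => i _; exact: rho_ge0].
rewrite mulrA ler_pdivrMr// dpE//.
have r0 : 0 <= kappa * G t - P 1 t by rewrite subr_ge0 P1_le.
have c1 : h t * (kappa * G t - P 1 t) <= eta * ((1 + e) * P 2 t).
  by apply: ler_pM => //; [exact: h_ge0|exact: h_le].
have c2 : h t * sigma t * (G t * G t) <= (S + g / 4 / V) * (V * P 2 t).
  by apply: ler_pM => //; apply: mulr_ge0; exact: ltW.
have c3 : (S + g / 4 / V) * (V * P 2 t) = (excess + e + g / 4) * P 2 t.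
  by rewrite mulrA mulrDl VS mulfVK// lt0r_neq0.
have c4 : (eta + 1) * e = g / 4 by rewrite mulrC mulfVK// lt0r_neq0.
have c5 : ((eta + 1) * e) * P 2 t = g / 4 * P 2 t by rewrite c4.
rewrite c3 in c2; rewrite /g in c2 c5 *; lra.
Unshelve. all: by end_near. Qed.

Let incr_halfline (phi dphi : R -> R) (b : R) :
  (forall t, b < t -> is_derive t 1 phi (dphi t)) -> (forall t, b < t -> 0 <= dphi t) ->
  forall s t, b < s -> s <= t -> phi s <= phi t.
Proof.
move=> der pos s t bs; rewrite le_eqVlt => /predU1P[->//|st].
have [x /andP[sx _] e] := mvt_halfline der bs st.
by rewrite -subr_ge0 e mulr_ge0 ?subr_ge0 ?(ltW st)// pos// (lt_trans bs).
Qed.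

Lemma busy_ratio_eventually_nondecreasing :
  exists tau, forall s t, tau < s -> s <= t -> P 1 s / G s <= P 1 t / G t.
Proof.
have [e e0 [A [_ HA]]] := p_growth.
exists (Num.max A a) => s t bs st; apply: (@incr_halfline p dp _ _ _ s t bs st) => u.
  by rewrite gt_max => /andP[_]; exact: p_derive.
rewrite gt_max => /andP[Au au]; apply: le_trans (HA u Au).
by apply: mulr_ge0; [exact: ltW|apply: divr_ge0 => //; exact/ltW/G_gt0].
Qed.

Lemma exponential_tail_limit :
  exists2 C : R, 0 < C & expR (eta * t) * G t @[t --> +oo] --> C.
Proof.
have [e e0 [A [_ HA]]] := p_growth.
pose b : R := Num.max A a.
have ab t : b < t -> a < t by rewrite gt_max => /andP[].
pose phi (t : R) : R := expR (eta * t) * G t.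
pose dphi (t : R) : R := phi t * (c * (kappa - p t)).
have expd (k t : R) : is_derive t 1 (fun u : R => expR (k * u)) (expR (k * t) * k).
  apply: (@is_derive1_comp _ expR (fun u => k * u) t _ k (is_derive_expR _)).
  have := is_deriveM (is_derive_cst k t 1) (is_derive_id t 1).
  by rewrite /GRing.scale/= mulr0 addr0 mulr1.
have phid t : b < t -> is_derive t 1 phi (dphi t).
  move=> /ab at_; have := is_deriveM (expd eta t) (dG at_).
  rewrite /GRing.scale/= (_ : expR (eta * t) * - (c * P 1 t) + G t * (expR (eta * t) * eta) = dphi t)//.
  rewrite /dphi /phi /p /eta; field; exact: lt0r_neq0 (G_gt0 at_).
have phi0 t : b < t -> 0 < phi t by move=> /ab at_; rewrite mulr_gt0 ?expR_gt0 ?G_gt0.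
have u0 t : a < t -> 0 <= kappa - p t.
  by move=> at_; rewrite subr_ge0 ler_pdivrMr ?G_gt0// P1_le.
have dphi0 t : b < t -> 0 <= dphi t.
  move=> bt; apply: mulr_ge0; first exact/ltW/phi0.
  by apply: mulr_ge0; [exact: ltW|exact/u0/ab].
pose K := c * n / e.
have K0 : 0 < K by apply: divr_gt0 => //; apply: mulr_gt0.
pose psi (t : R) : R := - (phi t * expR (K * (kappa - p t))).
pose dpsi (t : R) : R := - (phi t * (expR (K * (kappa - p t)) * (K * - dp t)) +
   expR (K * (kappa - p t)) * dphi t).
have psid t : b < t -> is_derive t 1 psi (dpsi t).
  move=> bt; have at_ := ab _ bt.
  have d1 : is_derive t 1 (fun u => K * (kappa - p u)) (K * - dp t).
    have d2 := is_deriveB (is_derive_cst kappa t 1) (p_derive at_).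
    have := is_deriveM (is_derive_cst K t 1) d2.
    by rewrite /GRing.scale/= mulr0 addr0 sub0r.
  have d3 := @is_derive1_comp _ expR (fun u => K * (kappa - p u)) t _ _ (is_derive_expR _) d1.
  exact: is_deriveN (is_deriveM (phid t bt) d3).
have dpsi0 t : b < t -> 0 <= dpsi t.
  move=> bt; have at_ := ab _ bt; have G0 := G_gt0 at_.
  have At : A < t by move: bt; rewrite gt_max => /andP[].
  have b1 := HA t At.
  have b2 : kappa - p t <= n * (P 2 t / G t).
    rewrite mulrA ler_pdivlMr// mulrBl [p t * _]mulfVK ?lt0r_neq0//.
    by have := P1_ge at_; lra.
  have b3 : c * (kappa - p t) <= K * dp t.
    apply: (@le_trans _ _ (c * (n * (P 2 t / G t)))); first by rewrite ler_pM2l.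
    rewrite /K -(ler_pM2l e0) in b1 *.
    rewrite (_ : c * n / e * dp t = c * n * (dp t / e)); last by field; exact: lt0r_neq0.
    rewrite mulrA ler_pM2l; last exact: mulr_gt0.
    rewrite ler_pdivlMr// mulrC.
    by move: b1; rewrite ler_pM2l.
  have E0 := expR_gt0 (K * (kappa - p t)); have F0 := phi0 t bt.
  have b4 : 0 <= phi t * expR (K * (kappa - p t)) * (K * dp t - c * (kappa - p t)).
    by rewrite mulr_ge0 ?subr_ge0// ltW// mulr_gt0.
  by rewrite /dpsi /dphi; lra.
have b0 : b < b + 1 by rewrite ltrDl.
pose C0 := - psi (b + 1).
have phi_le t : b + 1 <= t -> phi t <= C0.
  move=> bt; have := incr_halfline psid dpsi0 b0 bt; rewrite -lerN2; apply: le_trans.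
  rewrite /psi opprK; apply: ler_peMr; first by apply/ltW/phi0; exact: lt_le_trans b0 bt.
  rewrite -expR0 ler_expR.
  by apply: mulr_ge0; [exact: ltW|apply: u0; apply: ab; exact: lt_le_trans b0 bt].
pose Phi t := phi (Num.max t (b + 1)).
have Phi_homo : {homo Phi : s t / s <= t}.
  move=> s t st; apply: (incr_halfline phid dphi0).
    by rewrite lt_max b0 orbT.
  by rewrite ge_max !le_max st lexx orbT.
have Phi_ub : has_ubound (range Phi).
  by exists C0 => _ [t _ <-]; apply: phi_le; rewrite le_max lexx orbT.
have cvg := nondecreasing_cvgr Phi_homo Phi_ub.
exists (sup (range Phi)).
  apply: lt_le_trans (phi0 _ b0) _.
  have <- : Phi (b + 1) = phi (b + 1) by rewrite /Phi maxxx.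
  by apply: (ub_le_sup Phi_ub); exists (b + 1).
apply: cvg_trans cvg; apply: near_eq_cvg; near=> t.
rewrite /Phi max_l//; near: t; apply: nbhs_pinfty_ge; exact: num_real.
Unshelve. all: by end_near. Qed.

End Asymptotics.

(** * Independence *)

Section Independence.
Context (R : realType) (d : measure_display) (T : measurableType d)
  (P : probability T R) (I : finType) (Z : I -> {RV P >-> R}).

Definition others_events (k0 : I) : set (set T) :=
  [set A | exists k, k != k0 /\ exists2 B, measurable B & A = Z k @^-1` B].

(* [T] carrying only the events generated by the variables other than [Z k0];
   [Z k0] is independent of it, which turns Fubini into conditioning on them. *)
Definition others (k0 : I) := g_sigma_algebraType (others_events k0).

Lemma measurable_others k0 (A : set T) :
  @measurable _ (others k0) A -> measurable A.
Proof.
apply: smallest_sub; first exact: sigma_algebra_measurable.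
by move=> _ [k [_ [B mB ->]]]; rewrite -[X in measurable X]setTI; exact: measurable_funP.
Qed.

Lemma measurable_fun_others k k0 : k != k0 ->
  measurable_fun [set: others k0] (Z k : others k0 -> R).
Proof.
move=> kk0 _ B mB; rewrite setTI; apply: sub_gen_smallest.
by exists k; split => //; exists B.
Qed.

Hypothesis indep : mutually_independent Z.

Lemma indep_others k0 (A : set T) (B : set R) :
  @measurable _ (others k0) A -> measurable B ->
  P (A `&` Z k0 @^-1` B) = (P A * P (Z k0 @^-1` B))%E.
Proof.
move=> mA mB.
pose rect (C : I -> set R) : set T := \bigcap_(i in [set` [set~ k0]%SET]) (Z i @^-1` C i).
pose G : set (set T) :=
  [set A | exists2 C : I -> set R, (forall i, measurable (C i)) & A = rect C].
have mZ k (C : set R) : measurable C -> measurable (Z k @^-1` C).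
  by move=> mC; rewrite -[X in measurable X]setTI; exact: measurable_funP.
have mrect C : (forall i, measurable (C i)) -> measurable (rect C).
  by move=> mC; apply: fin_bigcap_measurable => // i _; exact: mZ.
have GI : setI_closed G.
  move=> _ _ [C1 mC1 ->] [C2 mC2 ->]; exists (fun i => C1 i `&` C2 i).
    by move=> i; exact: measurableI.
  by rewrite /rect -bigcapI.
have GP X : G X -> P (X `&` Z k0 @^-1` B) = (P X * P (Z k0 @^-1` B))%E.
  move=> [C mC ->].
  pose C' i := if i == k0 then B else C i.
  have mC' i : measurable (C' i) by rewrite /C'; case: ifP.
  have -> : rect C `&` Z k0 @^-1` B = \bigcap_(i in [set` [set: I]%SET]) (Z i @^-1` C' i).
    apply/seteqP; split => [w [Cw Bw] i _ /=|w Cw].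
      rewrite /C'; case: eqP => [->//|/eqP ik]; apply: Cw => /=.
      by rewrite !inE.
    split; last by have := Cw k0; rewrite /C' eqxx/= !inE; apply.
    move=> i /=; rewrite !inE => ik.
    by have := Cw i; rewrite /C' (negbTE ik)/= !inE; apply.
  rewrite indep// (bigD1 k0)//= {1}/C' eqxx.
  have -> : (\prod_(i in [set: I]%SET | i != k0) fine (P (Z i @^-1` C' i)) =
             \prod_(i in [set~ k0]%SET) fine (P (Z i @^-1` C i)))%R.
    apply: eq_big => [i|i /andP[_ ik]]; first by rewrite !inE.
    by rewrite /C' (negbTE ik).
  by rewrite EFinM -indep// fineK ?fin_num_measure//; [rewrite muleC|exact: mZ].
have mAT := measurable_others mA.
pose Q := [set X : set T | measurable X /\
   P (X `&` Z k0 @^-1` B) = (P X * P (Z k0 @^-1` B))%E].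
have mB' := mZ k0 _ mB.
suff : <<s others_events k0 >> `<=` Q by move=> /(_ _ mA) [].
have GQ : G `<=` Q.
  by move=> X GX; split; [case: GX => C mC ->; exact: mrect|exact: GP].
have sG : <<s others_events k0 >> `<=` <<s G >>.
  apply: smallest_sub; first exact: smallest_sigma_algebra.
  move=> _ [k [kk0 [C mC ->]]]; apply: sub_gen_smallest.
  exists (fun i => if i == k then C else setT).
    by move=> i; case: ifP.
  apply/seteqP; split=> [w Cw i _ /=|w Cw].
    by case: eqP => [->|].
  by have := Cw k; rewrite /= !inE eqxx; apply.
apply: (subset_trans sG); rewrite -setI_closed_g_dynkin_g_sigma_algebra//.
apply: smallest_sub => //; split.
- by split=> //; rewrite setTI probability_setT mul1e.
- move=> X [mX PX]; split; first exact: measurableC.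
  have -> : ~` X `&` Z k0 @^-1` B = Z k0 @^-1` B `\` X by rewrite setIC.
  rewrite measureD//; last by rewrite ltey_eq fin_num_measure.
  rewrite [Y in (_ - Y)%E](_ : _ = (P X * P (Z k0 @^-1` B))%E); last by rewrite setIC.
  rewrite probability_setC// muleBl ?mul1e ?fin_num_measure//.
- move=> F tF mF; split; first by apply: bigcup_measurable => k _; case: (mF k).
  rewrite setI_bigcupl.
  rewrite measure_bigcup//; last 2 first.
  + by move=> n _; apply: measurableI => //; case: (mF n).
  + by under eq_fun do rewrite setIC; exact: trivIset_setIl.
  rewrite measure_bigcup//; last by move=> n _; case: (mF n).
  rewrite muleC -[P (Z k0 @^-1` B)]fineK ?fin_num_measure// -nneseriesZl//.
  by apply: eq_eseriesr => n _; rewrite fineK ?fin_num_measure// muleC; case: (mF n) => _ /esym.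
Qed.

Lemma indep_pair_le k0 (c : R) (C C' : set (others k0 * R)) :
  0 <= c -> measurable C -> measurable C' ->
  (forall w, (P (Z k0 @^-1` xsection C w) <=
              c%:E * P (Z k0 @^-1` xsection C' w))%E) ->
  (P [set w | C (w, Z k0 w)] <= c%:E * P [set w | C' (w, Z k0 w)])%E.
Proof.
move=> c0 mC mC' CC'.
have mid : measurable_fun [set: T] (id : T -> others k0).
  by move=> _ B mB; rewrite setTI; exact: measurable_others mB.
have mpair : measurable_fun [set: T] (fun w => (w, Z k0 w) : others k0 * R).
  by apply: measurable_fun_pair => //; exact: measurable_funP.
pose X : {mfun T >-> others k0} := mfun_Sub (mem_set mid).
pose Y : {mfun T >-> (others k0 * R)%type} := mfun_Sub (mem_set mpair).
have PE (D : set (others k0 * R)) : measurable D ->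
    P [set w | D (w, Z k0 w)] =
    (\int[distribution P X]_w distribution P (Z k0) (xsection D w))%E.
  move=> mD.
  rewrite -[LHS]/(distribution P Y D).
  rewrite -(@product_measure_unique _ _ _ _ _ (distribution P X) (distribution P (Z k0)) (distribution P Y))//.
  move=> A B mA mB.
  rewrite /distribution /pushforward /=.
  exact: (indep_others mA mB).
rewrite !PE// -ge0_integralZl//; last exact: measurable_fun_xsection.
apply: ge0_le_integral => //=.
- exact: measurable_fun_xsection.
- by apply: emeasurable_funM => //; exact: measurable_fun_xsection.
- by move=> w _; exact: CC'.
Qed.

End Independence.

(** * Expectations of bounded functions *)

Section BoundedExpectation.
Context (R : realType) (d : measure_display) (T : measurableType d)
  (P : probability T R).
Implicit Types (f g : T -> R) (b : T -> bool).

Definition tame f := measurable_fun [set: T] f /\ exists C, forall w, `|f w| <= C.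

Definition expect f : R := \int[P]_w f w.

Definition pr b : R := expect (fun w => (b w)%:R).

Lemma tame_integrable f : tame f -> P.-integrable [set: T] (EFin \o f).
Proof.
move=> [mf [C fC]]; apply: measurable_bounded_integrable => //.
  by rewrite ltey_eq fin_num_measure.
by exists C; split; [exact: num_real|move=> x Cx w _; exact: le_trans (fC w) (ltW Cx)].
Qed.

Lemma tame_cst (c : R) : tame (fun=> c).
Proof. by split; [exact: measurable_cst|exists `|c|]. Qed.

Lemma tameD f g : tame f -> tame g -> tame (fun w => f w + g w).
Proof.
move=> [mf [C fC]] [mg [D gD]]; split; first exact: measurable_funD.
by exists (C + D) => w; rewrite (le_trans (ler_normD _ _))// lerD.
Qed.

Lemma tameM f g : tame f -> tame g -> tame (fun w => f w * g w).
Proof.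
move=> [mf [C fC]] [mg [D gD]]; split; first exact: measurable_funM.
by exists (C * D) => w; rewrite normrM ler_pM.
Qed.

Lemma tameN f : tame f -> tame (fun w => - f w).
Proof.
move=> [mf [C fC]]; split; last by exists C => w; rewrite normrN.
exact: measurableT_comp.
Qed.

Lemma tameB f g : tame f -> tame g -> tame (fun w => f w - g w).
Proof. by move=> tf tg; apply: tameD => //; exact: tameN. Qed.

Lemma tame_sum (B : Type) (r : seq B) (p : pred B) (f : B -> T -> R) :
  (forall j, tame (f j)) -> tame (fun w => \sum_(j <- r | p j) f j w).
Proof.
move=> tf; elim: r => [|j r IH].
  rewrite [X in tame X](_ : _ = fun=> 0); first exact: tame_cst.
  by apply/funext => w; rewrite big_nil.
rewrite [X in tame X](_ : _ = fun w => (if p j then f j w else 0) + \sum_(j <- r | p j) f j w).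
  by apply: tameD => //; case: (p j) => //; exact: tame_cst.
by apply/funext => w; rewrite big_cons; case: ifP; rewrite ?add0r.
Qed.

Lemma tame_bool b : measurable_fun [set: T] b -> tame (fun w => (b w)%:R).
Proof.
move=> mb; split; last by exists 1 => w; case: (b w); rewrite ?normr1 ?normr0.
rewrite [X in measurable_fun _ X](_ : _ = fun w => if b w then 1 else 0).
  by apply: measurable_fun_ifT => //; exact: measurable_cst.
by apply/funext => w; case: (b w).
Qed.

Lemma expect_cst (c : R) : expect (fun=> c) = c.
Proof. by rewrite /expect Rintegral_cst// (_ : fine _ = 1) ?mulr1//; exact: (congr1 fine (probability_setT P)). Qed.

Lemma expectD f g : tame f -> tame g -> expect (fun w => f w + g w) = expect f + expect g.
Proof. by move=> tf tg; rewrite /expect RintegralD//; exact: tame_integrable. Qed.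

Lemma expectZ (c : R) f : tame f -> expect (fun w => c * f w) = c * expect f.
Proof. by move=> tf; rewrite /expect RintegralZl//; exact: tame_integrable. Qed.

Lemma expectN f : tame f -> expect (fun w => - f w) = - expect f.
Proof.
move=> tf; rewrite -mulN1r -expectZ//; congr expect; apply/funext => w.
by rewrite mulN1r.
Qed.

Lemma expectB f g : tame f -> tame g -> expect (fun w => f w - g w) = expect f - expect g.
Proof. by move=> tf tg; rewrite expectD ?expectN//; exact: tameN. Qed.

Lemma expect_sum (B : Type) (r : seq B) (p : pred B) (f : B -> T -> R) :
  (forall j, tame (f j)) ->
  expect (fun w => \sum_(j <- r | p j) f j w) = \sum_(j <- r | p j) expect (f j).
Proof.
move=> tf; elim: r => [|j r IH].
  rewrite big_nil [X in expect X](_ : _ = fun=> 0); first exact: expect_cst.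
  by apply/funext => w; rewrite big_nil.
rewrite big_cons -IH; case: ifP => pj.
  rewrite -expectD//; last exact: tame_sum.
  by congr expect; apply/funext => w; rewrite big_cons pj.
by congr expect; apply/funext => w; rewrite big_cons pj.
Qed.

Lemma expect_le f g : tame f -> tame g -> (forall w, f w <= g w) -> expect f <= expect g.
Proof. by move=> tf tg fg; apply: le_Rintegral => //; exact: tame_integrable. Qed.

Lemma expect_le_as (good : T -> bool) f g :
  measurable_fun [set: T] good -> pr good = 1 -> tame f -> tame g ->
  (forall w, good w -> f w <= g w) -> expect f <= expect g.
Proof.
move=> mgood prgood tf tg fg; have [_ [C fgC]] := tameB tf tg.
have C0 : 0 <= C by apply: le_trans (fgC point).
rewrite -subr_le0 -expectB//.
have tgood := tame_bool mgood.
have tbad : tame (fun w => 1 - (good w)%:R) by apply: tameB => //; exact: tame_cst.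
have : expect (fun w => f w - g w) <= expect (fun w => C * (1 - (good w)%:R)).
  apply: expect_le; [exact: tameB|by apply: tameM => //; exact: tame_cst|move=> w].
  case gw: (good w); first by rewrite subrr mulr0 subr_le0 fg.
  by rewrite subr0 mulr1 (le_trans (ler_norm _))//.
move=> /le_trans; apply.
rewrite expectZ// expectB//; last exact: tame_cst.
by rewrite expect_cst -/(pr good) prgood subrr mulr0.
Qed.

Lemma prE b : measurable_fun [set: T] b -> pr b = fine (P [set w | b w]).
Proof.
move=> mb; rewrite /pr /expect /Rintegral.
have mA : measurable [set w | b w].
  by have := mb measurableT [set true]; rewrite setTI; apply.
have PI := integral_indic P measurableT mA; rewrite setIT in PI.
congr fine; rewrite -[RHS]PI.
apply: eq_integral => w _; rewrite indicE; congr ((nat_of_bool _)%:R%:E).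
by apply/idP/idP; rewrite inE.
Qed.

Lemma pr_ge0 b : 0 <= pr b.
Proof. by apply: Rintegral_ge0 => w _; exact: ler0n. Qed.

Lemma expectation_expect f : fine ('E_P[f])%E = expect f.
Proof. by rewrite unlock. Qed.

End BoundedExpectation.

(** * The queue *)

Section Customers.
Context (R : realType) (d : measure_display) (T : measurableType d)
  (P : probability T R) (N : nat) (mu : R) (F : R -> R) (M : customers P N mu F).
Hypothesis mu_gt0 : 0 < mu.

Notation pr := (pr P).
Notation expect := (expect P).
Notation everyone := [set: 'I_N]%SET.
Notation leak s t := (1 - expR (- mu * (t - s))).

Definition primitives (k : 'I_N + 'I_N + option 'I_N) : {RV P >-> R} :=
  match k with
  | inl (inl i) => arrival M i
  | inl (inr i) => service M i
  | inr i => mark M i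
  end.

Notation others := (others primitives).

Lemma measurable_fun_bool_others k (b : T -> bool) :
  measurable_fun [set: others k] (b : others k -> bool) -> measurable_fun [set: T] b.
Proof.
move=> mb _ B mB; have := mb measurableT B mB; rewrite !setTI.
exact: measurable_others.
Qed.

Lemma indep_pr_le k (c : R) (C C' : T -> R -> bool) : 0 <= c ->
  measurable_fun [set: others k * R] (fun p => C p.1 p.2) ->
  measurable_fun [set: others k * R] (fun p => C' p.1 p.2) ->
  (forall w, pr (fun v => C w (primitives k v)) <=
             c * pr (fun v => C' w (primitives k v))) ->
  pr (fun w => C w (primitives k w)) <= c * pr (fun w => C' w (primitives k w)).
Proof.
move=> c0 mC mC' CC'.
have mset (D : T -> R -> bool) : measurable_fun [set: others k * R] (fun p => D p.1 p.2) ->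
    measurable [set p : others k * R | D p.1 p.2].
  by move=> mD; have := mD measurableT [set true]; rewrite setTI; apply.
have mw (D : T -> R -> bool) w : measurable_fun [set: others k * R] (fun p => D p.1 p.2) ->
    measurable_fun [set: T] (fun v => D w (primitives k v)).
  move=> mD; apply: (measurableT_comp (f := fun p : others k * R => D p.1 p.2)
    (g := fun v => (w, primitives k v))) => //.
  by apply: measurable_fun_pair => //; exact: measurable_cst.
have mdiag (D : T -> R -> bool) : measurable_fun [set: others k * R] (fun p => D p.1 p.2) ->
    measurable_fun [set: T] (fun w => D w (primitives k w)).
  move=> mD; apply: (measurableT_comp (f := fun p : others k * R => D p.1 p.2)
    (g := fun w => (w, primitives k w))) => //.
  apply: measurable_fun_pair => //.
  by move=> _ B mB; rewrite setTI; exact: measurable_others mB.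
have fin (A : set T) : measurable A -> P A \is a fin_num.
  by move=> mA; exact: fin_num_measure.
have msetT (b : T -> bool) : measurable_fun [set: T] b -> measurable [set w | b w].
  by move=> mb; have := mb measurableT [set true]; rewrite setTI; apply.
rewrite !prE; [|exact: mdiag|exact: mdiag].
rewrite -lee_fin EFinM !fineK; [|exact/fin/msetT/mdiag|exact/fin/msetT/mdiag].
apply: (indep_pair_le (customers_indep M) c0 (mset _ mC) (mset _ mC')) => w.
have xs (D : T -> R -> bool) : measurable_fun [set: others k * R] (fun p => D p.1 p.2) ->
    P (primitives k @^-1` xsection [set p : others k * R | D p.1 p.2] w) =
    (pr (fun v => D w (primitives k v)))%:E.
  move=> mD; rewrite prE ?fineK; [|exact/fin/msetT/mw|exact: mw].
  by congr (P _); apply/seteqP; split => v /=; rewrite /xsection/= inE.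
by rewrite [leLHS](xs C mC) [in leRHS](xs C' mC') -EFinM lee_fin CC'.
Qed.

Definition tail (x : R) : R := expR (- mu * Num.max x 0).

Lemma measurable_service i : measurable_fun [set: T] (service M i).
Proof. exact: measurable_funP. Qed.

Lemma service_tail i x : pr (fun w => x < service M i w) = tail x.
Proof.
have mS := measurable_service i.
have mle y : measurable_fun [set: T] (fun w => service M i w <= y).
  by apply: measurable_fun_ler => //; exact: measurable_cst.
have mge y : measurable_fun [set: T] (fun w => y <= service M i w).
  by apply: measurable_fun_ler => //; exact: measurable_cst.
have mlt y : measurable_fun [set: T] (fun w => service M i w < y).
  by apply: measurable_fun_ltr => //; exact: measurable_cst.
have mgt y : measurable_fun [set: T] (fun w => y < service M i w).
  by apply: measurable_fun_ltr => //; exact: measurable_cst.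
have neg0 : pr (fun w => service M i w < 0) = 0.
  rewrite prE//; have := @service_law _ _ _ _ _ _ _ M i `]-oo, 0[%classic (measurable_itv _).
  rewrite /distribution /pushforward/= => e.
  rewrite (_ : [set w | _] = service M i @^-1` `]-oo, 0[); last first.
    by apply/seteqP; split => w /=; rewrite in_itv.
  rewrite e /exponential_prob integral0_eq// => y; rewrite /= in_itv/= => y0.
  by rewrite lt0_exponential_pdf.
have split_le y : 0 <= y -> pr (fun w => service M i w <= y) =
    pr (fun w => 0 <= service M i w <= y).
  move=> y0; rewrite -[RHS]add0r -[X in X + _]neg0 -expectD; last 2 first.
  - exact: tame_bool.
  - by apply: tame_bool; exact: measurable_and.
  congr expect; apply/funext => w.
  case: (ltP (service M i w) 0) => /= S0; last by rewrite mulr0n add0r.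
  by rewrite (le_trans (ltW S0) y0) mulr0n addr0.
have itvE y : 0 <= y -> pr (fun w => 0 <= service M i w <= y) = 1 - expR (- mu * y).
  move=> y0; rewrite prE//; last exact: measurable_and.
  have := @service_law _ _ _ _ _ _ _ M i `[0, y]%classic (measurable_itv _).
  rewrite /distribution /pushforward/= => e.
  rewrite (_ : [set w | _] = service M i @^-1` `[0, y]); last first.
    by apply/seteqP; split => w /=; rewrite in_itv.
  rewrite e; move: y0; rewrite le_eqVlt => /predU1P[<-|y0]; last first.
    by rewrite exponential_prob_itv0c// -EFinB.
  by rewrite set_itv1 /exponential_prob integral_set1 mulr0 expR0 subrr.
have gtE y : pr (fun w => y < service M i w) = 1 - pr (fun w => service M i w <= y).
  rewrite -[in RHS](expect_cst P 1) -expectB; last 2 first.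
  - exact: tame_cst.
  - exact: tame_bool.
  by congr expect; apply/funext => w; case: (leP (service M i w) y) => _ /=; rewrite ?mulr0n ?mulr1n ?subrr ?subr0.
have [x0|x0] := leP 0 x.
  by rewrite gtE split_le// itvE// /tail max_l// opprB addrCA subrr addr0.
rewrite /tail max_r ?(ltW x0)// mulr0 expR0.
have h0 : pr (fun w => 0 < service M i w) = 1.
  by rewrite gtE split_le// itvE// mulr0 expR0 subrr subr0.
apply/le_anti/andP; split.
  rewrite -[leRHS](expect_cst P 1); apply: expect_le => [| |w]; last by rewrite lern1 leq_b1.
  - exact: tame_bool.
  - exact: tame_cst.
rewrite -[leLHS]h0; apply: expect_le => [| |w]; [exact: tame_bool|exact: tame_bool|].
rewrite ler_nat; case: (ltP 0 (service M i w)) => // S0.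
by rewrite (lt_trans x0 S0).
Qed.

Lemma tail_sub_le a b : a <= b -> tail a - tail b <= 1 - expR (- mu * (b - a)).
Proof.
move=> ab; have ab0 : Num.max a 0 <= Num.max b 0 by rewrite ge_max !le_max ab lexx orbT.
have -> : tail a - tail b =
    tail a * (1 - expR (- mu * (Num.max b 0 - Num.max a 0))).
  by rewrite mulrBr mulr1 /tail -expRD; congr (_ - expR _); ring.
have h : 0 <= 1 - expR (- mu * (Num.max b 0 - Num.max a 0)).
  by rewrite subr_ge0 -expR0 ler_expR mulNr oppr_le0 mulr_ge0 ?subr_ge0// ltW.
rewrite (le_trans (ler_piMl h _))//.
  by rewrite /tail -expR0 ler_expR mulNr oppr_le0 mulr_ge0 ?le_max ?lexx ?orbT// ltW.
rewrite lerB// ler_expR !mulNr lerN2 ler_pM2l//.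
by case: (leP a 0) => a0; case: (leP b 0) => b0; lra.
Qed.

Lemma service_between i a b : a <= b ->
  pr (fun w => a < service M i w <= b) = tail a - tail b.
Proof.
move=> ab; have mS := measurable_service i.
have mgt y : measurable_fun [set: T] (fun w => y < service M i w).
  by apply: measurable_fun_ltr => //; exact: measurable_cst.
rewrite -!(service_tail i) -expectB; last 2 first.
- exact: tame_bool.
- exact: tame_bool.
congr expect; apply/funext => w /=.
case: (leP (service M i w) b) => Sb /=; rewrite ?andbT ?mulr0n ?subr0//.
by rewrite andbF (le_lt_trans ab Sb) mulr1n subrr.
Qed.

Lemma measurable_service_gt i (W : T -> R) (x : R) :
  measurable_fun [set: others (inl (inr i))] (W : others (inl (inr i)) -> R) ->
  measurable_fun [set: others (inl (inr i)) * R]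
    (fun p : others (inl (inr i)) * R => x < W p.1 + p.2).
Proof.
move=> mW; apply: measurable_fun_ltr; first exact: measurable_cst.
by apply: measurable_funD; [exact: measurableT_comp mW measurable_fst|exact: measurable_snd].
Qed.

Lemma service_window_le i (O : T -> bool) (W : T -> R) s t : s <= t ->
  measurable_fun [set: others (inl (inr i))] (O : others (inl (inr i)) -> bool) ->
  measurable_fun [set: others (inl (inr i))] (W : others (inl (inr i)) -> R) ->
  pr (fun w => [&& O w, s < W w + service M i w & W w + service M i w <= t]) <=
  (1 - expR (- mu * (t - s))) * pr O.
Proof.
move=> st mO mW.
have e0 : 0 <= 1 - expR (- mu * (t - s)).
  by rewrite subr_ge0 -expR0 ler_expR mulNr oppr_le0 mulr_ge0 ?subr_ge0// ltW.
have mO' : measurable_fun [set: others (inl (inr i)) * R]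
    (fun p : others (inl (inr i)) * R => O p.1).
  exact: measurableT_comp mO measurable_fst.
apply: (@indep_pr_le (inl (inr i)) _
  (fun w x => [&& O w, s < W w + x & W w + x <= t]) (fun w _ => O w)) => //.
- apply: measurable_and => //; apply: measurable_and; first exact: measurable_service_gt.
  apply: measurable_fun_ler; last exact: measurable_cst.
  by apply: measurable_funD; [exact: measurableT_comp mW measurable_fst|exact: measurable_snd].
- move=> w; case: (O w) => /=; last by rewrite /pr !expect_cst mulr0.
  rewrite [leRHS](_ : _ = 1 - expR (- mu * ((t - W w) - (s - W w)))); last first.
    by rewrite /pr expect_cst mulr1; congr (_ - expR (_ * _)); ring.
  rewrite -[leLHS](congr1 _ (_ : (fun v => (s - W w) < service M i v <= t - W w) = _)); last first.
    by apply/funext => v; rewrite ltrBlDl lerBrDl.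
  by rewrite service_between ?lerD2r// tail_sub_le// lerD2r.
Qed.

Lemma service_memoryless i (O : T -> bool) (W : T -> R) s t : s <= t ->
  measurable_fun [set: others (inl (inr i))] (O : others (inl (inr i)) -> bool) ->
  measurable_fun [set: others (inl (inr i))] (W : others (inl (inr i)) -> R) ->
  (forall w, O w -> W w <= s) ->
  pr (fun w => O w && (t < W w + service M i w)) =
  expR (- mu * (t - s)) * pr (fun w => O w && (s < W w + service M i w)).
Proof.
move=> st mO mW OW.
have mO' : measurable_fun [set: others (inl (inr i)) * R]
    (fun p : others (inl (inr i)) * R => O p.1).
  exact: measurableT_comp mO measurable_fst.
have tailE w : O w -> tail (t - W w) = expR (- mu * (t - s)) * tail (s - W w).
  move=> /OW Ws; rewrite /tail !max_l ?subr_ge0//; last exact: le_trans st.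
  by rewrite -expRD; congr expR; ring.
have prE w x : pr (fun v => x < W w + service M i v) = tail (x - W w).
  rewrite -(service_tail i); congr expect; apply/funext => v.
  by rewrite ltrBlDl.
have mC x : measurable_fun [set: others (inl (inr i)) * R]
    (fun p : others (inl (inr i)) * R => O p.1 && (x < W p.1 + p.2)).
  by apply: measurable_and => //; exact: measurable_service_gt.
apply/le_anti/andP; split.
  apply: (@indep_pr_le (inl (inr i)) _
    (fun w x => O w && (t < W w + x)) (fun w x => O w && (s < W w + x))) => //.
  move=> w /=; case Ow: (O w) => /=; last by rewrite /pr !expect_cst mulr0.
  by rewrite !prE tailE.
rewrite -ler_pdivlMl ?expR_gt0// -expRN.
apply: (@indep_pr_le (inl (inr i)) _
  (fun w x => O w && (s < W w + x)) (fun w x => O w && (t < W w + x))) => //.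
move=> w /=; case Ow: (O w) => /=; last by rewrite /pr !expect_cst mulr0.
by rewrite !prE tailE// mulrA -expRD addNr expR0 mul1r.
Qed.

Definition queue (J : {set 'I_N}) (t : R) (w : T) : seq 'I_N :=
  sort (arrives_before M w) [seq i <- enum 'I_N | (i \in J) && ahead M t w i].

Definition serves (w : T) := serve (fun i => arrival M i w) (fun i => service M i w).

Definition present (J : {set 'I_N}) (t : R) (w : T) : nat :=
  count (fun e => t < e) (scanl (serves w) 0 (queue J t w)).

(* How many of the customers queued by time [t] have not left at time [s]. *)
Definition pending (J : {set 'I_N}) (s t : R) (w : T) : nat :=
  count (fun e => s < e) (scanl (serves w) 0 (queue J t w)).

Definition newcomer (s t : R) (i : 'I_N) (w : T) : bool :=
  ahead M t w i && ~~ ahead M s w i.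

Definition good (w : T) : bool := [forall i, 0 < service M i w].

Lemma num_presentE t w : num_present M t w = present everyone t w.
Proof.
rewrite /num_present /present /departures /arrivals /queue.
by congr (count _ (scanl _ _ (sort _ _))); apply: eq_filter => i; rewrite inE.
Qed.

Lemma arrives_before_total w : total (arrives_before M w).
Proof.
move=> i j; rewrite /arrives_before.
by case: (ltgtP (arrival M i w) (arrival M j w)) => //= _; exact: le_total.
Qed.

Lemma arrives_before_trans w : transitive (arrives_before M w).
Proof.
move=> j i k; rewrite /arrives_before => /orP[ij|/andP[/eqP ij mij]] /orP[jk|/andP[/eqP jk mjk]].
- by rewrite (lt_trans ij jk).
- by rewrite -jk ij.
- by rewrite ij jk.
- by rewrite ij jk eqxx (le_trans mij mjk) orbT.
Qed.

Lemma ahead_before t w i j : arrives_before M w i j -> ahead M t w j -> ahead M t w i.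
Proof.
rewrite /ahead => /orP[ij|/andP[/eqP ij mij]] /orP[jt|/andP[/eqP jt mj]].
- by rewrite (lt_trans ij jt).
- by rewrite -jt ij.
- by rewrite ij jt.
- by rewrite ij jt eqxx (le_lt_trans mij mj) orbT.
Qed.

Lemma ahead_le t w i : ahead M t w i -> arrival M i w <= t.
Proof. by move=> /orP[/ltW//|/andP[/eqP -> _]]. Qed.

Lemma not_ahead_ge t w i : ~~ ahead M t w i -> t <= arrival M i w.
Proof. by rewrite /ahead negb_or => /andP[]; rewrite -leNgt. Qed.

Lemma ahead_mono s t w i : s < t -> ahead M s w i -> ahead M t w i.
Proof. by move=> st /ahead_le is_; rewrite /ahead (le_lt_trans is_ st). Qed.

Lemma uniq_queue J t w : uniq (queue J t w).
Proof. by rewrite sort_uniq filter_uniq// enum_uniq. Qed.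

Lemma mem_queue J t w i : (i \in queue J t w) = (i \in J) && ahead M t w i.
Proof. by rewrite mem_sort mem_filter mem_enum andbT. Qed.

Lemma filter_queue (p : pred 'I_N) J t w :
  [seq i <- queue J t w | p i] =
  sort (arrives_before M w) [seq i <- enum 'I_N | [&& p i, i \in J & ahead M t w i]].
Proof.
rewrite /queue filter_sort; [|exact: arrives_before_total|exact: arrives_before_trans].
by rewrite -filter_predI.
Qed.

Lemma queue_split J s t w : s < t ->
  queue J t w = queue J s w ++ [seq i <- queue J t w | ~~ ahead M s w i].
Proof.
move=> st.
have -> : queue J s w = [seq i <- queue J t w | ahead M s w i].
  rewrite filter_queue /queue; congr sort; apply: eq_filter => i.
  case: (i \in J) => /=; last by rewrite andbF.
  by case h: (ahead M s w i) => //=; rewrite (ahead_mono st h).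
have := sort_sorted (arrives_before_total w) [seq i <- enum 'I_N | (i \in J) && ahead M t w i].
rewrite -/(queue J t w); elim: (queue J t w) => //= x l IH xl.
case: (boolP (ahead M s w x)) => /= hx; first by rewrite -IH// (path_sorted xl).
have none : {in l, forall y, ~~ ahead M s w y}.
  move=> y yl; apply: contra hx => hy; apply: ahead_before hy.
  by have /allP/(_ y yl) := order_path_min (@arrives_before_trans w) xl.
rewrite [X in X ++ _](_ : _ = [::]); last first.
  by apply/eqP; rewrite -(negbK (_ == _)) -has_filter -all_predC; exact/allP.
rewrite cat0s; congr cons; apply/esym/all_filterP; exact/allP.
Qed.

Lemma pendingE J s t w : good w -> s < t ->
  pending J s t w = (present J s w + \sum_(i in J) newcomer s t i w)%N.
Proof.
move=> /forallP gw st; rewrite /pending (queue_split J w st) count_scanl_serve_cat//; last first.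
  by move=> i; rewrite mem_filter => /andP[/not_ahead_ge].
congr addn; rewrite filter_queue size_sort size_filter -sum1_count.
rewrite big_enum_cond big_mkcond [RHS]big_mkcond/=.
apply: eq_bigr => i _; rewrite /newcomer.
by case: (i \in J); case: (ahead M s w i); case: (ahead M t w i).
Qed.

Lemma size_queue_le J t w : (size (queue J t w) <= #|J|)%N.
Proof.
rewrite /queue size_sort cardE; apply: uniq_leq_size.
  by rewrite filter_uniq// enum_uniq.
by move=> i; rewrite mem_filter !mem_enum => /andP[/andP[]].
Qed.

Lemma present_le_card J t w : (present J t w <= #|J|)%N.
Proof.
rewrite (leq_trans (count_size _ _))// size_scanl; exact: size_queue_le.
Qed.

Lemma pending_le_size J s t w : (pending J s t w <= size (queue J t w))%N.
Proof. by rewrite (leq_trans (count_size _ _))// size_scanl. Qed.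

Lemma present_le_pending J s t w : s <= t -> (present J t w <= pending J s t w)%N.
Proof. by move=> st; apply: sub_count => e; exact: le_lt_trans. Qed.

Lemma present_subset (J J' : {set 'I_N}) t w : good w -> J' \subset J ->
  (present J' t w <= present J t w)%N.
Proof.
move=> /forallP gw /fintype.subsetP J'J; apply: count_scanl_serve_subseq => //.
have -> : queue J' t w = [seq i <- queue J t w | i \in J'].
  rewrite filter_queue /queue; congr sort; apply: eq_filter => i /=.
  by case h: (i \in J') => //=; rewrite (J'J _ h).
exact: filter_subseq.
Qed.

Lemma present_setD1 J t w i : ~~ ahead M t w i -> present (J :\ i) t w = present J t w.
Proof.
move=> hi; rewrite /present; suff -> : queue (J :\ i) t w = queue J t w by [].
rewrite /queue; congr sort; apply: eq_filter => j; rewrite !inE.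
by case: eqP => [->|//]; rewrite (negbTE hi) !andbF.
Qed.

Lemma present_all (J : {set 'I_N}) t w : good w ->
  (forall i, i \in J -> ahead M t w i && (t < service M i w)) -> present J t w = #|J|.
Proof.
move=> /forallP gw h; rewrite /present count_scanl_serve_all_long//.
  rewrite -(card_uniqP (uniq_queue J t w)).
  apply: eq_card => i; rewrite mem_queue.
  by case iJ: (i \in J) => //=; have /andP[-> _] := h i iJ.
by move=> i; rewrite mem_queue => /andP[/h/andP[]].
Qed.

Lemma present_gt0 (J : {set 'I_N}) t w i : good w -> i \in J -> ahead M t w i -> t < service M i w ->
  (0 < present J t w)%N.
Proof.
move=> /forallP gw iJ ti tS; apply: (@count_scanl_serve_long _ _ _ _ gw t 0 _ i) => //.
by rewrite mem_queue iJ.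
Qed.

Lemma leq_pending J s t w k : good w -> (0 < k <= size (queue J t w))%N ->
  (k <= pending J s t w)%N =
  (s < foldl (serves w) 0 (take (size (queue J t w) - k).+1 (queue J t w))).
Proof. by move=> /forallP gw; exact: count_scanl_serve. Qed.

(* A snapshot has finitely many values, and on each of them the queues at times
   [s] and [t] are fixed lists. *)
Definition snapshot (J : {set 'I_N}) (s t : R) (w : T) :
    {ffun 'I_N -> bool} * {ffun 'I_N -> bool} * {ffun 'I_N * 'I_N -> bool} :=
  ([ffun i => (i \in J) && ahead M s w i],
   [ffun i => (i \in J) && ahead M t w i],
   [ffun p => [&& p.1 \in J, p.2 \in J & arrives_before M w p.1 p.2]]).

Definition line (o : {ffun 'I_N * 'I_N -> bool}) (a : {ffun 'I_N -> bool}) : seq 'I_N :=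
  sort (fun i j => o (i, j)) [seq i <- enum 'I_N | a i].

Lemma eq_in_sort (S : eqType) (r r' : rel S) (l : seq S) :
  {in l &, r =2 r'} -> sort r l = sort r' l.
Proof.
have key n (t : n.-tuple S) : {in t &, r =2 r'} -> sort r t = sort r' t.
  move=> rr'; rewrite -[X in sort r X]map_tnth_enum -[X in sort r' X]map_tnth_enum.
  rewrite [LHS]sort_map [RHS]sort_map; congr (map _ (sort _ _)).
  by apply/funext => i; apply/funext => j /=; apply: rr'; exact: mem_tnth.
exact: (key _ (in_tuple l)).
Qed.

Lemma queue_line J s t w b : snapshot J s t w = b ->
  queue J s w = line b.2 b.1.1 /\ queue J t w = line b.2 b.1.2.
Proof.
move=> <-; rewrite /line /queue /=; split.
  rewrite [in RHS](eq_filter (a2 := fun i => (i \in J) && ahead M s w i)); last first.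
    by move=> i; rewrite ffunE.
  apply: eq_in_sort => i j; rewrite !mem_filter => /andP[/andP[iJ _] _] /andP[/andP[jJ _] _].
  by rewrite ffunE /= iJ jJ.
rewrite [in RHS](eq_filter (a2 := fun i => (i \in J) && ahead M t w i)); last first.
  by move=> i; rewrite ffunE.
apply: eq_in_sort => i j; rewrite !mem_filter => /andP[/andP[iJ _] _] /andP[/andP[jJ _] _].
by rewrite ffunE /= iJ jJ.
Qed.

Section Measurability.
Context (d' : measure_display) (T' : measurableType d') (e : T' -> T) (J : {set 'I_N}).

Lemma measurable_all (B : Type) (r : seq B) (p : B -> T' -> bool) :
  (forall x, measurable_fun [set: T'] (p x)) ->
  measurable_fun [set: T'] (fun w => all (p^~ w) r).
Proof.
move=> mp; elim: r => [|x r IH] /=; first exact: measurable_cst.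
exact: measurable_and.
Qed.

Lemma measurable_forall (B : finType) (p : B -> T' -> bool) :
  (forall x, measurable_fun [set: T'] (p x)) ->
  measurable_fun [set: T'] (fun w => [forall x, p x w]).
Proof.
move=> mp; rewrite [X in measurable_fun _ X](_ : _ = fun w => all (p^~ w) (enum B)).
  exact: measurable_all.
apply/funext => w; apply/forallP/allP => h x; first by rewrite h.
by apply: h; rewrite mem_enum.
Qed.

Lemma measurable_exists (B : finType) (p : B -> T' -> bool) :
  (forall x, measurable_fun [set: T'] (p x)) ->
  measurable_fun [set: T'] (fun w => [exists x, p x w]).
Proof.
move=> mp; rewrite [X in measurable_fun _ X](_ : _ = fun w => ~~ [forall x, ~~ p x w]).
  by apply/measurable_neg/measurable_forall => x; exact/measurable_neg.
by apply/funext => w; rewrite negb_forall; apply: eq_existsb => x; rewrite negbK.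
Qed.

Lemma measurable_ffun_eq (B : finType) (f : T' -> {ffun B -> bool}) (b : {ffun B -> bool}) :
  (forall x, measurable_fun [set: T'] (fun w => f w x)) ->
  measurable_fun [set: T'] (fun w => f w == b).
Proof.
move=> mf; rewrite [X in measurable_fun _ X](_ : _ = fun w => [forall x, f w x == b x]).
  apply: measurable_forall => x; case: (b x).
    by under eq_fun do rewrite eqb_id; exact: mf.
  by under eq_fun do rewrite eqbF_neg; exact/measurable_neg.
apply/funext => w; apply/eqP/forallP => [-> //|h].
by apply/ffunP => x; exact/eqP.
Qed.

Hypothesis mX : forall i, i \in J -> measurable_fun [set: T'] (fun w => arrival M i (e w)).
Hypothesis mU : forall o, measurable_fun [set: T'] (fun w => mark M o (e w)).

Lemma measurable_ahead t i : i \in J -> measurable_fun [set: T'] (fun w => ahead M t (e w) i).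
Proof.
move=> iJ; apply: measurable_or.
  by apply: measurable_fun_ltr; [exact: mX|exact: measurable_cst].
apply: measurable_and; last exact: measurable_fun_ltr.
by apply: measurable_fun_eqr; [exact: mX|exact: measurable_cst].
Qed.

Lemma measurable_newcomer s t i : i \in J ->
  measurable_fun [set: T'] (fun w => newcomer s t i (e w)).
Proof.
move=> iJ; apply: measurable_and; first exact: measurable_ahead.
by apply/measurable_neg; exact: measurable_ahead.
Qed.

Lemma measurable_snapshot s t b :
  measurable_fun [set: T'] (fun w => snapshot J s t (e w) == b).
Proof.
rewrite [X in measurable_fun _ X](_ : _ = fun w =>
    (((snapshot J s t (e w)).1.1 == b.1.1) && ((snapshot J s t (e w)).1.2 == b.1.2)) &&
    ((snapshot J s t (e w)).2 == b.2)); last first.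
  by apply/funext => w; case: b => [[]].
apply: measurable_and; [apply: measurable_and|]; apply: measurable_ffun_eq => x.
- under eq_fun do rewrite ffunE; case xJ: (x \in J); last exact: measurable_cst.
  exact: measurable_ahead.
- under eq_fun do rewrite ffunE; case xJ: (x \in J); last exact: measurable_cst.
  exact: measurable_ahead.
- under eq_fun do rewrite ffunE.
  case xJ: (x.1 \in J); last exact: measurable_cst.
  case yJ: (x.2 \in J); last exact: measurable_cst.
  apply: measurable_or; first by apply: measurable_fun_ltr; exact: mX.
  apply: measurable_and; last exact: measurable_fun_ler.
  by apply: measurable_fun_eqr; exact: mX.
Qed.

Hypothesis mS : forall i, i \in J -> measurable_fun [set: T'] (fun w => service M i (e w)).

Lemma measurable_serve (D : T' -> R) i : i \in J -> measurable_fun [set: T'] D ->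
  measurable_fun [set: T'] (fun w => serves (e w) (D w) i).
Proof.
move=> iJ mD; apply: measurable_funD; last exact: mS.
by apply: measurable_maxr => //; exact: mX.
Qed.

Lemma measurable_count_scanl t (D : T' -> R) l k : {subset l <= J} ->
  measurable_fun [set: T'] D ->
  measurable_fun [set: T'] (fun w => (k <= count (fun x => (t < x)%R)
    (scanl (serves (e w)) (D w) l))%N).
Proof.
elim: l D k => [|i l IH] D k lJ mD /=; first exact: measurable_cst.
have iJ : i \in J by apply: lJ; exact: mem_head.
have mD' := measurable_serve iJ mD.
have lJ' : {subset l <= J} by move=> j jl; apply: lJ; rewrite in_cons jl orbT.
rewrite [X in measurable_fun _ X](_ : _ = fun w =>
    ((t < serves (e w) (D w) i) && (k.-1 <= count (fun x => (t < x)%R)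
      (scanl (serves (e w)) (serves (e w) (D w) i) l))%N) ||
    (k <= count (fun x => (t < x)%R)
      (scanl (serves (e w)) (serves (e w) (D w) i) l))%N).
  apply: measurable_or; last exact: (IH (fun w => serves (e w) (D w) i)).
  apply: measurable_and; last exact: (IH (fun w => serves (e w) (D w) i)).
  by apply: measurable_fun_ltr => //; exact: measurable_cst.
apply/funext => w; set c := count _ _.
case: (t < _) => /=; last by rewrite add0n.
by rewrite add1n; case: k => //= k; rewrite ltnS; apply/idP/orP => [h|[//|/ltnW//]]; left.
Qed.

Lemma measurable_pending s t k :
  measurable_fun [set: T'] (fun w => (k <= pending J s t (e w))%N).
Proof.
rewrite [X in measurable_fun _ X](_ : _ = fun w => [exists b,
    (snapshot J t t (e w) == b) && ([forall i, b.1.2 i ==> (i \in J)] &&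
    (k <= count (fun x => (s < x)%R) (scanl (serves (e w)) 0%R (line b.2 b.1.2)))%N)]).
  apply: measurable_exists => b; apply: measurable_and; first exact: measurable_snapshot.
  case: (boolP [forall i, _]) => /= [/forallP bJ|_]; last exact: measurable_cst.
  apply: (@measurable_count_scanl s (fun=> 0)); last exact: measurable_cst.
  by move=> i; rewrite mem_sort mem_filter => /andP[/(implyP (bJ i))].
apply/funext => w; apply/idP/existsP => [h|[b /andP[/eqP sb /andP[_]]]].
  exists (snapshot J t t (e w)); rewrite eqxx /=; apply/andP; split.
    by apply/forallP => i; rewrite ffunE; apply/implyP => /andP[].
  by have [_ <-] := queue_line (erefl (snapshot J t t (e w))).
by have [_ <-] := queue_line sb.
Qed.

Lemma measurable_present t k :
  measurable_fun [set: T'] (fun w => (k <= present J t (e w))%N).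
Proof. exact: (measurable_pending t t). Qed.

Lemma measurable_foldl_serve (l : seq 'I_N) : {subset l <= J} ->
  measurable_fun [set: T'] (fun w => foldl (serves (e w)) 0 l).
Proof.
elim/last_ind: l => [|l i IH] lJ; first exact: measurable_cst.
under eq_fun do rewrite foldl_rcons.
apply: measurable_serve; first by rewrite lJ// mem_rcons mem_head.
by apply: IH => j jl; rewrite lJ// mem_rcons in_cons jl orbT.
Qed.

End Measurability.

Lemma measurable_arrival i : measurable_fun [set: T] (fun w => arrival M i w).
Proof. exact: measurable_funP. Qed.

Lemma measurable_mark o : measurable_fun [set: T] (fun w => mark M o w).
Proof. exact: measurable_funP. Qed.

Lemma measurable_good : measurable_fun [set: T] good.
Proof.
apply: measurable_forall => i.
by apply: measurable_fun_ltr; [exact: measurable_cst|exact: measurable_funP].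
Qed.

Lemma pr_good : pr good = 1.
Proof.
apply/le_anti/andP; split.
  rewrite -[leRHS](expect_cst P 1); apply: expect_le => [| |w]; last by rewrite lern1 leq_b1.
  - exact/tame_bool/measurable_good.
  - exact: tame_cst.
have tpos i : tame (fun w => (0 < service M i w)%R%:R : R).
  by apply: tame_bool; apply: measurable_fun_ltr; [exact: measurable_cst|exact: measurable_funP].
have : expect (fun w => 1 - \sum_(i : 'I_N) (1 - (0 < service M i w)%R%:R)) <= pr good.
  apply: expect_le => [| |w].
  - apply: tameB; first exact: tame_cst.
    by apply: tame_sum => i; apply: tameB => //; exact: tame_cst.
  - exact/tame_bool/measurable_good.
  - case: (boolP (good w)) => [/forallP gw|]; rewrite ?mulr1n ?mulr0n.
      by rewrite big1 ?subr0// => i _; rewrite gw subrr.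
    rewrite negb_forall => /existsP[i hi]; rewrite subr_le0 (bigD1 i)//=.
    rewrite (negbTE hi) subr0 lerDl sumr_ge0// => j _.
    by rewrite subr_ge0 lern1 leq_b1.
apply: le_trans; rewrite expectB; last 2 first.
- exact: tame_cst.
- by apply: tame_sum => i; apply: tameB => //; exact: tame_cst.
rewrite expect_cst expect_sum; last by move=> i; apply: tameB => //; exact: tame_cst.
rewrite big1 ?subr0// => i _; rewrite expectB ?expect_cst//; last exact: tame_cst.
by rewrite -[X in _ - X]/(pr _) service_tail /tail maxxx mulr0 expR0 subrr.
Qed.

Lemma measurable_snapshotT J s t b : measurable_fun [set: T] (fun w => snapshot J s t w == b).
Proof.
apply: (@measurable_snapshot _ T id J) => [i _|o].
- exact: measurable_arrival.
- exact: measurable_mark.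
Qed.

Lemma measurable_pendingT J s t k : measurable_fun [set: T] (fun w => (k <= pending J s t w)%N).
Proof.
apply: (@measurable_pending _ T id J) => [i _|o|i _].
- exact: measurable_arrival.
- exact: measurable_mark.
- exact: measurable_service.
Qed.

Lemma measurable_presentT J t k : measurable_fun [set: T] (fun w => (k <= present J t w)%N).
Proof. exact: measurable_pendingT. Qed.

Lemma measurable_present_ltT J t k : measurable_fun [set: T] (fun w => (present J t w < k)%N).
Proof.
rewrite [X in measurable_fun _ X](_ : _ = fun w => ~~ (k <= present J t w)%N).
  exact/measurable_neg/measurable_presentT.
by apply/funext => w; rewrite ltnNge.
Qed.

Lemma measurable_present_eqT J t k : measurable_fun [set: T] (fun w => present J t w == k).
Proof.
rewrite [X in measurable_fun _ X](_ : _ = fun w => (k <= present J t w)%N && (present J t w < k.+1)%N).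
  by apply: measurable_and; [exact: measurable_presentT|exact: measurable_present_ltT].
by apply/funext => w; rewrite ltnS eqn_leq andbC.
Qed.

Lemma measurable_newcomerT s t i : measurable_fun [set: T] (newcomer s t i).
Proof.
apply: (@measurable_newcomer _ T id everyone) => [j _|o|].
- exact: measurable_arrival.
- exact: measurable_mark.
- by rewrite inE.
Qed.

Lemma measurable_leavingT J s t k :
  measurable_fun [set: T] (fun w => (present J t w < k <= pending J s t w)%N).
Proof.
by apply: measurable_and; [exact: measurable_present_ltT|exact: measurable_pendingT].
Qed.

Lemma expect_snapshot J s t (f : T -> R) : tame f ->
  expect f = \sum_b expect (fun w => (snapshot J s t w == b)%:R * f w).
Proof.
move=> tf; rewrite -expect_sum; last first.
  by move=> b; apply: tameM => //; apply: tame_bool; exact: measurable_snapshotT.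
congr expect; apply/funext => w; rewrite (bigD1 (snapshot J s t w))//= eqxx mul1r.
by rewrite big1 ?addr0// => b /negbTE; rewrite eq_sym => ->; rewrite mul0r.
Qed.

Lemma pr_snapshot J s t (p : T -> bool) : measurable_fun [set: T] p ->
  pr p = \sum_b pr (fun w => (snapshot J s t w == b) && p w).
Proof.
move=> mp; rewrite [LHS](expect_snapshot J s t (tame_bool _ mp)).
by apply: eq_bigr => b _; congr expect; apply/funext => w; rewrite -mulnb natrM.
Qed.

Lemma uniq_line o a : uniq (line o a : seq 'I_N).
Proof. by rewrite sort_uniq filter_uniq// enum_uniq. Qed.

Lemma pending_position J s t b k : (0 < k <= size (line b.2 b.1.2))%N ->
  exists p i, [/\ uniq (rcons p i), i \in line b.2 b.1.2 &
    forall w x, good w -> snapshot J s t w = b ->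
      ((k <= pending J x t w)%N =
        (x < Num.max (foldl (serves w) 0 p) (arrival M i w) + service M i w)) /\
      (0 <= x -> (k < pending J x t w)%N = (x < foldl (serves w) 0 p))].
Proof.
set l := line _ _ => /andP[k0 kl].
have [x0 _] : exists x0 : 'I_N, x0 \in l.
  case: l kl => [|x0 l' _]; first by rewrite leqNgt k0.
  by exists x0; exact: mem_head.
set n := (size l - k)%N; have nl : (n < size l)%N by rewrite /n; lia.
have tk := take_nth x0 nl.
exists (take n l), (nth x0 l n); split.
- by rewrite -tk take_uniq// uniq_line.
- exact: mem_nth.
move=> w x gw sb; have [_ ql] := queue_line sb; split.
  rewrite leq_pending// ?ql -/l; last by rewrite k0.
  by rewrite tk foldl_rcons.
move=> x0'; have [kl'|lk] := leqP k.+1 (size l).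
  rewrite leq_pending// ?ql -/l ?kl'//.
  by rewrite (_ : (size l - k.+1).+1 = n)// /n; lia.
have -> : n = 0%N by rewrite /n; lia.
rewrite take0/= ltNge x0'/=; apply/negbTE; rewrite -leqNgt.
by rewrite (leq_trans (pending_le_size _ _ _ _))// ql -/l; lia.
Qed.

Lemma others_measurability (k : 'I_N) J s t b (l : seq 'I_N) : k \notin l ->
  let U := others (inl (inr k)) in
  [/\ measurable_fun [set: U] (fun w : U => snapshot J s t w == b),
      measurable_fun [set: U] (fun w : U => foldl (serves w) 0 l) &
      forall i, measurable_fun [set: U] (fun w : U => arrival M i w)].
Proof.
move=> kl U.
have mX i : measurable_fun [set: U] (fun w : U => arrival M i w).
  exact: (@measurable_fun_others _ _ _ _ _ primitives (inl (inl i)) (inl (inr k))).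
have mU o : measurable_fun [set: U] (fun w : U => mark M o w).
  exact: (@measurable_fun_others _ _ _ _ _ primitives (inr o) (inl (inr k))).
split => //.
  exact: (@measurable_snapshot _ U id J).
apply: (@measurable_foldl_serve _ U id [set~ k]%SET).
- by move=> i _; exact: mX.
- move=> i; rewrite !inE => ik.
  by apply: (@measurable_fun_others _ _ _ _ _ primitives (inl (inr i)) (inl (inr k))).
- by move=> i il; rewrite !inE; apply: contraNN kl => /eqP <-.
Qed.

Lemma leak_ge0 s t : s <= t -> 0 <= leak s t.
Proof. by move=> st; rewrite subr_ge0 -expR0 ler_expR mulNr oppr_le0 mulr_ge0 ?subr_ge0// ltW. Qed.

Lemma leaving_snapshot_le J s t b k : s <= t -> (0 < k)%N ->
  pr (fun w => (snapshot J s t w == b) && (present J t w < k <= pending J s t w)%N) <=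
  leak s t * pr (fun w => snapshot J s t w == b).
Proof.
move=> st k0.
have mO := measurable_snapshotT J s t b.
have [kl|kl] := leqP k (size (line b.2 b.1.2)); last first.
  rewrite /pr (_ : (fun w => _) = (fun=> 0)) ?expect_cst ?mulr_ge0 ?leak_ge0 ?pr_ge0//.
  apply/funext => w; case: eqP => //= sb.
  have [_ ql] := queue_line sb.
  have := pending_le_size J s t w; rewrite ql => h.
  by rewrite [(k <= _)%N]leqNgt (leq_ltn_trans h kl) andbF.
have [p [i [+ il pos]]] := @pending_position J s t b k ltac:(by rewrite k0).
rewrite rcons_uniq => /andP[ip _].
have [mOi mD mX] := others_measurability J s t b ip.
set W := fun w => Num.max (foldl (serves w) 0 p) (arrival M i w).
have mW : measurable_fun [set: others (inl (inr i))] (W : others (inl (inr i)) -> R).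
  exact: measurable_maxr.
apply: le_trans (service_window_le st mOi mW).
have mS := measurable_service i.
have mWT : measurable_fun [set: T] W.
  move=> _ B mB; have := mW measurableT B mB; rewrite !setTI; exact: measurable_others.
apply: (@expect_le_as _ _ _ _ good); [exact: measurable_good|exact: pr_good| | |].
- by apply: tame_bool; apply: measurable_and => //; exact: measurable_leavingT.
- apply: tame_bool; apply: measurable_and => //; apply: measurable_and.
    apply: measurable_fun_ltr; first exact: measurable_cst.
    exact: measurable_funD.
  apply: measurable_fun_ler; last exact: measurable_cst.
  exact: measurable_funD.
move=> w gw; rewrite ler_nat; case: eqP => //= sb.
have [e1 _] := pos w s gw sb; have [e2 _] := pos w t gw sb.
rewrite e1 ltnNge e2 -leNgt /W andbC.
by case: (_ && _).
Qed.

Lemma pr_le_good (p p' : T -> bool) :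
  measurable_fun [set: T] p -> measurable_fun [set: T] p' ->
  (forall w, good w -> p w -> p' w) -> pr p <= pr p'.
Proof.
move=> mp mp' pp'.
apply: (@expect_le_as _ _ _ _ good); [exact: measurable_good|exact: pr_good| | |].
- exact: tame_bool.
- exact: tame_bool.
move=> w gw; rewrite ler_nat; case h: (p w) => //.
by rewrite (pp' w gw h).
Qed.

Lemma pr_eq_good (p p' : T -> bool) :
  measurable_fun [set: T] p -> measurable_fun [set: T] p' ->
  (forall w, good w -> p w = p' w) -> pr p = pr p'.
Proof.
by move=> mp mp' pp'; apply/le_anti/andP; split; apply: pr_le_good => // w gw; rewrite pp'.
Qed.

Lemma pr_split (p p' : T -> bool) :
  measurable_fun [set: T] p -> measurable_fun [set: T] p' ->
  pr p = pr (fun w => p w && p' w) + pr (fun w => p w && ~~ p' w).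
Proof.
move=> mp mp'; rewrite -expectD; last 2 first.
- by apply: tame_bool; exact: measurable_and.
- by apply: tame_bool; apply: measurable_and => //; exact: measurable_neg.
congr expect; apply/funext => w.
by case: (p w); case: (p' w); rewrite /= ?mulr1n ?mulr0n ?addr0 ?add0r.
Qed.

Lemma pr_cst_false : pr (fun=> false) = 0.
Proof. by rewrite /pr expect_cst. Qed.

Lemma leaving_le J (s t : R) k : s <= t -> (0 < k)%N ->
  pr (fun w => (present J t w < k <= pending J s t w)%N) <= leak s t.
Proof.
move=> st k0; rewrite (pr_snapshot J s t (measurable_leavingT J s t k)).
have -> : leak s t = \sum_b leak s t * pr (fun w => snapshot J s t w == b).
  rewrite -mulr_sumr -[LHS]mulr1; congr (_ * _).
  rewrite -[LHS](expect_cst P 1) (expect_snapshot J s t (tame_cst _ _)).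
  by apply: eq_bigr => b _; congr expect; apply/funext => w; rewrite mulr1.
by apply: ler_sum => b _; exact: (leaving_snapshot_le).
Qed.

Lemma departure_window_le J (s t : R) b p : 0 <= s -> s <= t -> uniq p ->
  pr (fun w => (snapshot J s t w == b) && (s < foldl (serves w) 0 p <= t)) <=
  leak s t * pr (fun w => snapshot J s t w == b).
Proof.
move=> s0 st; case/lastP: p => [|p j].
  rewrite (_ : (fun w => _) = (fun=> false)) ?pr_cst_false ?mulr_ge0 ?leak_ge0 ?pr_ge0//.
  by apply/funext => w /=; rewrite ltNge s0/= andbF.
rewrite rcons_uniq => /andP[jp _].
have [mOi mD mX] := others_measurability J s t b jp.
have mW : measurable_fun [set: others (inl (inr j))] ((fun w : T =>
    Num.max (foldl (serves w) 0 p) (arrival M j w)) : others (inl (inr j)) -> R).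
  exact: measurable_maxr.
apply: le_trans (service_window_le st mOi mW).
by rewrite le_eqVlt; apply/orP; left; apply/eqP; congr pr; apply/funext => w; rewrite foldl_rcons.
Qed.

(* The error term accounts for two departures between [s] and [t]. *)
Lemma leaving_snapshot_approx J (s t : R) b k : 0 <= s -> s <= t -> (0 < k)%N ->
  b.1.1 = b.1.2 ->
  `|pr (fun w => (snapshot J s t w == b) && (present J t w < k <= pending J s t w)%N) -
    leak s t * pr (fun w => (snapshot J s t w == b) && (present J s w == k))| <=
  leak s t ^+ 2 * pr (fun w => snapshot J s t w == b).
Proof.
move=> s0 st k0 beq.
have mO := measurable_snapshotT J s t b.
have pending_s w : snapshot J s t w = b -> pending J s t w = present J s w.
  move=> sb; have [qs qt] := queue_line sb.
  by rewrite /pending /present qs qt beq.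
have [kl|kl] := leqP k (size (line b.2 b.1.2)); last first.
  rewrite /pr (_ : (fun w => _) = (fun=> 0)); last first.
    apply/funext => w; case: eqP => //= sb.
    have [_ ql] := queue_line sb.
    have := pending_le_size J s t w; rewrite ql => h.
    by rewrite [(k <= _)%N]leqNgt (leq_ltn_trans h kl) andbF.
  rewrite [X in leak s t * expect X](_ : _ = (fun=> 0)); last first.
    apply/funext => w; case: eqP => //= sb; rewrite -(pending_s _ sb).
    have [_ ql] := queue_line sb.
    have := pending_le_size J s t w; rewrite ql => h.
    by rewrite ltn_eqF// (leq_ltn_trans h kl).
  by rewrite !expect_cst mulr0 subrr normr0 mulr_ge0 ?exprn_ge0 ?leak_ge0 ?pr_ge0.
have [p [i [+ il pos]]] := @pending_position J s t b k ltac:(by rewrite k0).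
rewrite rcons_uniq => /andP[ip up].
have [mOi mD mX] := others_measurability J s t b ip.
pose D w := foldl (serves w) 0 p.
pose W w := Num.max (D w) (arrival M i w).
have mW : measurable_fun [set: others (inl (inr i))] (W : others (inl (inr i)) -> R).
  exact: measurable_maxr.
have mS := measurable_service i.
have toT (f : T -> R) : measurable_fun [set: others (inl (inr i))] (f : others (inl (inr i)) -> R) ->
    measurable_fun [set: T] f.
  move=> mf _ B mB; have := mf measurableT B mB; rewrite !setTI; exact: measurable_others.
have mWT := toT _ mW.
have mDT : measurable_fun [set: T] D by exact: toT.
have mgt x : measurable_fun [set: T] (fun w => x < W w + service M i w).
  by apply: measurable_fun_ltr; [exact: measurable_cst|exact: measurable_funD].
have mDle : measurable_fun [set: others (inl (inr i))] (fun w : others (inl (inr i)) => D w <= s).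
  by apply: measurable_fun_ler => //; exact: measurable_cst.
have mDleT : measurable_fun [set: T] (fun w => D w <= s).
  by apply: measurable_fun_ler => //; exact: measurable_cst.
pose O w := (snapshot J s t w == b) && (D w <= s).
have mO' : measurable_fun [set: T] O by exact: measurable_and.
have mO'i : measurable_fun [set: others (inl (inr i))] (O : others (inl (inr i)) -> bool).
  exact: measurable_and.
have OW w : O w -> W w <= s.
  move=> /andP[/eqP sb Ds]; rewrite ge_max Ds/=.
  have := il; rewrite mem_sort mem_filter => /andP[+ _].
  by rewrite -beq -sb ffunE => /andP[_ /ahead_le].
have leave_fst : pr (fun w => (snapshot J s t w == b) && (present J t w < k <= pending J s t w)%N && (D w <= s)) =
    leak s t * pr (fun w => (snapshot J s t w == b) && (present J s w == k)).
  have -> : pr (fun w => (snapshot J s t w == b) && (present J s w == k)) =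
      pr (fun w => O w && (s < W w + service M i w)).
    apply: pr_eq_good => [| |w gw].
    - by apply: measurable_and => //; exact: measurable_present_eqT.
    - exact: measurable_and.
    rewrite /O; case: eqP => //= sb; have [e1 e2] := pos w s gw sb.
    by rewrite -(pending_s _ sb) eqn_leq leqNgt e2// -leNgt e1.
  rewrite mulrBl mul1r -(service_memoryless st mO'i mW OW).
  rewrite (pr_split (p := fun w => O w && (s < W w + service M i w))
    (p' := fun w => t < W w + service M i w)); [|exact: measurable_and|exact: mgt].
  rewrite (_ : pr (fun w => O w && (s < _) && (t < _)) = pr (fun w => O w && (t < W w + service M i w))); last first.
    congr pr; apply/funext => w; case: (O w) => //=.
    by case h: (t < _); rewrite ?andbF// (le_lt_trans st h).
  rewrite [X in _ = X - _]addrC addrK; apply: pr_eq_good => [| |w gw].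
  - by apply: measurable_and => //; apply: measurable_and => //; exact: measurable_leavingT.
  - by apply: measurable_and; [exact: measurable_and|exact/measurable_neg].
  rewrite /O; case: eqP => //= sb.
  have [e1 _] := pos w s gw sb; have [e2 _] := pos w t gw sb.
  by rewrite e1 ltnNge e2 -/(D w) -/(W w) andbC -andbA [(~~ _) && _]andbC.
rewrite (pr_split (p' := fun w => D w <= s)); [|by apply: measurable_and => //; exact: measurable_leavingT|done].
rewrite leave_fst [X in `|X - _|]addrC addrK ger0_norm ?pr_ge0//.
apply: (@le_trans _ _ (leak s t * pr (fun w => (snapshot J s t w == b) && (s < D w <= t)))); last first.
  by rewrite expr2 -mulrA ler_wpM2l ?leak_ge0// departure_window_le.
have -> : leak s t = leak 0 (t - s) by rewrite subr0.
have mB : measurable_fun [set: others (inl (inr i))]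
    (fun w : others (inl (inr i)) => (snapshot J s t w == b) && (s < D w <= t)).
  apply: measurable_and => //; apply: measurable_and.
    by apply: measurable_fun_ltr => //; exact: measurable_cst.
  by apply: measurable_fun_ler => //; exact: measurable_cst.
have := @service_window_le i _ (fun=> 0) 0 (t - s) _ mB (measurable_cst _).
rewrite subr_ge0 => /(_ st); apply: le_trans; apply: pr_le_good => [| |w gw].
- apply: measurable_and; last exact/measurable_neg.
  by apply: measurable_and => //; exact: measurable_leavingT.
- apply: measurable_and; first exact: measurable_fun_bool_others mB.
  apply: measurable_and; first by apply: measurable_fun_ltr; [exact: measurable_cst|exact: measurable_funD].
  by apply: measurable_fun_ler; [exact: measurable_funD|exact: measurable_cst].
case: eqP => //= sb; have [e1 _] := pos w s gw sb; have [e2 _] := pos w t gw sb.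
rewrite e1 ltnNge e2 -leNgt !add0r -/(D w) => /andP[/andP[h1 h2]].
rewrite -ltNge => h4; rewrite h4 /=.
have /forallP/(_ i) S0 := gw; rewrite S0/=.
have h3 : D w <= Num.max (D w) (arrival M i w) by rewrite le_max lexx.
apply/andP; split; first by apply: le_trans h1; rewrite (le_trans h3)// lerDl ltW.
by move: h1; set m := Num.max _ _ in h3 *; move: h4; lra.
Qed.

Definition queue_prob (J : {set 'I_N}) (k : nat) (t : R) : R :=
  pr (fun w => (k <= present J t w)%N).

Lemma pr_present_eq J k t :
  pr (fun w => present J t w == k) = queue_prob J k t - queue_prob J k.+1 t.
Proof.
rewrite /queue_prob (pr_split (measurable_presentT J t k) (measurable_presentT J t k.+1)).
rewrite (_ : pr (fun w => (k <= present J t w)%N && (k < present J t w)%N) = queue_prob J k.+1 t).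
  rewrite [X in _ = X - _]addrC addrK; congr pr; apply/funext => w.
  by rewrite -leqNgt eqn_leq andbC.
congr pr; apply/funext => w; case: (ltnP k (present J t w)); rewrite ?andbF// andbT.
by move=> /ltnW ->.
Qed.

Lemma queue_prob0 J t : queue_prob J 0 t = 1.
Proof. exact: expect_cst. Qed.

Lemma queue_prob_gt (J : {set 'I_N}) k t : (#|J| < k)%N -> queue_prob J k t = 0.
Proof.
move=> Jk; rewrite /queue_prob (_ : (fun w => _) = (fun=> false)) ?pr_cst_false//.
apply/funext => w; apply/negbTE; rewrite -ltnNge.
by rewrite (leq_ltn_trans (present_le_card J t w)).
Qed.

Lemma queue_prob_ge0 J k t : 0 <= queue_prob J k t.
Proof. exact: pr_ge0. Qed.

Lemma queue_prob_le1 J k t : queue_prob J k t <= 1.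
Proof. by rewrite -(queue_prob0 J t); apply: pr_le_good => //; exact: measurable_presentT. Qed.

Lemma queue_prob_anti J k t : queue_prob J k.+1 t <= queue_prob J k t.
Proof. by apply: pr_le_good => [||w _]; [exact: measurable_presentT..|exact: ltnW]. Qed.

Lemma queue_prob_subset (J J' : {set 'I_N}) k t : J' \subset J ->
  queue_prob J' k t <= queue_prob J k t.
Proof.
move=> J'J; apply: pr_le_good => [||w gw]; [exact: measurable_presentT..|].
by move=> /leq_trans; apply; exact: present_subset.
Qed.

Lemma expect_dist_le_good (f g h : T -> R) : tame f -> tame g -> tame h ->
  (forall w, good w -> `|f w - g w| <= h w) -> `|expect f - expect g| <= expect h.
Proof.
move=> tf tg th fgh; rewrite -expectB// ler_norml -expectN//; apply/andP; split.
  apply: (@expect_le_as _ _ _ _ good) => [||||w /fgh].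
  - exact: measurable_good.
  - exact: pr_good.
  - exact: tameN.
  - exact: tameB.
  - by rewrite ler_norml => /andP[].
apply: (@expect_le_as _ _ _ _ good) => [||||w /fgh].
- exact: measurable_good.
- exact: pr_good.
- exact: tameB.
- exact: th.
- by rewrite ler_norml => /andP[].
Qed.

Lemma leaving_approx (J : {set 'I_N}) (s t : R) k : 0 <= s -> s < t -> (0 < k)%N ->
  `|pr (fun w => (present J t w < k <= pending J s t w)%N) -
    leak s t * (queue_prob J k s - queue_prob J k.+1 s)| <=
  leak s t ^+ 2 + leak s t * \sum_(i in J) pr (newcomer s t i).
Proof.
move=> s0 st k0; have st' := ltW st.
pose anynew w := [exists i, (i \in J) && newcomer s t i w].
have many : measurable_fun [set: T] anynew.
  apply: measurable_exists => i; case: (i \in J); last exact: measurable_cst.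
  exact: measurable_newcomerT.
have -> : leak s t ^+ 2 = \sum_b leak s t ^+ 2 * pr (fun w => snapshot J s t w == b).
  rewrite -mulr_sumr -[LHS]mulr1; congr (_ * _).
  rewrite -[LHS](expect_cst P 1) (expect_snapshot J s t (tame_cst _ _)).
  by apply: eq_bigr => b _; congr expect; apply/funext => w; rewrite mulr1.
have anyle : pr anynew <= \sum_(i in J) pr (newcomer s t i).
  rewrite -expect_sum; last by move=> i; apply: tame_bool; exact: measurable_newcomerT.
  apply: expect_le => [||w]; first exact: tame_bool.
    by apply: tame_sum => i; apply: tame_bool; exact: measurable_newcomerT.
  case: (boolP (anynew w)) => [/existsP[i /andP[iJ iw]]|_]; last by apply: sumr_ge0 => i _; exact: ler0n.
  by rewrite (bigD1 i)//= iw lerDl; apply: sumr_ge0 => j _; exact: ler0n.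
apply: (@le_trans _ _ (\sum_b leak s t ^+ 2 * pr (fun w => snapshot J s t w == b) +
   leak s t * pr anynew)); last by rewrite lerD2l ler_wpM2l// leak_ge0.
rewrite (pr_snapshot J s t many) mulr_sumr -big_split/=.
rewrite (pr_snapshot J s t (measurable_leavingT J s t k)) -pr_present_eq.
rewrite (pr_snapshot J s t (measurable_present_eqT J s k)) mulr_sumr -sumrB.
apply: le_trans (ler_norm_sum _ _ _) _; apply: ler_sum => b _.
have mb := measurable_snapshotT J s t b.
have [beq|bneq] := eqVneq b.1.1 b.1.2.
  apply: le_trans (leaving_snapshot_approx J s0 st' k0 beq) _.
  by rewrite lerDl mulr_ge0 ?leak_ge0 ?pr_ge0.
have -> : pr (fun w => (snapshot J s t w == b) && anynew w) = pr (fun w => snapshot J s t w == b).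
  congr pr; apply/funext => w; case: eqP => //= sb; apply/existsP.
  have [i] : exists i, b.1.1 i != b.1.2 i.
    apply/existsP; apply: contraNT bneq => /existsPn h; apply/eqP/ffunP => i.
    by have := h i; rewrite negbK => /eqP.
  rewrite -sb /= !ffunE /newcomer => hi; exists i.
  move: hi; case: (i \in J) => //=.
  case hs: (ahead M s w i); case ht: (ahead M t w i) => //=.
  by rewrite (ahead_mono st hs) in ht.
rewrite (le_trans (_ : _ <= leak s t * pr (fun w => snapshot J s t w == b)))//; last first.
  by rewrite lerDr mulr_ge0 ?exprn_ge0 ?leak_ge0 ?pr_ge0.
have h1 := leaving_snapshot_le J b st' k0.
have h2 : leak s t * pr (fun w => (snapshot J s t w == b) && (present J s w == k)) <=
    leak s t * pr (fun w => snapshot J s t w == b).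
  rewrite ler_wpM2l ?leak_ge0//; apply: pr_le_good => // [|w _ /andP[]//].
  by apply: measurable_and => //; exact: measurable_present_eqT.
have h3 : 0 <= leak s t * pr (fun w => (snapshot J s t w == b) && (present J s w == k)).
  by rewrite mulr_ge0 ?leak_ge0 ?pr_ge0.
have h4 := pr_ge0 P (fun w => (snapshot J s t w == b) && (present J t w < k <= pending J s t w)%N).
rewrite ler_norml; apply/andP; split.
  by rewrite lerNl opprB lerBlDr (le_trans h2)// lerDl.
by rewrite lerBlDr (le_trans h1)// lerDl.
Qed.

Lemma arriving_approx (J : {set 'I_N}) (s t : R) k : s < t -> (0 < k)%N ->
  `|pr (fun w => (present J s w < k <= pending J s t w)%N) -
    \sum_(i in J) pr (fun w => newcomer s t i w && (present (J :\ i) s w == k.-1))| <=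
  N%:R * \sum_(i in J) \sum_(j in J | j != i) pr (fun w => newcomer s t i w && newcomer s t j w).
Proof.
move=> st k0.
have tn i : tame (fun w => (newcomer s t i w)%:R : R).
  by apply: tame_bool; exact: measurable_newcomerT.
have tnp i : tame (fun w => (newcomer s t i w && (present (J :\ i) s w == k.-1))%:R : R).
  apply: tame_bool; apply: measurable_and; first exact: measurable_newcomerT.
  exact: measurable_present_eqT.
have tnn i j : tame (fun w => (newcomer s t i w && newcomer s t j w)%:R : R).
  by apply: tame_bool; apply: measurable_and; exact: measurable_newcomerT.
rewrite -expect_sum//; under [in leRHS]eq_bigr do rewrite -expect_sum//.
rewrite -expect_sum; last by move=> i; exact: tame_sum.
rewrite -expectZ; last by apply: tame_sum => i; exact: tame_sum.
apply: expect_dist_le_good => [||| w gw].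
- apply: tame_bool; apply: measurable_and; [exact: measurable_present_ltT|exact: measurable_pendingT].
- exact: tame_sum.
- by apply: tameM; [exact: tame_cst|apply: tame_sum => i; exact: tame_sum].
rewrite pendingE//.
have rhs0 : 0 <= N%:R * \sum_(i in J) \sum_(j in J | j != i) (newcomer s t i w && newcomer s t j w)%:R :> R.
  by rewrite mulr_ge0// sumr_ge0// => i _; rewrite sumr_ge0.
have [[i /andP[iJ iw]]|none] := pselect (exists i, (i \in J) && newcomer s t i w); last first.
  have no i : i \in J -> newcomer s t i w = false.
    by move=> iJ; apply/negP => iw; apply: none; exists i; rewrite iJ.
  rewrite [X in `|_ - X|]big1; last by move=> i iJ; rewrite no.
  rewrite (_ : (\sum_(i in J) newcomer s t i w)%N = 0%N); last by rewrite big1// => i iJ; rewrite no.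
  by rewrite addn0 ltnNge andNb subrr normr0.
have [[j /and3P[jJ ji jw]]|none] := pselect (exists j, [&& j \in J, j != i & newcomer s t j w]).
  apply: (@le_trans _ _ N%:R); last first.
    rewrite -[leLHS]mulr1 ler_wpM2l// (bigD1 i)//= (bigD1 j) ?jJ//=.
    rewrite iw jw/= -addrA lerDl addr_ge0// sumr_ge0// => l _; exact: sumr_ge0.
  have N1 : 1 <= N%:R :> R by rewrite ler1n (leq_ltn_trans _ (ltn_ord i)).
  have g0 : 0 <= \sum_(i in J) (newcomer s t i w && (present (J :\ i) s w == k.-1))%:R :> R.
    by apply: sumr_ge0.
  have gN : \sum_(i in J) (newcomer s t i w && (present (J :\ i) s w == k.-1))%:R <= N%:R :> R.
    apply: (@le_trans _ _ (\sum_(i in J) 1)); first by apply: ler_sum => l _; rewrite lern1 leq_b1.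
    by rewrite sumr_const ler_nat -[leqRHS]card_ord max_card.
  have f1 (b : bool) : (0 <= (b%:R : R)) && ((b%:R : R) <= 1) by case: b; rewrite /= ?lexx ?ler01.
  have /andP[f0 f1'] := f1 (present J s w < k <= present J s w + \sum_(i in J) newcomer s t i w)%N.
  by rewrite ler_norml; apply/andP; split; move: f0 f1' g0 gN N1; set a := _%:R; set b := \sum_(_ in _) _; lra.
have no j : j \in J -> j != i -> newcomer s t j w = false.
  by move=> jJ ji; apply/negP => jw; apply: none; exists j; rewrite jJ ji.
rewrite [X in `|_ - X|](bigD1 i)//= [X in _ - (_ + X)]big1 ?addr0; last first.
  by move=> j /andP[jJ ji]; rewrite no.
rewrite (bigD1 i)//= big1 ?addn0; last by move=> j /andP[jJ ji]; rewrite no.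
rewrite iw/= present_setD1; last by have /andP[] := iw.
rewrite (_ : (present J s w < k <= present J s w + 1)%N = (present J s w == k.-1)) ?subrr ?normr0//.
by rewrite addn1; case: k k0 {tnp} => //= k _; rewrite ltnS -eqn_leq.
Qed.

Definition null_arrival (t : R) := forall i, pr (fun w => arrival M i w == t) = 0.

Lemma pr_le_null (p p' n : T -> bool) :
  measurable_fun [set: T] p -> measurable_fun [set: T] p' -> measurable_fun [set: T] n ->
  (forall w, p w -> p' w || n w) -> pr n = 0 -> pr p <= pr p'.
Proof.
move=> mp mp' mn h n0; rewrite -[leRHS]addr0 -n0 -expectD; [|exact: tame_bool..].
apply: expect_le => [||w]; first exact: tame_bool.
  by apply: tameD; exact: tame_bool.
rewrite -natrD ler_nat; case pw: (p w) => //.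
by have := h w pw; case: (p' w); case: (n w).
Qed.

Lemma measurable_arrival_eq i t : measurable_fun [set: T] (fun w => arrival M i w == t).
Proof. by apply: measurable_fun_eqr; [exact: measurable_arrival|exact: measurable_cst]. Qed.

Lemma measurable_arrival_le i t : measurable_fun [set: T] (fun w => arrival M i w <= t).
Proof. by apply: measurable_fun_ler; [exact: measurable_arrival|exact: measurable_cst]. Qed.

Lemma measurable_arrival_gt i t : measurable_fun [set: T] (fun w => t < arrival M i w).
Proof. by apply: measurable_fun_ltr; [exact: measurable_cst|exact: measurable_arrival]. Qed.

Lemma pr_arrival_le i t : pr (fun w => arrival M i w <= t) = F t.
Proof.
rewrite prE; last exact: measurable_arrival_le.
have := arrival_law M i t; rewrite /cdf /distribution /pushforward => e.
rewrite (_ : [set w | _] = arrival M i @^-1` `]-oo, t]); first by rewrite e.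
by apply/seteqP; split => w /=; rewrite in_itv.
Qed.

Lemma pr_arrival_between i s t : s <= t -> pr (fun w => s < arrival M i w <= t) = F t - F s.
Proof.
move=> st; rewrite -(pr_arrival_le i t) -(pr_arrival_le i s) -expectB; last 2 first.
- exact/tame_bool/measurable_arrival_le.
- exact/tame_bool/measurable_arrival_le.
congr expect; apply/funext => w.
case: (leP (arrival M i w) s) => Xs /=; first by rewrite (le_trans Xs st) subrr.
by rewrite mulr0n subr0.
Qed.

Lemma measurable_arrival_between i s t : measurable_fun [set: T] (fun w => s < arrival M i w <= t).
Proof. by apply: measurable_and; [exact: measurable_arrival_gt|exact: measurable_arrival_le]. Qed.

Lemma pr_indep k (p : T -> bool) (B : set R) (b : R -> bool) : measurable B ->
  (forall x, B x <-> b x) ->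
  measurable_fun [set: others k] (p : others k -> bool) ->
  pr (fun w => b (primitives k w) && p w) = pr (fun w => b (primitives k w)) * pr p.
Proof.
move=> mB Bb mp.
have mpT : measurable_fun [set: T] p by exact: measurable_fun_bool_others mp.
have mset : measurable [set w : others k | p w].
  by have := mp measurableT [set true]; rewrite setTI; apply.
have mpreB : measurable (primitives k @^-1` B).
  by rewrite -[X in measurable X]setTI; exact: measurable_funP.
have bE : [set w | b (primitives k w)] = primitives k @^-1` B.
  by apply/seteqP; split => w /= /Bb.
have mb : measurable_fun [set: T] (fun w => b (primitives k w)).
  by apply: measurable_fun_bool; rewrite setTI; rewrite -bE in mpreB; exact: mpreB.
rewrite !prE//; last exact: measurable_and.
rewrite -fineM ?fin_num_measure//; [|by rewrite bE|exact: measurable_others mset].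
rewrite bE muleC -(indep_others (customers_indep M) mset mB).
congr (fine (P _)); apply/seteqP; split => w /=.
  by move=> /andP[/Bb].
by move=> [-> /Bb ->].
Qed.

Lemma pr_newcomer s t i (p : T -> bool) : s < t -> null_arrival s -> null_arrival t ->
  measurable_fun [set: others (inl (inl i))] (p : others (inl (inl i)) -> bool) ->
  pr (fun w => newcomer s t i w && p w) = (F t - F s) * pr p.
Proof.
move=> st ns nt mp.
have mpT : measurable_fun [set: T] p by exact: measurable_fun_bool_others mp.
rewrite -(pr_arrival_between i (ltW st)).
rewrite -(@pr_indep (inl (inl i)) p `]s, t]%classic (fun x => s < x <= t)) => [|//| |//]; last first.
  by move=> x /=; rewrite in_itv.
have mn : measurable_fun [set: T] (fun w => (arrival M i w == s) || (arrival M i w == t)).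
  by apply: measurable_or; exact: measurable_arrival_eq.
have n0 : pr (fun w => (arrival M i w == s) || (arrival M i w == t)) = 0.
  apply/le_anti/andP; split; last exact: pr_ge0.
  rewrite -(ns i); apply: (pr_le_null _ _ _ _ (nt i)).
  - exact: mn.
  - exact: measurable_arrival_eq.
  - exact: measurable_arrival_eq.
  - by [].
have m1 : measurable_fun [set: T] (fun w => newcomer s t i w && p w).
  by apply: measurable_and => //; exact: measurable_newcomerT.
have m2 : measurable_fun [set: T] (fun w => (s < arrival M i w <= t) && p w).
  by apply: measurable_and => //; exact: measurable_arrival_between.
apply/le_anti/andP; split; apply: (pr_le_null m1 m2 mn _ n0) || apply: (pr_le_null m2 m1 mn _ n0).
- move=> w /andP[/andP[it is_] ->]; rewrite andbT.
  have := ahead_le it; have := not_ahead_ge is_.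
  rewrite le_eqVlt eq_sym => /predU1P[->|->->]; rewrite ?eqxx ?orbT//.
- move=> w /andP[/andP[sX Xt] ->]; rewrite andbT /newcomer /ahead.
  move: Xt; rewrite le_eqVlt => /predU1P[->|Xt]; first by rewrite eqxx !orbT.
  by rewrite Xt/= negb_or -leNgt (ltW sX)/= gt_eqF.
Qed.

Lemma pr_newcomerT s t i : s < t -> null_arrival s -> null_arrival t ->
  pr (newcomer s t i) = F t - F s.
Proof.
move=> st ns nt; rewrite -[RHS]mulr1 -[X in _ = _ * X](expect_cst P 1).
rewrite -[X in _ * X]/(pr (fun=> true)) -(@pr_newcomer s t i (fun=> true) st ns nt); last exact: measurable_cst.
by congr pr; apply/funext => w; rewrite andbT.
Qed.

Lemma pr_newcomer2 s t i j : j != i -> s < t -> null_arrival s -> null_arrival t ->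
  pr (fun w => newcomer s t i w && newcomer s t j w) = (F t - F s) ^+ 2.
Proof.
move=> ji st ns nt; rewrite pr_newcomer// ?pr_newcomerT//.
have nk k : k != inl (inl i) -> measurable_fun [set: others (inl (inl i))]
    (primitives k : others (inl (inl i)) -> R) by exact: measurable_fun_others.
apply: (@measurable_newcomer _ (others (inl (inl i))) id [set~ i]%SET) => [l|o|].
- rewrite !inE => li; exact: (nk (inl (inl l))).
- exact: (nk (inr o)).
- by rewrite !inE.
Qed.

Lemma measurable_present_setD1 J i t k :
  measurable_fun [set: others (inl (inl i))]
    ((fun w => present (J :\ i) t w == k) : others (inl (inl i)) -> bool).
Proof.
have nk l : l != inl (inl i) -> measurable_fun [set: others (inl (inl i))]
    (primitives l : others (inl (inl i)) -> R) by exact: measurable_fun_others.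
have mge m : measurable_fun [set: others (inl (inl i))]
    ((fun w => (m <= present (J :\ i) t w)%N) : others (inl (inl i)) -> bool).
  apply: (@measurable_present _ (others (inl (inl i))) id (J :\ i)) => [l|o|l _].
  - rewrite !inE => /andP[li _]; exact: (nk (inl (inl l))).
  - exact: (nk (inr o)).
  - exact: (nk (inl (inr l))).
rewrite [X in measurable_fun _ X](_ : _ = fun w : others (inl (inl i)) =>
    (k <= present (J :\ i) t w)%N && ~~ (k < present (J :\ i) t w)%N).
  by apply: measurable_and; [exact: mge|apply: measurable_neg; exact: mge].
by apply/funext => w; rewrite -leqNgt eqn_leq andbC.
Qed.

Lemma queue_prob_diff (J : {set 'I_N}) (s t : R) k : s < t ->
  queue_prob J k t - queue_prob J k s =
  pr (fun w => (present J s w < k <= pending J s t w)%N) -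
  pr (fun w => (present J t w < k <= pending J s t w)%N).
Proof.
move=> st.
have pendE u : (forall w, good w -> (present J u w <= pending J s t w)%N) ->
    pr (fun w => (k <= pending J s t w)%N) = queue_prob J k u +
    pr (fun w => (present J u w < k <= pending J s t w)%N).
  move=> up; rewrite (pr_split (measurable_pendingT J s t k) (measurable_presentT J u k)).
  congr (_ + _).
    apply: pr_eq_good => [||w gw]; last first.
    - by apply/andP/idP => [[]//|kp]; split=> //; exact: leq_trans kp (up w gw).
    - exact: measurable_presentT.
    - by apply: measurable_and; [exact: measurable_pendingT|exact: measurable_presentT].
  by congr pr; apply/funext => w; rewrite -ltnNge andbC.
have e1 := pendE t (fun w _ => present_le_pending J w (ltW st)).
have e2 : pr (fun w => (k <= pending J s t w)%N) = queue_prob J k s +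
    pr (fun w => (present J s w < k <= pending J s t w)%N).
  by apply: pendE => w gw; rewrite pendingE// leq_addr.
by move: e1; rewrite e2; lra.
Qed.

Lemma queue_prob_step (J : {set 'I_N}) (s t : R) k :
  0 <= s -> s < t -> F s <= F t -> null_arrival s -> null_arrival t -> (0 < k)%N ->
  `|queue_prob J k t - queue_prob J k s
     + leak s t * (queue_prob J k s - queue_prob J k.+1 s)
     - (F t - F s) * \sum_(i in J) (queue_prob (J :\ i) k.-1 s - queue_prob (J :\ i) k s)| <=
  leak s t ^+ 2 + N%:R * (leak s t * (F t - F s)) + N%:R ^+ 3 * (F t - F s) ^+ 2.
Proof.
move=> s0 st Fst ns nt k0; set D := F t - F s.
have D0 : 0 <= D by rewrite subr_ge0.
have cardJ : #|J|%:R <= N%:R :> R by rewrite ler_nat -[leqRHS]card_ord max_card.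
have L0 : 0 <= leak s t by rewrite leak_ge0// ltW.
have lv := leaving_approx J s0 st k0.
have ar := arriving_approx J st k0.
rewrite queue_prob_diff//.
have sumE : \sum_(i in J) pr (fun w => newcomer s t i w && (present (J :\ i) s w == k.-1)) =
    D * \sum_(i in J) (queue_prob (J :\ i) k.-1 s - queue_prob (J :\ i) k s).
  rewrite mulr_sumr; apply: eq_bigr => i iJ.
  rewrite pr_newcomer//; last exact: measurable_present_setD1.
  by rewrite pr_present_eq prednK.
have newE : \sum_(i in J) pr (newcomer s t i) <= N%:R * D.
  rewrite (eq_bigr (fun=> D)); last by move=> i _; rewrite pr_newcomerT.
  by rewrite sumr_const -[leLHS]mulr_natl ler_wpM2r.
have new2E : N%:R * \sum_(i in J) \sum_(j in J | j != i) pr (fun w => newcomer s t i w && newcomer s t j w) <=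
    N%:R ^+ 3 * D ^+ 2.
  rewrite exprS -mulrA ler_wpM2l//.
  apply: (@le_trans _ _ (\sum_(i in J) N%:R * D ^+ 2)).
    apply: ler_sum => i iJ; apply: (@le_trans _ _ (\sum_(j in J) D ^+ 2)).
      rewrite [leRHS](bigID (fun j => j != i))/= ler_wpDr ?sumr_ge0// => [j _|].
        by rewrite exprn_ge0.
      by apply: ler_sum => j /andP[_ ji]; rewrite pr_newcomer2.
    by rewrite sumr_const -[leLHS]mulr_natl ler_wpM2r ?exprn_ge0.
  by rewrite sumr_const -[leLHS]mulr_natl (expr2 (N%:R : R)) -mulrA ler_wpM2r ?mulr_ge0 ?exprn_ge0.
rewrite sumE in ar.
have lv' : leak s t * \sum_(i in J) pr (newcomer s t i) <= N%:R * (leak s t * D).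
  by rewrite mulrCA ler_wpM2l.
move: lv ar; rewrite !ler_norml => /andP[l1 l2] /andP[a1 a2].
move: l1 l2 a1 a2 lv' new2E.
set x1 := pr _; set x2 := leak s t * (_ - _); set x3 := leak s t * \sum_(_ in _) _.
set x4 := pr _; set x5 := D * _; set x6 := N%:R * \sum_(_ in _) _.
set x7 := N%:R * (_ * _); set x8 := _ ^+ 3 * _; set x9 := leak s t ^+ 2.
by move=> *; apply/andP; split; lra.
Qed.

Definition mean_present (t : R) : R := expect (fun w => (num_present M t w)%:R).

Definition mean_arrived (t : R) : R := expect (fun w => (num_arrived M t w)%:R).

Lemma sum_ltn_minn n m : (\sum_(k < n) (k < m) = minn n m)%N.
Proof.
elim: n => [|n IH]; first by rewrite big_ord0 min0n.
by rewrite big_ord_recr/= IH; case: (ltnP n m) => h; rewrite /minn; case: ifP; lia.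
Qed.

Lemma sum_ltn_ge n m l : (l <= m)%N -> (m <= n)%N ->
  (\sum_(k < n) (l < k.+1 <= m) = m - l)%N.
Proof.
move=> lm mn; rewrite -[in RHS](minn_idPr mn) -[in RHS](minn_idPr (leq_trans lm mn)).
rewrite -!sum_ltn_minn -sumnB; last first.
  by move=> k _; case: (ltnP k l) => // kl; rewrite (leq_trans kl lm).
apply: eq_bigr => k _; rewrite ltnS; case: (leqP l k) => lk; case: (ltnP k m) => km //=.
Qed.

Lemma present_le_N J t w : (present J t w <= N)%N.
Proof. by rewrite (leq_trans (present_le_card J t w))// -[leqRHS]card_ord max_card. Qed.

Lemma mean_presentE t : mean_present t = \sum_(k < N) queue_prob everyone k.+1 t.
Proof.
rewrite /queue_prob /pr -expect_sum; last first.
  by move=> k; apply: tame_bool; exact: measurable_presentT.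
congr expect; apply/funext => w; rewrite num_presentE -natr_sum sum_ltn_minn.
by rewrite (minn_idPr (present_le_N _ _ _)).
Qed.

Lemma mean_present_diff s t : s < t -> mean_present t - mean_present s =
  \sum_i pr (newcomer s t i) -
  \sum_(k < N) pr (fun w => (present everyone t w < k.+1 <= pending everyone s t w)%N).
Proof.
move=> st; rewrite !mean_presentE -sumrB.
under eq_bigr do rewrite queue_prob_diff//.
rewrite sumrB; congr (_ - _).
rewrite -!expect_sum; last 2 first.
- by move=> i; apply: tame_bool; exact: measurable_newcomerT.
- move=> k; apply: tame_bool; apply: measurable_and.
    exact: measurable_present_ltT.
  exact: measurable_pendingT.
have tl : tame (fun w => \sum_(k < N) (present everyone s w < k.+1 <= pending everyone s t w)%N%:R : R).
  apply: tame_sum => k; apply: tame_bool; apply: measurable_and.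
    exact: measurable_present_ltT.
  exact: measurable_pendingT.
have tr : tame (fun w => \sum_i (newcomer s t i w)%:R : R).
  by apply: tame_sum => i; apply: tame_bool; exact: measurable_newcomerT.
have eq w : good w -> \sum_(k < N) (present everyone s w < k.+1 <= pending everyone s t w)%N%:R =
    \sum_i (newcomer s t i w)%:R :> R.
  move=> gw; rewrite -!natr_sum sum_ltn_ge.
  - rewrite pendingE// addKn; congr (_%:R); apply: eq_bigl => i; by rewrite inE.
  - by rewrite pendingE// leq_addr.
  - rewrite (leq_trans (pending_le_size _ _ _ _))// (leq_trans (size_queue_le _ _ _))//.
    by rewrite -[leqRHS]card_ord max_card.
apply/le_anti/andP; split; apply: (@expect_le_as _ _ _ _ good) => //.
- exact: measurable_good.
- exact: pr_good.
- by move=> w /eq ->.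
- exact: measurable_good.
- exact: pr_good.
- by move=> w /eq ->.
Qed.

Lemma leak_le (s t : R) : leak s t <= mu * (t - s).
Proof. by have := @expR_ge1Dx R (- mu * (t - s)); lra. Qed.

Lemma mean_present_ge (s t : R) : s < t ->
  mean_present s + \sum_i pr (newcomer s t i) - N%:R * (mu * (t - s)) <= mean_present t.
Proof.
move=> st; have := mean_present_diff st.
have : \sum_(k < N) pr (fun w => (present everyone t w < k.+1 <= pending everyone s t w)%N) <=
    N%:R * (mu * (t - s)).
  rewrite -[in leRHS](card_ord N) mulr_natl -sumr_const; apply: ler_sum => k _.
  by apply: le_trans (leak_le _ _); apply: leaving_le => //; exact: ltW.
by move=> h1 h2; lra.
Qed.

Lemma ahead_prob_sum t : mean_arrived t = \sum_i pr (fun w => ahead M t w i).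
Proof.
rewrite -expect_sum; last first.
  move=> i; apply: tame_bool.
  apply: (@measurable_ahead _ T id everyone) => [j _|o|]; last by rewrite inE.
  - exact: measurable_arrival.
  - exact: measurable_mark.
congr expect; apply/funext => w; rewrite -natr_sum; congr (_%:R).
rewrite /num_arrived /arrivals size_sort size_filter -sum1_count big_enum_cond/=.
by rewrite big_mkcond/=; apply: eq_bigr => i _; case: (ahead M t w i).
Qed.

Lemma measurable_aheadT t i : measurable_fun [set: T] (fun w => ahead M t w i).
Proof.
apply: (@measurable_ahead _ T id everyone) => [j _|o|]; last by rewrite inE.
- exact: measurable_arrival.
- exact: measurable_mark.
Qed.

Lemma mean_arrived_diff s t : s < t ->
  mean_arrived t - mean_arrived s = \sum_i pr (newcomer s t i).
Proof.
move=> st; rewrite !ahead_prob_sum -sumrB; apply: eq_bigr => i _.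
rewrite (pr_split (measurable_aheadT t i) (measurable_aheadT s i)).
rewrite (_ : pr (fun w => ahead M t w i && ahead M s w i) = pr (fun w => ahead M s w i)).
  by rewrite [X in X - _]addrC addrK.
congr pr; apply/funext => w; case h: (ahead M s w i); rewrite ?andbF//.
by rewrite (ahead_mono st h).
Qed.

Lemma ahead_prob t i : null_arrival t -> pr (fun w => ahead M t w i) = F t.
Proof.
move=> nt; rewrite -(pr_arrival_le i t); apply/le_anti/andP; split.
  apply: (pr_le_null _ _ _ _ (nt i)).
  - exact: measurable_aheadT.
  - exact: measurable_arrival_le.
  - exact: measurable_arrival_eq.
  - by move=> w /ahead_le ->.
apply: (pr_le_null _ _ _ _ (nt i)).
- exact: measurable_arrival_le.
- exact: measurable_aheadT.
- exact: measurable_arrival_eq.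
- by move=> w; rewrite /ahead le_eqVlt => /orP[->|->//]; rewrite orbT.
Qed.

Lemma mean_arrivedE t : null_arrival t -> mean_arrived t = N%:R * F t.
Proof.
move=> nt; rewrite ahead_prob_sum (eq_bigr (fun=> F t)); last by move=> i _; rewrite ahead_prob.
by rewrite sumr_const card_ord mulr_natl.
Qed.

Lemma costE alpha gamma t : cost M alpha gamma t =
  - alpha * t * (t < 0)%R%:R + alpha / mu * mean_present t + gamma * mean_arrived t.
Proof. by rewrite /cost !expectation_expect. Qed.

Lemma prob_emptyE t : 1 - prob_empty M t = queue_prob everyone 1 t.
Proof.
rewrite /prob_empty /queue_prob.
have -> : fine (P [set w | num_present M t w = 0%N]) = pr (fun w => present everyone t w == 0%N).
  rewrite prE; last exact: measurable_present_eqT.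
  congr (fine (P _)); apply/seteqP; split => w /=; rewrite num_presentE; first by move=> ->.
  by move/eqP.
by rewrite pr_present_eq queue_prob0 opprB addrC subrK.
Qed.

Lemma arrival_cdf_ge0 (i : 'I_N) t : 0 <= F t.
Proof. by rewrite -(pr_arrival_le i); exact: pr_ge0. Qed.

Lemma arrival_cdf_le1 (i : 'I_N) t : F t <= 1.
Proof.
rewrite -(pr_arrival_le i t) -[leRHS](expect_cst P 1); apply: expect_le => [||w].
- exact/tame_bool/measurable_arrival_le.
- exact: tame_cst.
- by rewrite lern1 leq_b1.
Qed.

Lemma arrival_cdf_mono (i : 'I_N) s t : s <= t -> F s <= F t.
Proof. by move=> st; rewrite -subr_ge0 -(pr_arrival_between i st); exact: pr_ge0. Qed.

Lemma arrival_cdf_cvg1 (i : 'I_N) : F t @[t --> +oo] --> (1 : R).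
Proof.
have h := @cvg_cdfy1 _ _ _ P (arrival M i).
rewrite (_ : F = fine \o cdf (arrival M i)); last by apply/funext => t /=; rewrite (arrival_law M).
exact: (@fine_cvg _ _ _ _ _ 1%R h).
Qed.

Lemma arrival_cdf_cvg0 (i : 'I_N) : F t @[t --> -oo] --> (0 : R).
Proof.
have h := @cvg_cdfNy0 _ _ _ P (arrival M i).
rewrite (_ : F = fine \o cdf (arrival M i)); last by apply/funext => t /=; rewrite (arrival_law M).
exact: (@fine_cvg _ _ _ _ _ 0%R h).
Qed.

Lemma arrival_cdf_right_cont (i : 'I_N) t : F x @[x --> t^'+] --> F t.
Proof.
have h := @cdf_right_continuous _ _ _ P (arrival M i) t.
rewrite (_ : F = fine \o cdf (arrival M i)); last by apply/funext => u /=; rewrite (arrival_law M).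
apply: fine_cvg; rewrite /= (arrival_law M)/=.
by rewrite (arrival_law M) in h.
Qed.

Lemma pr_indep_service (p : T -> bool) i x :
  measurable_fun [set: others (inl (inr i))] (p : others (inl (inr i)) -> bool) ->
  pr (fun w => (x < service M i w) && p w) = tail x * pr p.
Proof.
move=> mp; rewrite -(service_tail i x).
apply: (@pr_indep (inl (inr i)) p `]x, +oo[%classic (fun y => x < y)) => //.
by move=> y /=; rewrite in_itv/= andbT.
Qed.

Lemma measurable_ahead_others t i j :
  measurable_fun [set: others (inl (inr j))] ((fun w => ahead M t w i) : others (inl (inr j)) -> bool).
Proof.
have nk k : k != inl (inr j) -> measurable_fun [set: others (inl (inr j))]
    (primitives k : others (inl (inr j)) -> R) by exact: measurable_fun_others.
apply: (@measurable_ahead _ (others (inl (inr j))) id everyone) => [l _|o|].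
- exact: (nk (inl (inl l))).
- exact: (nk (inr o)).
- by rewrite inE.
Qed.

Lemma queue_prob1_gt0 (i : 'I_N) t : null_arrival t -> 0 < F t ->
  0 < queue_prob everyone 1 t.
Proof.
move=> nt Ft.
apply: (@lt_le_trans _ _ (pr (fun w => (t < service M i w) && ahead M t w i))).
  rewrite pr_indep_service; last exact: measurable_ahead_others.
  by rewrite ahead_prob// mulr_gt0// expR_gt0.
apply: pr_le_good => [||w gw /andP[h1 h2]].
- by apply: measurable_and; [apply: measurable_fun_ltr; [exact: measurable_cst|exact: measurable_service]|exact: measurable_aheadT].
- exact: measurable_presentT.
- by apply: (present_gt0 (i := i)) => //; rewrite inE.
Qed.

Lemma mean_present_le t : mean_present t <= N%:R * queue_prob everyone 1 t.
Proof.
set q := queue_prob _ 1 t; have -> : N%:R * q = \sum_(k < N) q by rewrite sumr_const card_ord mulr_natl.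
rewrite mean_presentE; apply: ler_sum => k _; rewrite /q.
elim: (nat_of_ord k) => // n; apply: le_trans; exact: queue_prob_anti.
Qed.

Lemma queue_prob1_le_mean (i : 'I_N) t : queue_prob everyone 1 t <= mean_present t.
Proof.
rewrite mean_presentE.
have N0 : (0 < N)%N by rewrite (leq_ltn_trans _ (ltn_ord i)).
rewrite (bigD1 (Ordinal N0))//= lerDl sumr_ge0// => k _; exact: queue_prob_ge0.
Qed.

Lemma queue_prob1_cvg0 : queue_prob everyone 1 t @[t --> +oo] --> (0 : R).
Proof.
pose B w : R := \sum_i (`|arrival M i w| + service M i w).
have mB : measurable_fun [set: T] B.
  apply: measurable_sum => i; apply: measurable_funD; last exact: measurable_service.
  by apply: measurableT_comp => //; exact: measurable_arrival.
pose Y : {RV P >-> R} := mfun_Sub (mem_set mB).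
have h := @cvg_ccdfy0 _ _ _ P Y.
have h0 : (fine \o ccdf Y) t @[t --> +oo] --> (0 : R) by exact: (@fine_cvg _ _ _ _ _ 0%R h).
apply: (squeeze_cvgr _ (cvg_cst 0) h0); apply: nearW => t.
rewrite queue_prob_ge0/=.
have -> : fine (ccdf Y t) = pr (fun w => t < B w).
  rewrite prE; last by apply: measurable_fun_ltr => //; exact: measurable_cst.
  rewrite /ccdf /distribution /pushforward; congr (fine (P _)).
  by apply/seteqP; split => w /=; rewrite in_itv/= andbT.
apply: pr_le_good => [||w gw h1].
- exact: measurable_presentT.
- by apply: measurable_fun_ltr => //; exact: measurable_cst.
have sz : (0 < size (queue everyone t w))%N.
  by apply: leq_trans h1 _; exact: pending_le_size.
have := h1; rewrite -[present _ _ _]/(pending _ t t w) leq_pending//.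
rewrite subn1 prednK// take_size => /lt_le_trans; apply.
apply: le_trans (foldl_serve_le _ (forallP gw) _ (lexx 0)) _; rewrite add0r /B.
rewrite (big_uniq _ (uniq_queue _ t w))/= [leRHS](bigID (mem (queue everyone t w)))/=.
rewrite lerDl sumr_ge0// => i _; rewrite addr_ge0// ltW//; exact: (forallP gw).
Qed.

Lemma queue_prob_telescope t :
  \sum_(k < N) (queue_prob everyone k.+1 t - queue_prob everyone k.+2 t) =
  queue_prob everyone 1 t.
Proof.
rewrite -(big_mkord xpredT (fun k =>
  queue_prob everyone k.+1 t - queue_prob everyone k.+2 t)).
rewrite (@telescope_sumr_eq _ _ _ (fun k => - queue_prob everyone k.+1 t))//; last first.
  by move=> k _; rewrite opprK addrC.
by rewrite queue_prob_gt ?cardsT ?card_ord// oppr0 sub0r opprK.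
Qed.

Lemma mark_prob o (B : set R) (b : R -> bool) : measurable B -> B `<=` `[0, 1] ->
  (forall x, B x <-> b x) -> pr (fun w => b (mark M o w)) = fine (lebesgue_measure B).
Proof.
move=> mB B01 Bb.
have mpre : measurable (mark M o @^-1` B).
  by rewrite -[X in measurable X]setTI; exact: measurable_funP.
have bE : [set w | b (mark M o w)] = mark M o @^-1` B.
  by apply/seteqP; split => w /= /Bb.
rewrite prE; last by apply: measurable_fun_bool; rewrite setTI; rewrite -bE in mpre; exact: mpre.
rewrite bE; have := @mark_law _ _ _ _ _ _ _ M o B mB.
rewrite /distribution /pushforward => ->; congr fine.
rewrite /uniform_prob (eq_integral (fun=> 1%E)); first by rewrite integral_cst// mul1e.
move=> x; rewrite inE => /B01; rewrite /= in_itv/= /uniform_pdf => ->.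
by rewrite subr0 invr1.
Qed.

Lemma pr_mark_lt_gt0 i : 0 < pr (fun w => mark M (Some i) w < mark M None w).
Proof.
have m1 x : measurable_fun [set: R] (fun y : R => x < y).
  by apply: measurable_fun_ltr => //; exact: measurable_cst.
have mM o := @measurable_mark o.
have mlow : measurable_fun [set: T] (fun w => 0 <= mark M (Some i) w < 2^-1).
  apply: measurable_and; first by apply: measurable_fun_ler => //; exact: measurable_cst.
  by apply: measurable_fun_ltr => //; exact: measurable_cst.
have mhigh : measurable_fun [set: T] (fun w => 2^-1 < mark M None w <= 1).
  apply: measurable_and; first by apply: measurable_fun_ltr => //; exact: measurable_cst.
  by apply: measurable_fun_ler => //; exact: measurable_cst.
apply: (@lt_le_trans _ _ (pr (fun w => (0 <= mark M (Some i) w < 2^-1) && (2^-1 < mark M None w <= 1)))); last first.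
  apply: pr_le_good => [||w _ /andP[/andP[_ h1] /andP[h2 _]]].
  - exact: measurable_and.
  - exact: measurable_fun_ltr.
  - exact: lt_trans h1 h2.
have mhigh' : measurable_fun [set: others (inr (Some i))]
    ((fun w => 2^-1 < mark M None w <= 1) : others (inr (Some i)) -> bool).
  have mN := @measurable_fun_others _ _ _ _ _ primitives (inr None) (inr (Some i)) isT.
  apply: measurable_and; first by apply: measurable_fun_ltr => //; exact: measurable_cst.
  by apply: measurable_fun_ler => //; exact: measurable_cst.
have in_low (x : R) : `[0, 2^-1[%classic x <-> 0 <= x < 2^-1 by rewrite /= in_itv.
rewrite [ltRHS](@pr_indep (inr (Some i)) _ _ (fun x => 0 <= x < 2^-1)
  (measurable_itv _) in_low mhigh') /=.
have -> : pr (fun w => 0 <= mark M (Some i) w < 2^-1) = fine (lebesgue_measure `[(0 : R), 2^-1[%classic).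
  apply: (@mark_prob (Some i) _ (fun x => 0 <= x < 2^-1)) => // x; rewrite /= !in_itv/=.
  by move=> /andP[-> /ltW h]; rewrite (le_trans h)// invf_le1// ler1n.
have -> : pr (fun w => 2^-1 < mark M None w <= 1) = fine (lebesgue_measure `](2^-1 : R), 1]%classic).
  apply: (@mark_prob None _ (fun x => 2^-1 < x <= 1)) => // x; rewrite /= !in_itv/=.
  by move=> /andP[h ->]; rewrite andbT (le_trans _ (ltW h))// invr_ge0.
rewrite !lebesgue_measure_itv/= !lte_fin.
have h0 : (0 : R) < 2^-1 by rewrite invr_gt0.
have h1 : (2^-1 : R) < 1 by rewrite invf_lt1// ltr1n.
by rewrite h0 h1 -!EFinB/= mulr_gt0// subr_gt0.
Qed.

Lemma pr_tie_le i s t : s < t ->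
  pr (fun w => arrival M i w == t) * pr (fun w => mark M (Some i) w < mark M None w) <=
  pr (newcomer s t i).
Proof.
move=> st; have mM o := @measurable_mark o.
rewrite -(@pr_indep (inl (inl i)) (fun w => mark M (Some i) w < mark M None w)
  [set t] (fun x => x == t)) => [|//|x|]; last 2 first.
- by split => [->|/eqP].
- apply: measurable_fun_ltr.
    exact: (@measurable_fun_others _ _ _ _ _ primitives (inr (Some i))).
  exact: (@measurable_fun_others _ _ _ _ _ primitives (inr None)).
apply: pr_le_good => [||w _ /andP[/eqP /= Xt h]].
- by apply: measurable_and; [exact: measurable_arrival_eq|exact: measurable_fun_ltr].
- exact: measurable_newcomerT.
by rewrite /newcomer /ahead Xt eqxx h orbT/= negb_or -leNgt (ltW st) gt_eqF.
Qed.

Lemma support_between (i : 'I_N) y z : y <= z -> F y < F z ->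
  exists2 b, cdf_support F b & y <= b <= z.
Proof.
move=> yz Fyz; pose E := [set u | u <= z /\ F u <= F y].
have Ey : E y by split.
have supE : has_sup E by split; [exists y|exists z => u []].
have Fm := @arrival_cdf_mono i.
exists (sup E); last first.
  by rewrite sup_upper_bound//=; apply: ge_sup; [exists y|move=> u []].
move=> e e0; apply: (@le_lt_trans _ _ (F y)).
  have [u [_ Fu] bu] := sup_adherent e0 supE.
  by apply: le_trans Fu; apply: Fm; exact: ltW.
have [bz|zb] := leP (sup E + e) z; last by rewrite (lt_le_trans Fyz)// Fm// ltW.
rewrite ltNge; apply/negP => h.
have /= := @sup_upper_bound _ _ supE (sup E + e) (conj bz h).
by rewrite gerDl leNgt e0.
Qed.

Lemma arrival_cdf_flat_right (i : 'I_N) a t c : a < t -> (forall u, a < u -> u <= t -> F u = c) -> F a = c.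
Proof.
move=> at' h; apply: (@cvg_unique _ _ (F x @[x --> a^'+])) => //.
  exact: (arrival_cdf_right_cont i).
apply: cvg_near_cst; near=> x; apply: h => //.
by near: x; exact: nbhs_right_le.
Unshelve. all: by end_near. Qed.

Lemma mean_present_flat_lt (i : 'I_N) (a t : R) : 0 <= a -> a < t ->
  (forall u, a <= u -> u <= t -> null_arrival u) -> F a = F t -> 0 < F a ->
  mean_present t < mean_present a.
Proof.
move=> a0 at' nul Fat Fa0.
have na : null_arrival a by apply: nul => //; exact: ltW.
set q := queue_prob everyone 1 a.
have q0 : 0 < q := queue_prob1_gt0 i na Fa0.
have N0 : 0 < N%:R :> R by rewrite ltr0n (leq_ltn_trans _ (ltn_ord i)).
pose e : R := Num.min (t - a) (q / (2 * N%:R * mu)).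
have e0 : 0 < e by rewrite lt_min subr_gt0 at'/= divr_gt0// !mulr_gt0.
have eta : a + e <= t by rewrite -lerBrDl ge_min lexx.
have ae : a < a + e by rewrite ltrDl.
have Fm := @arrival_cdf_mono i.
have Fae : F (a + e) = F a.
  by apply/le_anti; rewrite (Fm _ _ (ltW ae)) andbT Fat Fm.
have newc s u : a <= s -> s < u -> u <= t -> \sum_i pr (newcomer s u i) = 0.
  move=> as_ su ut; rewrite big1// => j _; rewrite pr_newcomerT//.
  - apply/eqP; rewrite subr_eq0 eq_le (Fm _ _ (ltW su)) andbT.
    by rewrite (le_trans (Fm _ _ ut))// -Fat Fm.
  - by apply: nul => //; exact: le_trans (ltW su) ut.
  - by apply: nul => //; exact: le_trans as_ (ltW su).
set L : R := leak a (a + e).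
have L0 : 0 < L.
  rewrite subr_gt0 -expR0 ltr_expR mulNr oppr_lt0 mulr_gt0// addrC addKr//.
have Lq : N%:R * L < q.
  have : L <= mu * e by rewrite (le_trans (leak_le _ _))// (addrC a) addrK.
  rewrite -(ler_pM2l N0) => /le_lt_trans; apply.
  have : e <= q / (2 * N%:R * mu) by rewrite ge_min lexx orbT.
  rewrite ler_pdivlMr ?mulr_gt0// => h.
  by apply: (@le_lt_trans _ _ (q / 2)); lra.
apply: (@le_lt_trans _ _ (mean_present (a + e))).
  move: eta; rewrite le_eqVlt => /predU1P[->//|et].
  have := mean_present_diff et; rewrite newc//; last exact: ltW.
  move/eqP; rewrite sub0r subr_eq => /eqP ->; rewrite addrC gerDl oppr_le0.
  by apply: sumr_ge0 => k _; exact: pr_ge0.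
have := mean_present_diff ae; rewrite newc// => h.
have : L * q - N%:R * L ^+ 2 <= \sum_(k < N)
    pr (fun w => (present everyone (a + e) w < k.+1 <= pending everyone a (a + e) w)%N).
  have -> : L * q - N%:R * L ^+ 2 = \sum_(k < N)
      (L * (queue_prob everyone k.+1 a - queue_prob everyone k.+2 a) - L ^+ 2).
    rewrite sumrB sumr_const card_ord mulr_natl -mulr_sumr; congr (_ * _ - _).
    by rewrite queue_prob_telescope.
  apply: ler_sum => k _.
  have := leaving_approx everyone a0 ae (ltn0Sn k).
  rewrite (eq_bigl xpredT) => [|j]; last by rewrite inE.
  rewrite newc// mulr0 addr0 -/L ler_norml => /andP[+ _].
  by set x := pr _; set y := L * _; lra.
have : 0 < L * (q - N%:R * L) by rewrite mulr_gt0// subr_gt0.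
move: h; set x := \sum_(_ < _) _ => h1 h2 h3.
have -> : mean_present (a + e) = mean_present a - x by lra.
have : L * q - N%:R * L ^+ 2 = L * (q - N%:R * L) by ring.
by lra.
Qed.

Section Equilibrium.
Variables (early : bool) (alpha gamma ce : R).
Hypothesis N_gt0 : (0 < N)%N.
Hypothesis alpha_gt0 : 0 < alpha.
Hypothesis gamma_gt0 : 0 < gamma.
Hypothesis support_admissible : cdf_support F `<=` admissible early.
Hypothesis support_cost : forall t, cdf_support F t -> cost M alpha gamma t = ce.
Hypothesis admissible_cost : forall t, admissible early t -> ce <= cost M alpha gamma t.
Hypothesis F0_lt1 : ~~ early -> F 0 < 1.

Let i0 : 'I_N := Ordinal N_gt0.

Let Fm := @arrival_cdf_mono i0.

(* An atom is beaten by arriving slightly earlier: this jumps the queue of the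
   tied customers while at most [N mu e] of them are served in the meantime. *)
Lemma null_arrival_admissible b : early || (0 < b) -> null_arrival b.
Proof.
move=> badm i; apply/le_anti; rewrite pr_ge0 andbT leNgt; apply/negP => atom.
have Xb e : 0 < e -> pr (fun w => arrival M i w == b) <= F b - F (b - e).
  move=> e0; have eb : b - e < b by rewrite gtrBl.
  rewrite -(pr_arrival_between i (ltW eb)).
  apply: pr_le_good => [||w _ /eqP ->]; last by rewrite eb lexx.
    exact: measurable_arrival_eq.
  exact: measurable_arrival_between.
have suppb : cdf_support F b.
  move=> e e0; have h1 := Xb e e0.
  have h2 : F b <= F (b + e) by rewrite Fm// lerDl ltW.
  by rewrite -subr_gt0 (lt_le_trans atom)// (le_trans h1)// lerB.
pose c := pr (fun w => arrival M i w == b) * pr (fun w => mark M (Some i) w < mark M None w).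
have c0 : 0 < c by rewrite mulr_gt0// pr_mark_lt_gt0.
pose K : R := alpha * N%:R + alpha.
have K0 : 0 < K by rewrite ltr_wpDl// mulr_ge0// ltW.
pose e : R := Num.min (if early then 1 else b) (gamma * c / (2 * K)).
have e0 : 0 < e.
  rewrite lt_min; apply/andP; split; last by rewrite divr_gt0 ?(mulr_gt0 gamma_gt0 c0) ?mulr_gt0.
  by case: early badm.
have eK : K * e <= gamma * c / 2.
  have : e <= gamma * c / (2 * K) by rewrite ge_min lexx orbT.
  by rewrite ler_pdivlMr ?mulr_gt0//; lra.
have adm : admissible early (b - e).
  rewrite /admissible/=; case E: early => //=.
  by rewrite subr_ge0 /e E ge_min lexx.
have := admissible_cost adm; rewrite -(support_cost suppb) !costE.
have be : b - e < b by rewrite gtrBl.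
have hm := mean_present_ge be.
have ha := mean_arrived_diff be.
have hc : c <= \sum_j pr (newcomer (b - e) b j).
  rewrite (bigD1 i)//= (le_trans (pr_tie_le i be))// lerDl sumr_ge0// => j _; exact: pr_ge0.
move: hm ha hc; set S := \sum_j _ => hm ha hc.
have ineq1 : alpha / mu * (mean_present (b - e) + S - N%:R * (mu * e)) <= alpha / mu * mean_present b.
  rewrite ler_pM2l ?divr_gt0//; apply: le_trans hm.
  by rewrite opprB addrCA subrr addr0.
have : alpha / mu * (mean_present (b - e) + S - N%:R * (mu * e)) =
    alpha / mu * mean_present (b - e) + alpha / mu * S - alpha * N%:R * e.
  by field; exact: lt0r_neq0.
move=> ineq2.
have ineq3 : 0 <= alpha / mu * S by rewrite mulr_ge0 ?divr_ge0// ?ltW// (lt_le_trans c0).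
have ineq4 : gamma * c <= gamma * mean_arrived b - gamma * mean_arrived (b - e).
  by rewrite -mulrBr ha ler_pM2l.
have ineq5 : - alpha * (b - e) * ((b - e < 0)%R)%:R <= - alpha * b * ((b < 0)%R)%:R + alpha * e.
  have ae : 0 < alpha * e by rewrite mulr_gt0.
  case: (ltP b 0) => b0; case: (ltP (b - e) 0) => be0; rewrite ?mulr1 ?mulr0 ?mulr0n ?mulr1n; try lra.
  have : 0 <= alpha * b by rewrite mulr_ge0// ltW.
  lra.
have gc0 : 0 < gamma * c by rewrite mulr_gt0.
rewrite /K in eK.
lra.
Qed.

Lemma early_cost_ge0 t : 0 <= - alpha * t * ((t < 0)%R)%:R.
Proof.
case: (ltP t 0) => t0; rewrite ?mulr0n ?mulr0// mulr1n mulr1 mulNr oppr_ge0.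
by rewrite mulr_ge0_le0// ltW.
Qed.

Lemma mean_present_cvg0 : mean_present t @[t --> +oo] --> (0 : R).
Proof.
have h : N%:R * queue_prob everyone 1 t @[t --> +oo] --> (0 : R).
  by rewrite -(mulr0 (N%:R : R)); apply: cvgMr; exact: queue_prob1_cvg0.
apply: (squeeze_cvgr _ (cvg_cst 0) h); apply: nearW => t; apply/andP; split; last exact: mean_present_le.
by rewrite (le_trans _ (queue_prob1_le_mean i0 t))// queue_prob_ge0.
Qed.

Lemma mean_arrived_le t : mean_arrived t <= N%:R.
Proof.
rewrite ahead_prob_sum (_ : N%:R = \sum_(i < N) 1); last by rewrite sumr_const card_ord.
apply: ler_sum => i _; rewrite -[leRHS](expect_cst P 1); apply: expect_le => [||w].
- exact/tame_bool/measurable_aheadT.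
- exact: tame_cst.
- by rewrite lern1 leq_b1.
Qed.

Lemma arrival_cdf_lt1 x : F x < 1.
Proof.
rewrite lt_neqAle (arrival_cdf_le1 i0) andbT; apply/eqP => Fx.
pose E := [set u | F u = 1].
have infE : has_inf E.
  split; first by exists x.
  have /cvgrPdist_lt/(_ 1 ltr01) := @arrival_cdf_cvg0 i0.
  move=> [A [Areal HA]]; exists (A - 1) => u Eu; rewrite leNgt; apply/negP => uA.
  have uA' : u < A by apply: lt_trans uA _; rewrite gtrBl.
  by have := HA u uA'; rewrite sub0r normrN Eu normr1 ltxx.
set b := inf E.
have Fgt u : b < u -> F u = 1.
  rewrite -subr_gt0 => ub; have [v Ev vu] := inf_adherent ub infE.
  apply/le_anti; rewrite (arrival_cdf_le1 i0)/= -Ev Fm// ltW// (lt_le_trans vu)//.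
  by rewrite -/b addrC subrK.
have Flt u : u < b -> F u < 1.
  move=> ub; rewrite lt_neqAle (arrival_cdf_le1 i0) andbT; apply/eqP => Fu.
  have := ge_inf (proj2 infE) Fu; rewrite leNgt -/b ub//.
have Fb : F b = 1 by apply: (@arrival_cdf_flat_right i0 b (b + 1)) => [|u /Fgt//]; rewrite ltrDl.
have suppb : cdf_support F b.
  by move=> e e0; rewrite (@Fgt (b + e)) ?ltrDl// Flt// gtrBl.
have := support_admissible suppb; rewrite /admissible /= => adm.
have [hadm|hadm] := boolP (early || (0 < b)); last first.
  move: hadm; rewrite negb_or -leNgt => /andP[ne b0].
  move: adm; rewrite (negbTE ne)/= => b0'.
  have be : b = 0 by apply/le_anti; rewrite b0 b0'.
  by have := F0_lt1 ne; rewrite -be Fb ltxx.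
have nb := null_arrival_admissible hadm.
have mb : 0 < mean_present b.
  by apply: lt_le_trans (queue_prob1_le_mean i0 b); apply: (queue_prob1_gt0 i0) => //; rewrite Fb.
have /cvgrPdist_lt/(_ _ mb) [A [Areal HA]] := mean_present_cvg0.
pose t := Num.max (A + 1) 0.
have tA : A < t by rewrite lt_max ltrDl ltr01.
have t0 : 0 <= t by rewrite le_max lexx orbT.
have := HA t tA; rewrite sub0r normrN => /(le_lt_trans (ler_norm _)) mt.
have := admissible_cost (t := t); rewrite /admissible/= t0 orbT => /(_ isT).
rewrite -(support_cost suppb) !costE mean_arrivedE// Fb mulr1.
have := early_cost_ge0 b.
have -> : (t < 0) = false by apply/negbTE; rewrite -leNgt.
rewrite mulr0n mulr0 add0r.
have : alpha / mu * mean_present t < alpha / mu * mean_present b by rewrite ltr_pM2l ?divr_gt0.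
have : gamma * mean_arrived t <= gamma * N%:R by rewrite ler_pM2l// mean_arrived_le.
lra.
Qed.

Lemma support_unbounded x : exists2 b, cdf_support F b & x <= b.
Proof.
have Fx := arrival_cdf_lt1 x; rewrite -subr_gt0 in Fx.
have /cvgrPdist_lt/(_ _ Fx) [A [Areal HA]] := @arrival_cdf_cvg1 i0.
pose z := Num.max (A + 1) x.
have := HA z; rewrite lt_max ltrDl ltr01 => /(_ isT) hz.
have Fz : F x < F z by have := le_lt_trans (ler_norm _) hz; lra.
have [|b sb /andP[xb _]] := @support_between i0 x z _ Fz.
  by rewrite le_max lexx orbT.
by exists b.
Qed.

Lemma support_upward te t : cdf_support F te -> 0 < te -> te <= t -> cdf_support F t.
Proof.
move=> ste te0; rewrite le_eqVlt => /predU1P[<-//|tet].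
apply: contrapT => /existsNP[e /not_implyP[e0 /negP]]; rewrite -leNgt => Fe.
have te_lb u : u < te -> F u < F t.
  move=> ute; pose e' := Num.min (te - u) (t - te).
  have e'0 : 0 < e' by rewrite lt_min !subr_gt0 ute.
  have h1 : u <= te - e' by rewrite lerBrDl -lerBrDr ge_min lexx.
  have h2 : te + e' <= t by rewrite -lerBrDl ge_min lexx orbT.
  by rewrite (le_lt_trans (Fm h1))// (lt_le_trans (ste _ e'0))// Fm.
have Fte : F (t - e) = F t.
  apply/le_anti; rewrite Fm ?gerBl ?(ltW e0)//=.
  by apply: le_trans Fe; rewrite Fm// lerDl ltW.
pose E := [set u | F t <= F u].
have infE : has_inf E.
  split; first by exists t; exact: lexx.
  by exists te => u /= Eu; rewrite leNgt; apply/negP => /te_lb; rewrite ltNge Eu.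
set a := inf E.
have tea : te <= a.
  apply: lb_le_inf; first by exists t; exact: lexx.
  by move=> u /= Eu; rewrite leNgt; apply/negP => /te_lb; rewrite ltNge Eu.
have at_ : a < t.
  rewrite (@le_lt_trans _ _ (t - e)) ?gtrBl//; apply: ge_inf; first by case: infE.
  by rewrite /E/= Fte.
have Fa : F a = F t.
  apply: (@arrival_cdf_flat_right i0 a t) => // u au ut.
  apply/le_anti; rewrite Fm//=; move: au; rewrite -subr_gt0 => au.
  have [v Ev vu] := inf_adherent au infE.
  by apply: le_trans Ev _; rewrite Fm// ltW// (lt_le_trans vu)// -/a addrC subrK.
have Flt u : u < a -> F u < F a.
  rewrite Fa => ua; rewrite ltNge; apply/negP => Eu.
  by have := ge_inf (proj2 infE) Eu; rewrite leNgt -/a ua.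
have sa : cdf_support F a.
  move=> e' e'0; apply: (@lt_le_trans _ _ (F a)); first by rewrite Flt// gtrBl.
  by rewrite Fm// lerDl ltW.
have a0 : 0 < a := lt_le_trans te0 tea.
have nul u : a <= u -> null_arrival u.
  by move=> au; apply: null_arrival_admissible; rewrite (lt_le_trans a0 au) orbT.
have Fa0 : 0 < F a by rewrite (le_lt_trans (arrival_cdf_ge0 i0 (a - 1)))// Flt// gtrBl.
have hm := mean_present_flat_lt i0 (ltW a0) at_ (fun u au _ => nul u au) Fa Fa0.
have := admissible_cost (t := t); rewrite /admissible/= (ltW (lt_trans a0 at_)) orbT => /(_ isT).
rewrite -(support_cost sa) !costE !mean_arrivedE; [|exact/nul/ltW|exact: nul].
have -> : (t < 0) = false by apply/negbTE; rewrite -leNgt (ltW (lt_trans a0 at_)).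
have -> : (a < 0) = false by apply/negbTE; rewrite -leNgt ltW.
rewrite !mulr0n !mulr0 Fa lerD2r !add0r ler_pM2l ?divr_gt0//.
by rewrite leNgt hm.
Qed.

Lemma mean_present_tail : exists2 te, 0 < te & forall t, te <= t ->
  [/\ null_arrival t, 0 < F t &
      mean_present t = mu * gamma * N%:R / alpha * (1 - F t)].
Proof.
have [te ste te1] := support_unbounded 1.
have te0 : 0 < te := lt_le_trans ltr01 te1.
exists (te + 1); first by rewrite addr_gt0.
move=> t tet1; have tet : te <= t by apply: le_trans tet1; rewrite lerDl.
have nul u : te <= u -> null_arrival u.
  by move=> au; apply: null_arrival_admissible; rewrite (lt_le_trans te0 au) orbT.
split; [exact: nul| |].
  apply: lt_le_trans (Fm tet1); apply: le_lt_trans (ste _ ltr01).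
  exact: (arrival_cdf_ge0 i0).
have cE u : te <= u -> alpha / mu * mean_present u + gamma * (N%:R * F u) = ce.
  move=> teu; rewrite -(support_cost (support_upward ste te0 teu)) costE mean_arrivedE; last exact: nul.
  have -> : (u < 0) = false by apply/negbTE; rewrite -leNgt (le_trans (ltW te0)).
  by rewrite mulr0n mulr0 add0r.
have ceE : ce = gamma * N%:R.
  have h : (alpha / mu * mean_present u + gamma * (N%:R * F u)) @[u --> +oo] --> alpha / mu * 0 + gamma * (N%:R * 1).
    apply: cvgD; first by apply: cvgMr; exact: mean_present_cvg0.
    by apply: cvgMr; apply: cvgMr; exact: (arrival_cdf_cvg1 i0).
  rewrite mulr0 add0r mulr1 in h; apply/esym.
  apply: (@cvg_unique _ _ ((alpha / mu * mean_present u + gamma * (N%:R * F u)) @[u --> +oo])) => //.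
  apply: cvg_near_cst; near=> u; apply: cE.
  by near: u; apply: nbhs_pinfty_ge; exact: num_real.
have := cE t tet; rewrite ceE => h.
have a0 := lt0r_neq0 alpha_gt0; have m0 := lt0r_neq0 mu_gt0.
have -> : mean_present t = mu / alpha * (alpha / mu * mean_present t) by field; rewrite a0 m0.
have -> : alpha / mu * mean_present t = gamma * N%:R - gamma * (N%:R * F t) by rewrite -h addrK.
by field.
Unshelve. all: by end_near. Qed.

End Equilibrium.

Section TailDynamics.
Variables (te kappa : R).
Hypothesis N_gt0 : (0 < N)%N.
Hypothesis te_gt0 : 0 < te.
Hypothesis null_tail : forall t, te <= t -> null_arrival t.
Hypothesis kappa_gt0 : 0 < kappa.
Hypothesis mean_tail : forall t, te <= t -> mean_present t = kappa * (1 - F t).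

Let i0 : 'I_N := Ordinal N_gt0.

Let n : R := N%:R.

Let n_gt0 : 0 < n. Proof. by rewrite ltr0n. Qed.

Let nk_gt0 : 0 < n + kappa. Proof. by rewrite addr_gt0. Qed.

Let c : R := mu / (n + kappa).

Let lam : R := n * c.

Let c_gt0 : 0 < c. Proof. by rewrite divr_gt0. Qed.

Let lam_ge0 : 0 <= lam. Proof. by rewrite mulr_ge0// ltW. Qed.

Let cdf_incr_ge0 s t : s < t -> 0 <= F t - F s.
Proof. by move=> st; rewrite subr_ge0 (arrival_cdf_mono i0)// ltW. Qed.

Let newcomers s t : te <= s -> s < t -> \sum_i pr (newcomer s t i) = n * (F t - F s).
Proof.
move=> ts st; rewrite (eq_bigr (fun=> F t - F s)); last first.
  by move=> i _; rewrite pr_newcomerT//; apply: null_tail => //; exact: le_trans (ltW st).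
by rewrite sumr_const card_ord mulr_natl.
Qed.

Let cdf_lipschitz s t : te <= s -> s < t -> F t - F s <= lam * (t - s).
Proof.
move=> ts st; have := mean_present_ge st.
rewrite newcomers// !mean_tail//; last exact: le_trans (ltW st).
move=> h; rewrite -(ler_pM2l nk_gt0).
have -> : (n + kappa) * (lam * (t - s)) = n * (mu * (t - s)).
  by rewrite /lam /c; field; exact: lt0r_neq0.
lra.
Qed.

Let leak_bounds (s t : R) : s < t ->
  mu * (t - s) - mu ^+ 2 * (t - s) ^+ 2 <= leak s t <= mu * (t - s).
Proof.
move=> st; rewrite leak_le andbT -exprMn; set x := mu * (t - s).
have x0 : 0 < x by rewrite mulr_gt0// subr_gt0.
rewrite mulNr -/x.
have h1 := @expR_ge1Dx R x; have h2 := expRN x; have h3 := expR_gt0 x.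
have h4 : expR (- x) <= (1 + x)^-1 by rewrite h2 lef_pV2// posrE; lra.
have h5 : (1 + x)^-1 <= 1 - x + x ^+ 2.
  rewrite -[leLHS]mulr1 ler_pdivrMl; last by lra.
  have -> : (1 + x) * (1 - x + x ^+ 2) = 1 + x ^+ 3 by ring.
  by rewrite lerDl exprn_ge0// ltW.
by lra.
Qed.

Let leak_sq (s t : R) : s < t -> leak s t ^+ 2 <= mu ^+ 2 * (t - s) ^+ 2.
Proof.
move=> st; have /andP[_ h] := leak_bounds st.
by rewrite -exprMn lerXn2r ?nnegrE ?leak_ge0 ?mulr_ge0 ?subr_ge0// ltW.
Qed.

Let leak_cdf (s t : R) : te <= s -> s < t ->
  leak s t * (F t - F s) <= mu * lam * (t - s) ^+ 2.
Proof.
move=> ts st; have /andP[_ h] := leak_bounds st.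
rewrite (_ : mu * lam * (t - s) ^+ 2 = mu * (t - s) * (lam * (t - s))); last by ring.
by apply: ler_pM => //; rewrite ?leak_ge0 ?cdf_incr_ge0 ?cdf_lipschitz// ltW.
Qed.

Let cdf_rate : exists2 C, 0 <= C & forall s t, te <= s -> s < t ->
  `|F t - F s - (t - s) * (c * queue_prob everyone 1 s)| <= C * (t - s) ^+ 2.
Proof.
exists ((n * (mu ^+ 2 + n * (mu * lam)) + mu ^+ 2) / (n + kappa)).
  have [n0 m0] := (ltW n_gt0, ltW mu_gt0).
  apply: divr_ge0; last exact: ltW.
  by do !(assumption || apply: addr_ge0 || apply: mulr_ge0 || apply: exprn_ge0).
move=> s t ts st; have s0 : 0 <= s by exact: le_trans (ltW te_gt0) ts.
have tt : te <= t by exact: le_trans (ltW st).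
have := mean_present_diff st; rewrite newcomers// !mean_tail//.
set L := \sum_(k < N) _ => eL.
set q := queue_prob everyone 1 s.
have q0 : 0 <= q by exact: queue_prob_ge0.
have q1 : q <= 1 by exact: queue_prob_le1.
have LE : `|L - leak s t * q| <= n * (mu ^+ 2 + n * (mu * lam)) * (t - s) ^+ 2.
  rewrite /L /q -queue_prob_telescope mulr_sumr -sumrB.
  apply: le_trans (ler_norm_sum _ _ _) _.
  apply: (@le_trans _ _ (\sum_(k < N) (mu ^+ 2 + n * (mu * lam)) * (t - s) ^+ 2)); last first.
    by rewrite sumr_const card_ord -mulr_natl mulrA.
  apply: ler_sum => k _.
  apply: le_trans (leaving_approx everyone s0 st (ltn0Sn k)) _.
  rewrite (eq_bigl xpredT) => [|j]; last by rewrite inE.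
  rewrite newcomers// [leRHS]mulrDl lerD ?leak_sq//.
  by rewrite mulrCA -mulrA ler_pM2l// leak_cdf.
have /andP[l1 l2] := leak_bounds st.
have l3 : `|leak s t * q - mu * (t - s) * q| <= mu ^+ 2 * (t - s) ^+ 2.
  rewrite -mulrBl normrM (ger0_norm q0) -[leRHS]mulr1 ler_pM//.
  by rewrite ler_norml; apply/andP; split; have := sqr_ge0 (t - s); have := sqr_ge0 mu; nra.
rewrite -(ler_pM2l nk_gt0) -[X in X * `|_|](gtr0_norm nk_gt0) -normrM.
have -> : (n + kappa) * (F t - F s - (t - s) * (c * q)) = (L - leak s t * q) + (leak s t * q - mu * (t - s) * q).
  have -> : L = (n + kappa) * (F t - F s) by move: eL; lra.
  by rewrite /c; field; exact: lt0r_neq0.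
apply: le_trans (ler_normD _ _) _; apply: le_trans (lerD LE l3) _.
by rewrite le_eqVlt; apply/orP; left; apply/eqP; field; exact: lt0r_neq0.
Qed.

Let gap_bounds (J : {set 'I_N}) k s : 0 <= queue_prob J k s - queue_prob J k.+1 s <= 1.
Proof.
rewrite subr_ge0 queue_prob_anti/=.
by have := queue_prob_le1 J k s; have := queue_prob_ge0 J k.+1 s; lra.
Qed.

Let inflow_bounds (J : {set 'I_N}) k s :
  0 <= \sum_(i in J) (queue_prob (J :\ i) k s - queue_prob (J :\ i) k.+1 s) <= n.
Proof.
apply/andP; split; first by apply: sumr_ge0 => i _; have /andP[] := gap_bounds (J :\ i) k s.
apply: (@le_trans _ _ (\sum_(i in J) 1)).
  by apply: ler_sum => i _; have /andP[] := gap_bounds (J :\ i) k s.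
by rewrite sumr_const ler_nat -[leqRHS]card_ord max_card.
Qed.

Let queue_prob_rate J k : exists2 C, 0 <= C & forall s t, te <= s -> s < t ->
  `|queue_prob J k.+1 t - queue_prob J k.+1 s - (t - s) * drift queue_prob mu kappa J k s| <= C * (t - s) ^+ 2.
Proof.
have [C C0 HC] := cdf_rate.
exists (mu ^+ 2 + n * (mu * lam) + n ^+ 3 * lam ^+ 2 + mu ^+ 2 + C * n).
  have [n0 m0] := (ltW n_gt0, ltW mu_gt0).
  by do !(assumption || apply: addr_ge0 || apply: mulr_ge0 || apply: exprn_ge0).
move=> s t ts st; have s0 : 0 <= s by exact: le_trans (ltW te_gt0) ts.
have tt : te <= t by exact: le_trans (ltW st).
have Fst : F s <= F t by rewrite -subr_ge0 cdf_incr_ge0.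
have := queue_prob_step J s0 st Fst (null_tail ts) (null_tail tt) (ltn0Sn k).
have := HC _ _ ts st.
have /andP[S0 Sn] := inflow_bounds J k s.
have /andP[g0 g1] := gap_bounds J k.+1 s.
have /andP[l1 l2] := leak_bounds st.
have e1 := leak_sq st; have e2 := leak_cdf ts st.
have e3 : (F t - F s) ^+ 2 <= lam ^+ 2 * (t - s) ^+ 2.
  have d1 := cdf_incr_ge0 st; have d2 := cdf_lipschitz ts st.
  by rewrite -exprMn lerXn2r// nnegrE// (le_trans d1).
rewrite /drift /= -/n.
move: S0 Sn g0 g1 l1 l2 e1 e2 e3.
set S := \sum_(_ in _) _; set D := F t - F s; set g := _ - queue_prob J k.+2 s.
set l := leak s t; set x := t - s; set q := c * _.
set A := queue_prob J k.+1 t - queue_prob J k.+1 s.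
move=> S0 Sn g0 g1 l1 l2 e1 e2 e3 hF hQ.
have h1 : `|l * g - mu * x * g| <= mu ^+ 2 * x ^+ 2.
  rewrite -mulrBl normrM (ger0_norm g0) -[leRHS]mulr1 ler_pM//.
  rewrite ler_norml; apply/andP; split; first lra.
  have := mulr_ge0 (sqr_ge0 mu) (sqr_ge0 x); lra.
have h2 : `|D * S - x * q * S| <= C * n * x ^+ 2.
  by rewrite -mulrBl normrM (ger0_norm S0) [leRHS]mulrAC ler_pM.
have h3 : n * (l * D) <= n * (mu * lam) * x ^+ 2 by rewrite -[leRHS]mulrA ler_pM2l.
have h4 : n ^+ 3 * D ^+ 2 <= n ^+ 3 * lam ^+ 2 * x ^+ 2.
  by rewrite -[leRHS]mulrA ler_pM2l// exprn_gt0.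
move: h1 h2 hQ; rewrite !ler_norml => /andP[? ?] /andP[? ?] /andP[? ?].
by apply/andP; split; lra.
Qed.

Let queue_drift_bound J k s : `|drift queue_prob mu kappa J k s| <= mu + c * n.
Proof.
have /andP[S0 Sn] := inflow_bounds J k s; have /andP[g0 g1] := gap_bounds J k.+1 s.
have q0 := queue_prob_ge0 everyone 1 s; have q1 := queue_prob_le1 everyone 1 s.
rewrite /drift; apply: le_trans (ler_normD _ _) _; apply: lerD.
  by rewrite normrM normrN (gtr0_norm mu_gt0) (ger0_norm g0) ger_pMr.
rewrite (ger0_norm (mulr_ge0 (mulr_ge0 (ltW c_gt0) q0) S0)) -mulrA ler_pM2l//.
by rewrite -[leRHS]mul1r ler_pM.
Qed.

Let queue_prob_continuous J k t : te < t -> {for t, continuous (queue_prob J k)}.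
Proof.
case: k => [|k] tet.
  rewrite (_ : queue_prob J 0 = fun=> 1); first exact: cvg_cst.
  by apply/funext => u; rewrite queue_prob0.
have [C C0 HC] := queue_prob_rate J k.
by apply: (quadratic_estimate_continuous C0 HC _ tet) => s _; exact: queue_drift_bound.
Qed.

Lemma is_derive_queue_prob J k t : te < t ->
  is_derive t 1 (queue_prob J k.+1) (drift queue_prob mu kappa J k t).
Proof.
move=> tet; have [C C0 HC] := queue_prob_rate J k.
apply: (quadratic_estimate_derive C0 HC _ tet).
rewrite /drift; apply: cvgD.
  by apply: cvgMr; apply: cvgB; exact: queue_prob_continuous.
apply: cvgM; first by apply: cvgMr; exact: queue_prob_continuous.
apply: cvg_big => [|i _]; first exact: add_continuous.
by apply: cvgB; exact: queue_prob_continuous.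
Qed.

Lemma is_derive_tail t : te < t ->
  is_derive t 1 (fun u => 1 - F u) (- (c * queue_prob everyone 1 t)).
Proof.
move=> tet; have [C C0 HC] := cdf_rate.
have h : is_derive t 1 F (c * queue_prob everyone 1 t).
  by apply: (quadratic_estimate_derive C0 HC _ tet); apply: cvgMr; exact: queue_prob_continuous.
by have := is_deriveB (is_derive_cst (1 : R) t 1) h; rewrite sub0r.
Qed.

Lemma queue_prob_full_gt0 t : te <= t -> 0 < F t -> 0 < queue_prob everyone N t.
Proof.
move=> tet Ft.
pose B (k : 'I_N + 'I_N + option 'I_N) : set R :=
  match k with inl (inl _) => `]-oo, t]%classic | inl (inr _) => `]t, +oo[%classic | inr _ => setT end.
pose J : {set 'I_N + 'I_N + option 'I_N} :=
  [set k | if k is inl _ then true else false]%SET.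
have mB k : measurable (B k) by case: k => [[i|i]|o]; [exact: measurable_itv..|exact: measurableT].
have e : P (\bigcap_(k in [set` J]) (primitives k @^-1` B k)) =
  (\prod_(k in J) fine (P (primitives k @^-1` B k)))%:E := @customers_indep _ _ _ _ _ _ _ M J B mB.
pose p (w : T) := [forall i, (arrival M i w <= t) && (t < service M i w)].
have mp : measurable_fun [set: T] p.
  apply: measurable_forall => i; apply: measurable_and; first exact: measurable_arrival_le.
  by apply: measurable_fun_ltr; [exact: measurable_cst|exact: measurable_service].
have pp : 0 < pr p.
  rewrite prE// (_ : [set w | p w] = \bigcap_(k in [set` J]) (primitives k @^-1` B k)).
    rewrite e/=; apply: prodr_gt0 => -[[i|i]|o]; rewrite inE// => _ /=.
    - have := pr_arrival_le i t; rewrite prE; last exact: measurable_arrival_le.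
      rewrite (_ : [set w | _] = arrival M i @^-1` `]-oo, t]); first by move=> ->.
      by apply/seteqP; split => w /=; rewrite in_itv.
    - have := service_tail i t; rewrite prE; last first.
        by apply: measurable_fun_ltr; [exact: measurable_cst|exact: measurable_service].
      rewrite (_ : [set w | _] = service M i @^-1` `]t, +oo[); first by move=> ->; exact: expR_gt0.
      by apply/seteqP; split => w /=; rewrite in_itv/= andbT.
  apply/seteqP; split => w /=.
    by move=> /forallP h [[i|i]|o] _ /=; rewrite ?in_itv/= ?andbT//; case/andP: (h i).
  move=> h; apply/forallP => i; apply/andP; split.
    have : B (inl (inl i)) (arrival M i w) by apply: (h (inl (inl i))); rewrite /= inE.
    by rewrite /= in_itv.
  have : B (inl (inr i)) (service M i w) by apply: (h (inl (inr i))); rewrite /= inE.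
  by rewrite /= in_itv/= andbT.
pose z w := [exists i, arrival M i w == t].
have mz : measurable_fun [set: T] z.
  by apply: measurable_exists => i; exact: measurable_arrival_eq.
have z0 : pr z = 0.
  apply/le_anti; rewrite pr_ge0 andbT.
  have <- : \sum_i pr (fun w => arrival M i w == t) = 0.
    by rewrite big1// => i _; exact: null_tail.
  rewrite -expect_sum; last by move=> i; apply: tame_bool; exact: measurable_arrival_eq.
  apply: expect_le => [||w]; first exact: tame_bool.
    by apply: tame_sum => i; apply: tame_bool; exact: measurable_arrival_eq.
  case: (boolP (z w)) => [/existsP[i iw]|_]; last by apply: sumr_ge0 => i _; exact: ler0n.
  by rewrite (bigD1 i)//= iw lerDl; apply: sumr_ge0 => j _; exact: ler0n.
have mgp : measurable_fun [set: T] (fun w => good w && p w).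
  by apply: measurable_and => //; exact: measurable_good.
apply: (lt_le_trans pp); apply: (@le_trans _ _ (pr (fun w => good w && p w))).
  by apply: pr_le_good => // w -> ->.
apply: (pr_le_null mgp _ mz _ z0); first exact: measurable_presentT.
move=> w /andP[gw /forallP pw]; apply/orP.
case: (boolP (z w)) => [|/existsPn zw]; [by right|left].
rewrite (@present_all everyone t w gw) ?cardsT ?card_ord// => i _; have /andP[Xt ->] := pw i; rewrite andbT /ahead.
by move: Xt (zw i); rewrite le_eqVlt => /orP[->//|->].
Qed.

End TailDynamics.

End Customers.

Theorem lemma3p5 (R : realType) (d : measure_display) (T : measurableType d)
    (P : probability T R) (N : nat) (alpha gamma mu : R) (F : R -> R)
    (M : customers P N mu F) (early : bool)
    (hN : (2 <= N)%N) (halpha : 0 < alpha) (hgamma : 0 < gamma) (hmu : 0 < mu)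
    (heq : symmetric_equilibrium M early alpha gamma)
    (hp0 : ~~ early -> F 0 < 1) :
  [/\ exists tau : R, forall t s : R, tau < t -> 0 < s ->
        0 <= hazard_rate M alpha gamma (t + s) - hazard_rate M alpha gamma t,
      exists2 eta : R, 0 < eta &
        exists l : R, expR (eta * t) * (1 - F t) @[t --> +oo] --> l
    & exists2 eta : R, eta < mu &
        exists2 C : R, 0 < C &
          expR (eta * t) * (1 - F t) @[t --> +oo] --> C].
Proof.
have [_ adm [ce [cost_eq cost_ge]]] := heq.
have N0 : (0 < N)%N by exact: ltnW.
have [te te0 tail] := mean_present_tail hmu N0 halpha hgamma adm cost_eq cost_ge hp0.
pose kappa := mu * gamma * N%:R / alpha.
have n0 : 0 < N%:R :> R by rewrite ltr0n.
have kappa0 : 0 < kappa by rewrite divr_gt0// !mulr_gt0.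
have null t : te <= t -> null_arrival M t by case/tail.
have meanE t : te <= t -> mean_present M t = kappa * (1 - F t) by case/tail.
have G0 t : te < t -> 0 < 1 - F t.
  by move=> _; rewrite subr_gt0 (arrival_cdf_lt1 hmu N0 halpha hgamma adm cost_eq cost_ge hp0).
have Gcvg : (1 - F t) @[t --> +oo] --> (0 : R).
  rewrite -(subrr 1); apply: cvgB; first exact: cvg_cst.
  exact: (arrival_cdf_cvg1 M (Ordinal N0)).
have P0 t : te < t -> 0 < queue_prob M [set: 'I_N]%SET N t.
  by move=> tet; apply: (@queue_prob_full_gt0 _ _ _ _ _ _ _ M te null t (ltW tet)); case: (tail _ (ltW tet)).
have sumP t : te < t -> \sum_(k < N) queue_prob M [set: 'I_N]%SET k.+1 t = kappa * (1 - F t).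
  by move=> tet; rewrite -(meanE _ (ltW tet)) mean_presentE.
have dG t := @is_derive_tail _ _ _ _ _ _ _ M hmu _ _ N0 te0 null kappa0 meanE t.
have dq J k t := @is_derive_queue_prob _ _ _ _ _ _ _ M hmu _ _ N0 te0 null kappa0 meanE J k t.
have mono := busy_ratio_eventually_nondecreasing hN hmu kappa0 G0 Gcvg
  (queue_prob_ge0 M) (queue_prob0 M) (queue_prob_anti M) (@queue_prob_subset _ _ _ _ _ _ _ M)
  (@queue_prob_gt _ _ _ _ _ _ _ M) P0 sumP dG dq.
have lim := exponential_tail_limit hN hmu kappa0 G0 Gcvg
  (queue_prob_ge0 M) (queue_prob0 M) (queue_prob_anti M) (@queue_prob_subset _ _ _ _ _ _ _ M)
  (@queue_prob_gt _ _ _ _ _ _ _ M) P0 sumP dG dq.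
pose eta := mu / (N%:R + kappa) * kappa.
have nk0 : 0 < N%:R + kappa by rewrite addr_gt0.
have eta0 : 0 < eta by rewrite mulr_gt0// divr_gt0.
have eta_mu : eta < mu by rewrite /eta mulrAC ltr_pdivrMr// ltr_pM2l// ltrDr.
split.
- have [tau Htau] := mono; exists tau => t s taut s0.
  have coef : 0 <= alpha / (N%:R * (alpha / mu + gamma)).
    by rewrite ltW// divr_gt0// mulr_gt0// addr_gt0// divr_gt0.
  have hazE u : hazard_rate M alpha gamma u = alpha / (N%:R * (alpha / mu + gamma)) *
      (queue_prob M [set: 'I_N]%SET 1 u / (1 - F u)).
    by rewrite /hazard_rate /equilibrium_density prob_emptyE; ring.
  rewrite !hazE -mulrBr mulr_ge0// subr_ge0; apply: Htau => //.
  by rewrite lerDl ltW.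
- by exists eta => //; have [C _ HC] := lim; exists C.
- by exists eta => //; have [C C0 HC] := lim; exists C.
Qed.
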